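(* Let $(c,E)$ be real parameters in one of the four regimes: (i) $|c|<1$, $E<0$; (ii) $|c|>1$, $E>2$; (iii) $|c|<1$, $0<E\le 2$; (iv) $|c|>1$, $0<E\le 2$. Then for every nonzero real $\zeta$, $\operatorname{Re}\,I(\zeta)=0$, where $I(\zeta)$ is defined in the context.
   Context: Let $g_2=\frac{4-2E+E^2}{3(c^2-1)^2}$ and $g_3=\frac{8-6E-3E^2+E^3}{27(c^2-1)^3}$, let $\wp(\cdot)=\wp(\cdot;g_2,g_3)$ be the Weierstrass elliptic function with these invariants and $\zeta_w$ the corresponding Weierstrass zeta function, and let $e_1>e_2>e_3$ be the (real) roots of $4s^3-g_2s-g_3$ (they are $\frac{E-1}{3(c^2-1)}$, $\frac{E+2}{6(1-c^2)}$, $\frac{4-E}{6(c^2-1)}$ in some order). Let $\omega_1=\int_{e_1}^{\infty}\frac{ds}{\sqrt{4s^3-g_2s-g_3}}$ be the real half-period. For $\zeta\in\mathbb{C}\setminus\{0\}$ let $\Omega(\zeta)$ be a complex number with $$\Omega(\zeta)^2=\frac{1}{64}\left(-8(c^2-1)(E-1)-\frac{(c-1)^2}{\zeta^2}-16(c+1)^2\zeta^2\right),$$ let $C_4=\frac{8}{3}\zeta\left((c-1)(E-1)+12(c+1)\zeta^2-24i\zeta\Omega(\zeta)\right)$, $C_5=16(c-1)^2(c+1)\zeta$, let $\rho$ be any complex number with $\wp(\rho)=-C_4/C_5$, and let $\nu=+1$ if $-\frac{\pi}{2}<\arg\left(\frac{\zeta\left(-i(c-1)(E-1)-4i(c+1)\zeta^2-8\zeta\Omega(\zeta)\right)}{(c-1)^3(c+1)}\right)\le\frac{\pi}{2}$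 and $\nu=-1$ otherwise. Then $$I(\zeta)=\frac{2\omega_1\left(i\zeta+\Omega(\zeta)\right)}{c-1}+2\nu\left(\zeta_w(\rho)\,\omega_1-\zeta_w(\omega_1)\,\rho\right).$$ The condition $\operatorname{Re} I(\zeta)=0$ characterizes the Lax spectrum: the set of $\zeta$ for which the $z$-part of the sine-Gordon Lax pair, evaluated at the stationary periodic solution $\cos f(z)=\alpha+\frac{\beta}{k^2\lambda^2}(\wp(z+\omega_3)-e_3)$ of $(c^2-1)f''+\sin f=0$ with energy $\frac12(c^2-1)f'^2+1-\cos f=E$, has a bounded solution.
   Formalization: The boundary value E = 2 in regimes (iii) and (iv) is effectively excluded: there two roots of the cubic coincide, so e1 > e2 > e3 fails, no elliptic function with these invariants exists, and for |c| > 1 the integral for omega_1 diverges. *)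

(* Defs.v *)
From Stdlib Require Import Reals ZArith Bool.
From Coquelicot Require Import Coquelicot.
Open Scope R_scope.

(** * Principal argument of a complex number, with values in (-PI, PI], arg 0 = 0 *)
Definition Carg (z : C) : R :=
  let x := Re z in let y := Im z in
  if Rlt_dec 0 x then atan (y / x)
  else if Rlt_dec x 0 then
    (if Rle_dec 0 y then atan (y / x) + PI else atan (y / x) - PI)
  else if Rlt_dec 0 y then PI / 2
  else if Rlt_dec y 0 then - (PI / 2)
  else 0.

Definition lat_pt (w1 w2 : C) (m n : Z) : C :=
  (RtoC (IZR m) * w1 + RtoC (IZR n) * w2)%C.

Definition in_lattice (w1 w2 z : C) : Prop :=
  exists m n : Z, z = lat_pt w1 w2 m n.

Definition is_lattice_basis (w1 w2 : C) : Prop :=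
  w1 <> 0%C /\ Im (w2 / w1)%C <> 0.

Definition sq_partial (f : Z -> Z -> C) (N : nat) : C :=
  @sum_n C_AbelianMonoid (fun i =>
    @sum_n C_AbelianMonoid (fun j =>
      let m := (Z.of_nat i - Z.of_nat N)%Z in
      let n := (Z.of_nat j - Z.of_nat N)%Z in
      if (Z.eqb m 0 && Z.eqb n 0)%bool then RtoC 0 else f m n) (2 * N)) (2 * N).

(** the sum over the punctured lattice (all sums used below are absolutely
    convergent, so the square partial sums converge to the sum) *)
Definition lattice_sum (f : Z -> Z -> C) : C :=
  @lim (CompleteNormedModule.CompleteSpace _ C_CompleteNormedModule) (filtermap (sq_partial f) eventually).

Definition lat_g2 (w1 w2 : C) : C :=
  (RtoC 60 * lattice_sum (fun m n => let w := lat_pt w1 w2 m n in / (w*w*w*w)))%C.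
Definition lat_g3 (w1 w2 : C) : C :=
  (RtoC 140 * lattice_sum (fun m n => let w := lat_pt w1 w2 m n in / (w*w*w*w*w*w)))%C.

(** Weierstrass wp and zeta functions of the lattice (for z off the lattice) *)
Definition wp (w1 w2 z : C) : C :=
  (/ (z*z) + lattice_sum (fun m n => let w := lat_pt w1 w2 m n in
      / ((z - w) * (z - w)) - / (w * w)))%C.
Definition wzeta (w1 w2 z : C) : C :=
  (/ z + lattice_sum (fun m n => let w := lat_pt w1 w2 m n in
      / (z - w) + / w + z / (w * w)))%C.

Definition g2 (c E : R) : R := (4 - 2*E + E^2) / (3 * (c^2 - 1)^2).
Definition g3 (c E : R) : R := (8 - 6*E - 3*E^2 + E^3) / (27 * (c^2 - 1)^3).

Definition cubic (c E s : R) : R := 4 * s^3 - g2 c E * s - g3 c E.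

Definition rootA (c E : R) : R := (E - 1) / (3 * (c^2 - 1)).
Definition rootB (c E : R) : R := (E + 2) / (6 * (1 - c^2)).
Definition rootC (c E : R) : R := (4 - E) / (6 * (c^2 - 1)).
Definition e1 (c E : R) : R := Rmax (rootA c E) (Rmax (rootB c E) (rootC c E)).

Definition Omega2 (c E zeta : R) : C :=
  RtoC ((-8 * (c^2 - 1) * (E - 1) - (c - 1)^2 / zeta^2 - 16 * (c + 1)^2 * zeta^2) / 64).

Definition C4 (c E zeta : R) (Om : C) : C :=
  (RtoC (8/3 * zeta) *
   (RtoC ((c - 1) * (E - 1) + 12 * (c + 1) * zeta^2) - RtoC (24 * zeta) * Ci * Om))%C.
Definition C5 (c zeta : R) : C := RtoC (16 * (c - 1)^2 * (c + 1) * zeta).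

Definition nu (c E zeta : R) (Om : C) : R :=
  let W := (RtoC zeta *
            (- Ci * RtoC ((c - 1) * (E - 1)) - Ci * RtoC (4 * (c + 1) * zeta^2)
             - RtoC (8 * zeta) * Om) / RtoC ((c - 1)^3 * (c + 1)))%C in
  if Rlt_dec (- (PI / 2)) (Carg W) then
    (if Rle_dec (Carg W) (PI / 2) then 1 else -1) else -1.

(** I(zeta), given the lattice (w1,w2), the real half period om1,
    the chosen Omega and the chosen rho *)
Definition I_fun (c E zeta : R) (w1 w2 : C) (om1 : R) (Om rho : C) : C :=
  (RtoC (2 * om1) * (Ci * RtoC zeta + Om) / RtoC (c - 1)
   + RtoC (2 * nu c E zeta Om) *
     (wzeta w1 w2 rho * RtoC om1 - wzeta w1 w2 (RtoC om1) * rho))%C.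

(* Main.v *)
(** For real [zeta] the number [Omega ^ 2] is real and nonpositive, so [Omega] is imaginary, the first
    term of [I] is imaginary, [p = wp rho] is real and [wp' rho ^ 2 = 4 p ^ 3 - g2 p - g3 <= 0].  Since
    the invariants are real the lattice is stable under conjugation, hence
    [wp (conj rho) = wp (- rho)] and [wp' (conj rho) = wp' (- rho)].  By uniqueness for
    [wp'' = 6 wp ^ 2 - g2 / 2] this forces [conj rho + rho] to be a lattice point; the real lattice
    points are the multiples of [2 om1], and the quasi-periodicity of the zeta function turns
    [2 Re rho = 2 n om1] into [Re (zeta rho) = n zeta om1].

    The differential equation comes from Eisenstein's identity
    [sum 1/(z-w)^5 = wp z * sum 1/(z-w)^3].  Uniqueness for the differential equation is propagated
    along segments through the poles, which replaces Liouville's theorem everywhere: two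
    lattices with the same invariants coincide, [wp] and [wp'] determine a point modulo the lattice,
    and the first zero of [wp'] on the positive real axis is a half period. *)

Require Import Defs.
From Stdlib Require Import Reals ZArith Bool Lra Lia List Psatz Permutation.
From Stdlib Require Import Classical ClassicalEpsilon FunctionalExtensionality.
From Stdlib Require FinFun Ranalysis5.
From Coquelicot Require Import Coquelicot.
Open Scope R_scope.

(** * Unordered sums over Z x Z *)

(** The basis is arbitrary and known only through its invariants, so neither its stability under
    conjugation nor the position of [om1] can be read off; both have to come from the differential
    equation. Hence the uniqueness statement compares two lattices and must cross poles. There the
    difference of two solutions satisfies [D'' = 6 (P + Q) D] with coefficient close to
    [12 / s ^ 2], whose model solutions are [s ^ 4] and [s ^ (-3)]. The two invariants fix the
    Laurent expansion through [z ^ 4], so the difference is [O(s ^ 5)] and has to vanish. The square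
    partial sums of the definitions are replaced by unordered sums, which every bijection of the
    index set preserves; translations, sign changes and changes of basis then act on indices only.
    The delicate estimate is the interchange of summations in Eisenstein's identity. Its terms have
    total decay of degree 5 in two lattice points, and each of the two sums needs more than degree 2
    to converge: the even split [5/2 + 5/2] is the origin of the weight with exponent 5/4. *)

Fixpoint sumC {A} (f : A -> C) (l : list A) : C :=
  match l with nil => 0%C | cons p l => (f p + sumC f l)%C end.
Fixpoint sumR {A} (f : A -> R) (l : list A) : R :=
  match l with nil => 0 | cons p l => f p + sumR f l end.

Lemma sumC_app {A} (f : A -> C) l l' : sumC f (l ++ l') = (sumC f l + sumC f l')%C.
Proof. induction l; cbn [sumC sumR app map]; [|rewrite IHl]; ring. Qed.
Lemma sumR_app {A} (f : A -> R) l l' : sumR f (l ++ l') = sumR f l + sumR f l'.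
Proof. induction l; cbn [sumC sumR app map]; [|rewrite IHl]; ring. Qed.
Lemma sumC_plus {A} (f g : A -> C) l :
  sumC (fun p => f p + g p)%C l = (sumC f l + sumC g l)%C.
Proof. induction l; cbn [sumC sumR app map]; [|rewrite IHl]; ring. Qed.
Lemma sumC_scal {A} (c : C) (f : A -> C) l : sumC (fun p => c * f p)%C l = (c * sumC f l)%C.
Proof. induction l; cbn [sumC sumR app map]; [|rewrite IHl]; ring. Qed.
Lemma sumR_scal {A} (c : R) (f : A -> R) l : sumR (fun p => c * f p) l = c * sumR f l.
Proof. induction l; cbn [sumC sumR app map]; [|rewrite IHl]; ring. Qed.
Lemma sumC_ext {A} (f g : A -> C) l : (forall p, f p = g p) -> sumC f l = sumC g l.
Proof. intros H; induction l; cbn [sumC map]; [auto|rewrite IHl, H; auto]. Qed.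
Lemma sumC_conj {A} (f : A -> C) l : sumC (fun p => Cconj (f p)) l = Cconj (sumC f l).
Proof.
  induction l; cbn [sumC]; [apply injective_projections; simpl; ring|rewrite IHl, Cplus_conj; auto].
Qed.
Lemma sumC_map {A B} (h : A -> B) (f : B -> C) l : sumC f (map h l) = sumC (fun p => f (h p)) l.
Proof. induction l; cbn [sumC map]; [auto|rewrite IHl; auto]. Qed.
Lemma sumC_Cmod {A} (f : A -> C) (g : A -> R) l :
  (forall p, Cmod (f p) <= g p) -> Cmod (sumC f l) <= sumR g l.
Proof.
  intros H; induction l; simpl; [rewrite Cmod_0; lra|].
  eapply Rle_trans; [apply Cmod_triangle|]. specialize (H a); lra.
Qed.
Lemma sumR_pos {A} (f : A -> R) l : (forall p, 0 <= f p) -> 0 <= sumR f l.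
Proof. intros H; induction l; simpl; [lra|]. specialize (H a); lra. Qed.

Lemma sumR_incl {A} (f : A -> R) l l' : (forall p, 0 <= f p) -> NoDup l -> incl l l' ->
  sumR f l <= sumR f l'.
Proof.
  intros Hf Hl; revert l'; induction Hl as [|x l Hx Hl IH]; intros l' Hi; simpl.
  - apply sumR_pos; auto.
  - destruct (in_split x l') as [l1 [l2 E]]; [apply Hi; left; auto|]. subst l'.
    rewrite sumR_app; simpl.
    assert (sumR f l <= sumR f (l1 ++ l2)).
    { apply IH. intros y Hy. assert (Hy' : In y (l1 ++ x :: l2)) by (apply Hi; right; auto).
      apply in_app_iff in Hy'. apply in_app_iff. destruct Hy' as [?|[?|?]]; auto. subst; tauto. }
    rewrite sumR_app in H. lra.
Qed.

(** Splitting off the tail [r] as a duplicate-free list disjoint from [l] lets [wgt_tail] bound what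
    lies outside a square. *)
Lemma sumC_diff {A} (f : A -> C) l l' : NoDup l -> NoDup l' -> incl l l' ->
  exists r, NoDup r /\ (forall p, In p r -> In p l' /\ ~ In p l) /\
    sumC f l' = (sumC f l + sumC f r)%C.
Proof.
  intros Hl; revert l'; induction Hl as [|x l Hx Hl IH]; intros l' Hl' Hi; simpl.
  - exists l'. repeat split; auto. ring.
  - destruct (in_split x l') as [l1 [l2 E]]; [apply Hi; left; auto|]. subst l'.
    pose proof (NoDup_remove_1 _ _ _ Hl') as Hn1. pose proof (NoDup_remove_2 _ _ _ Hl') as Hn2.
    destruct (IH (l1 ++ l2)) as [r [Hr1 [Hr2 Hr3]]]; auto.
    { intros y Hy. assert (Hy' : In y (l1 ++ x :: l2)) by (apply Hi; right; auto).
      apply in_app_iff in Hy'. apply in_app_iff. destruct Hy' as [?|[?|?]]; auto. subst; tauto. }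
    exists r. split; [auto|]. split.
    + intros p Hp. destruct (Hr2 p Hp) as [Ha Hb]. split.
      * apply in_app_iff in Ha. apply in_app_iff. simpl. tauto.
      * intros [E|E]; [|tauto]. subst p. tauto.
    + rewrite sumC_app in *. simpl. rewrite <- Cplus_assoc, <- Hr3. ring.
Qed.

Definition zrange (N : nat) : list Z := map (fun i => (Z.of_nat i - Z.of_nat N)%Z) (seq 0 (S (2 * N))).
Definition square (N : nat) : list (Z * Z) := list_prod (zrange N) (zrange N).

Lemma in_zrange N k : In k (zrange N) <-> (Z.abs k <= Z.of_nat N)%Z.
Proof.
  unfold zrange. rewrite in_map_iff. split.
  - intros [i [E H]]. apply in_seq in H. lia.
  - intros H. exists (Z.to_nat (k + Z.of_nat N)). split; [lia|]. apply in_seq. lia.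
Qed.
Lemma NoDup_zrange N : NoDup (zrange N).
Proof. unfold zrange. apply FinFun.Injective_map_NoDup; [intros x y; lia|apply seq_NoDup]. Qed.
Lemma in_square N p : In p (square N) <-> (Z.abs (fst p) <= Z.of_nat N /\ Z.abs (snd p) <= Z.of_nat N)%Z.
Proof. destruct p as [m n]. unfold square. rewrite in_prod_iff, !in_zrange. simpl. tauto. Qed.
Lemma NoDup_square N : NoDup (square N).
Proof.
  unfold square. generalize (NoDup_zrange N). generalize (zrange N) at 1 2. intros l0 H1.
  induction H1 as [|x l Hx Hl IH]; cbn [list_prod].
  - constructor.
  - apply NoDup_app; auto.
    + apply FinFun.Injective_map_NoDup; [intros a b E; congruence|apply NoDup_zrange].
    + intros p Hp Hq. apply in_map_iff in Hp. destruct Hp as [y [E _]]. subst p.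
      apply in_prod_iff in Hq. tauto.
Qed.
Lemma square_mono N M : (N <= M)%nat -> incl (square N) (square M).
Proof. intros H p. rewrite !in_square. lia. Qed.
Lemma square_cover (l : list (Z * Z)) : exists N, incl l (square N).
Proof.
  induction l as [|p l [N H]].
  - exists 0%nat. intros p [].
  - exists (N + Z.to_nat (Z.abs (fst p)) + Z.to_nat (Z.abs (snd p)))%nat.
    intros q [E|Hq].
    + subst. apply in_square. lia.
    + eapply square_mono; [|apply H; auto]. lia.
Qed.

(** Convergence along all finite sets that contain a large square, that is, unconditional
    convergence. Unlike the limit of square partial sums, it is preserved by every bijection of the
    indices, which is what shifts by a lattice point require. *)
Definition is_sum (f : Z * Z -> C) (s : C) : Prop :=
  forall eps : R, 0 < eps -> exists N, forall l, NoDup l -> incl (square N) l ->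
    Cmod (sumC f l - s)%C < eps.

Lemma is_sum_ext f g s : (forall p, f p = g p) -> is_sum f s -> is_sum g s.
Proof. intros H. replace g with f; auto. apply functional_extensionality; auto. Qed.

Lemma is_sum_plus f g s t : is_sum f s -> is_sum g t -> is_sum (fun p => f p + g p)%C (s + t)%C.
Proof.
  intros Hf Hg eps He. destruct (Hf (eps / 2)) as [N HN]; [lra|].
  destruct (Hg (eps / 2)) as [M HM]; [lra|]. exists (N + M)%nat. intros l Hl Hi.
  rewrite sumC_plus.
  replace (sumC f l + sumC g l - (s + t))%C with ((sumC f l - s) + (sumC g l - t))%C by ring.
  eapply Rle_lt_trans; [apply Cmod_triangle|].
  assert (Cmod (sumC f l - s)%C < eps / 2).
  { apply HN; auto. eapply incl_tran; [|apply Hi]. apply square_mono; lia. }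
  assert (Cmod (sumC g l - t)%C < eps / 2).
  { apply HM; auto. eapply incl_tran; [|apply Hi]. apply square_mono; lia. }
  lra.
Qed.

Lemma is_sum_scal c f s : is_sum f s -> is_sum (fun p => c * f p)%C (c * s)%C.
Proof.
  intros Hf eps He. pose proof (Cmod_ge_0 c) as Hc.
  destruct (Hf (eps / (1 + Cmod c))) as [N HN]; [apply Rdiv_lt_0_compat; lra|].
  exists N. intros l Hl Hi. rewrite sumC_scal.
  replace (c * sumC f l - c * s)%C with (c * (sumC f l - s))%C by ring.
  rewrite Cmod_mult. specialize (HN l Hl Hi).
  apply Rle_lt_trans with (Cmod c * (eps / (1 + Cmod c))).
  - apply Rmult_le_compat_l; lra.
  - apply Rmult_lt_reg_r with (1 + Cmod c); [lra|]. unfold Rdiv.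
    replace (Cmod c * (eps * / (1 + Cmod c)) * (1 + Cmod c)) with (Cmod c * eps) by (field; lra). nra.
Qed.

Lemma is_sum_minus f g s t : is_sum f s -> is_sum g t -> is_sum (fun p => f p - g p)%C (s - t)%C.
Proof.
  intros Hf Hg. replace (s - t)%C with (s + (- (1)) * t)%C by ring.
  apply is_sum_ext with (fun p => f p + (- (1)) * g p)%C; [intros; ring|].
  apply is_sum_plus; auto. apply is_sum_scal; auto.
Qed.

Lemma is_sum_conj f s : is_sum f s -> is_sum (fun p => Cconj (f p)) (Cconj s).
Proof.
  intros Hf eps He. destruct (Hf eps He) as [N HN]. exists N. intros l Hl Hi.
  rewrite sumC_conj, <- Cminus_conj, Cmod_conj. auto.
Qed.

(** The image of [square N] under [k] is finite, so some [square M] contains it; a list containing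
    [square M] is carried by [h] to one containing [square N]. *)
Lemma is_sum_perm f s (h k : Z * Z -> Z * Z) : (forall p, h (k p) = p) -> (forall p, k (h p) = p) ->
  is_sum f s -> is_sum (fun p => f (h p)) s.
Proof.
  intros Hhk Hkh Hf eps He. destruct (Hf eps He) as [N HN].
  destruct (square_cover (map k (square N))) as [M HM]. exists M. intros l Hl Hi.
  rewrite <- sumC_map. apply HN.
  - apply FinFun.Injective_map_NoDup; auto. intros x y E.
    rewrite <- (Hkh x), <- (Hkh y), E; auto.
  - intros p Hp. apply in_map_iff. exists (k p). split; auto. apply Hi, HM.
    apply in_map_iff. exists p. auto.
Qed.

Lemma is_sum_unique f s t : is_sum f s -> is_sum f t -> s = t.
Proof.
  intros Hs Ht. destruct (Ceq_dec s t) as [|Hne]; auto. exfalso.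
  assert (H : 0 < Cmod (s - t)%C).
  { apply Cmod_gt_0. intros H. apply Hne. replace s with ((s - t) + t)%C by ring. rewrite H. ring. }
  destruct (Hs (Cmod (s - t)%C / 2)) as [N HN]; [lra|].
  destruct (Ht (Cmod (s - t)%C / 2)) as [M HM]; [lra|].
  specialize (HN (square (N + M)) (NoDup_square _) ltac:(apply square_mono; lia)).
  specialize (HM (square (N + M)) (NoDup_square _) ltac:(apply square_mono; lia)).
  set (u := sumC f (square (N + M))) in *.
  assert (Cmod (s - t)%C <= Cmod (u - t)%C + Cmod (u - s)%C).
  { replace (s - t)%C with ((u - t) + - (u - s))%C by ring.
    eapply Rle_trans; [apply Cmod_triangle|]. rewrite Cmod_opp. lra. }
  lra.
Qed.

(** Built on the same [lim] as [lattice_sum], so that the two can be compared directly. This [lim]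
    has a value for every filter; [is_sum_total] identifies it when the sum exists. *)
Definition total (f : Z * Z -> C) : C :=
  @lim (CompleteNormedModule.CompleteSpace _ C_CompleteNormedModule)
    (filtermap (fun N => sumC f (square N)) eventually).

Lemma is_sum_total f s : is_sum f s -> total f = s.
Proof.
  intros Hf. unfold total.
  set (F := filtermap (fun N => sumC f (square N)) eventually).
  assert (HF : ProperFilter F) by (apply filtermap_proper_filter, eventually_filter).
  assert (HL : @is_filter_lim C_UniformSpace F s).
  { intros P [eps HP]. destruct (Hf eps (cond_pos eps)) as [N HN]. exists N. intros n Hn. apply HP.
    apply C_NormedModule_mixin_compat1. apply HN; [apply NoDup_square|apply square_mono; auto]. }
  apply (@is_filter_lim_unique C_AbsRing C_NormedModule F (Proper_StrongProper _ HF)); [|exact HL].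
  intros P [eps HP].
  (* [lim] is specified for Cauchy filters: [complete_cauchy] then says that the filter converges to
     it, and limits are unique. *)
  assert (HC : @cauchy C_UniformSpace F).
  { intros e. exists s. apply HL. apply locally_ball. }
  generalize (@complete_cauchy (CompleteNormedModule.CompleteSpace _ C_CompleteNormedModule) F HF HC eps).
  apply filter_imp. intros x Hx. apply HP. exact Hx.
Qed.

Lemma sum_n_sumC (f : nat -> C) n : @sum_n C_AbelianMonoid f n = sumC f (seq 0 (S n)).
Proof.
  induction n.
  - rewrite sum_O. simpl. ring.
  - rewrite sum_Sn, IHn, (seq_S (S n)), sumC_app. simpl. unfold plus; simpl. ring.
Qed.

Lemma sumC_prod {A B} (f : A * B -> C) l l' :
  sumC f (list_prod l l') = sumC (fun a => sumC (fun b => f (a, b)) l') l.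
Proof. induction l; simpl; [auto|]. rewrite sumC_app, sumC_map, IHl. auto. Qed.

Lemma lattice_sum_total (f : Z -> Z -> C) : f 0%Z 0%Z = 0%C ->
  lattice_sum f = total (fun p => f (fst p) (snd p)).
Proof.
  intros H0. unfold lattice_sum, total. f_equal. f_equal. apply functional_extensionality. intros N.
  unfold sq_partial, square. rewrite sumC_prod, sum_n_sumC. unfold zrange. rewrite sumC_map.
  apply sumC_ext. intros i. rewrite sum_n_sumC, sumC_map. apply sumC_ext. intros j. simpl.
  destruct (Z.eqb_spec (Z.of_nat i - Z.of_nat N) 0) as [E|E];
  destruct (Z.eqb_spec (Z.of_nat j - Z.of_nat N) 0) as [E'|E']; simpl; auto.
  rewrite E, E'; auto.
Qed.

(** * Summable weights and dominated families *)

Definition root4 (x : R) : R := sqrt (sqrt x).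
(** This is [(1 + |k|) ^ (-5/4)], kept algebraic by a fourth root. The exponent exceeds 1, so the
    weights are summable; its double 5/2 is below the degree 3 of the lattice terms and exactly half
    the degree 5 of the terms in Eisenstein's identity. *)
Definition wgt1 (k : Z) : R := / root4 (1 + Rabs (IZR k)) ^ 5.
Definition wgt (p : Z * Z) : R := wgt1 (fst p) * wgt1 (snd p).

Lemma root4_ge1 x : 1 <= x -> 1 <= root4 x.
Proof. intros H. unfold root4. rewrite <- sqrt_1, <- sqrt_1. apply sqrt_le_1_alt, sqrt_le_1_alt, H. Qed.
Lemma root4_pow x : 0 <= x -> root4 x ^ 4 = x.
Proof.
  intros H. unfold root4. replace (sqrt (sqrt x) ^ 4) with ((sqrt (sqrt x) * sqrt (sqrt x)) * (sqrt (sqrt x) * sqrt (sqrt x))) by ring.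
  rewrite sqrt_sqrt by apply sqrt_pos. apply sqrt_sqrt, H.
Qed.
Lemma wgt1_pos k : 0 < wgt1 k.
Proof.
  unfold wgt1. apply Rinv_0_lt_compat, pow_lt. pose proof (Rabs_pos (IZR k)).
  pose proof (root4_ge1 (1 + Rabs (IZR k))). lra.
Qed.
Lemma wgt_pos p : 0 < wgt p.
Proof. apply Rmult_lt_0_compat; apply wgt1_pos. Qed.

(* Dominates [sum k ^ (-5/4)] by a telescoping sum, with [x], [y] the fourth roots of [k], [k + 1]. *)
Lemma inv5_telescope x y : 1 <= x -> 1 <= y -> y ^ 4 = x ^ 4 + 1 -> / y ^ 5 <= 4 * (/ x - / y).
Proof.
  intros Hx Hy E.
  assert (Hxy : x < y).
  { destruct (Rlt_or_le x y); auto. assert (y ^ 4 <= x ^ 4) by (apply pow_incr; lra). lra. }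
  assert (E2 : (y - x) * ((y + x) * (y ^ 2 + x ^ 2)) = 1) by (replace 1 with (y ^ 4 - x ^ 4) by lra; ring).
  assert (H4 : (y + x) * (y ^ 2 + x ^ 2) <= 4 * y ^ 3).
  { replace (4 * y ^ 3) with ((2 * y) * (2 * y ^ 2)) by ring.
    apply Rmult_le_compat; try nra. }
  assert (H5 : 1 <= (y - x) * (4 * y ^ 3)).
  { rewrite <- E2. apply Rmult_le_compat_l; lra. }
  assert (P3 : 0 < y ^ 3) by (apply pow_lt; lra).
  assert (P5 : 0 < y ^ 5) by (apply pow_lt; lra).
  apply Rmult_le_reg_r with (x * y ^ 5); [apply Rmult_lt_0_compat; lra|].
  replace (/ y ^ 5 * (x * y ^ 5)) with x by (field; lra).
  replace (4 * (/ x - / y) * (x * y ^ 5)) with ((y - x) * (4 * y ^ 3) * y) by (field; lra).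
  assert (1 * y <= (y - x) * (4 * y ^ 3) * y) by (apply Rmult_le_compat_r; lra). lra.
Qed.

(** The index 0 contributes 1 and the telescoping bound at most 4 more. *)
Lemma wgt1_sum N : sumR wgt1 (map Z.of_nat (seq 0 (S N))) <= 5 - 4 * / root4 (1 + INR N).
Proof.
  induction N.
  - simpl. unfold wgt1. rewrite Rabs_R0, !Rplus_0_r. unfold root4. rewrite !sqrt_1. lra.
  - rewrite seq_S, map_app, sumR_app. cbn [map sumR]. rewrite ?Nat.add_0_l.
    assert (H : wgt1 (Z.of_nat (S N)) <= 4 * (/ root4 (1 + INR N) - / root4 (1 + INR (S N)))).
    { unfold wgt1. rewrite <- INR_IZR_INZ, Rabs_right by (apply Rle_ge, pos_INR).
      pose proof (pos_INR N). rewrite S_INR.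
      apply inv5_telescope; try (apply root4_ge1; lra). rewrite !root4_pow; lra. }
    change (0 + S N)%nat with (S N). lra.
Qed.

Lemma wgt1_zrange N : sumR wgt1 (zrange N) <= 10.
Proof.
  assert (Hs := wgt1_sum N).
  assert (0 < / root4 (1 + INR N)).
  { apply Rinv_0_lt_compat. pose proof (root4_ge1 (1 + INR N)). pose proof (pos_INR N). lra. }
  assert (E : sumR wgt1 (map Z.opp (map Z.of_nat (seq 0 (S N)))) = sumR wgt1 (map Z.of_nat (seq 0 (S N)))).
  { clear Hs. induction (map Z.of_nat (seq 0 (S N))); cbn [map sumR]; auto. rewrite IHl.
    apply (f_equal (fun x => x + _)). unfold wgt1. rewrite opp_IZR, Rabs_Ropp. auto. }
  (* The range is covered by the half range and its mirror image, each of weight at most 5; counting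
     the index 0 twice is harmless for an upper bound. *)
  apply Rle_trans with (sumR wgt1 (map Z.of_nat (seq 0 (S N)) ++ map Z.opp (map Z.of_nat (seq 0 (S N))))).
  - apply sumR_incl; [intros; left; apply wgt1_pos|apply NoDup_zrange|].
    intros k Hk. apply in_zrange in Hk. apply in_app_iff.
    destruct (Z_le_gt_dec 0 k) as [H0|H0]; [left|right].
    + apply in_map_iff. exists (Z.to_nat k). split; [lia|]. apply in_seq. lia.
    + apply in_map_iff. exists (- k)%Z. split; [lia|].
      apply in_map_iff. exists (Z.to_nat (- k)). split; [lia|]. apply in_seq. lia.
  - rewrite sumR_app, E. lra.
Qed.

Lemma wgt_square N : sumR wgt (square N) <= 100.
Proof.
  unfold square.
  assert (E : forall l l', sumR wgt (list_prod l l') = sumR wgt1 l * sumR wgt1 l').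
  { intros l l'. induction l as [|a l IH]; cbn [list_prod sumR]; [ring|].
    rewrite sumR_app, IH, Rmult_plus_distr_r. f_equal. rewrite <- sumR_scal.
    clear. induction l'; cbn [map sumR]; auto. rewrite IHl'. auto. }
  rewrite E. pose proof (wgt1_zrange N).
  assert (0 <= sumR wgt1 (zrange N)) by (apply sumR_pos; intros; left; apply wgt1_pos). nra.
Qed.

Lemma wgt_bound l : NoDup l -> sumR wgt l <= 100.
Proof.
  intros Hl. destruct (square_cover l) as [N HN]. eapply Rle_trans; [|apply (wgt_square N)].
  apply sumR_incl; auto. intros; left; apply wgt_pos.
Qed.

(** A finite set [l] whose weight is within [eps] of the supremum leaves at most [eps] for anything
    disjoint from it, in particular for anything outside a square covering [l]. *)
Lemma wgt_tail eps : 0 < eps -> exists N, forall r, NoDup r -> (forall p, In p r -> ~ In p (square N)) ->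
  sumR wgt r <= eps.
Proof.
  intros He. destruct (completeness (fun x => exists l, NoDup l /\ x = sumR wgt l)) as [S [HS1 HS2]].
  { exists 100. intros x [l [Hl E]]. subst. apply wgt_bound; auto. }
  { exists 0, nil. split; [constructor|auto]. }
  destruct (classic (exists l, NoDup l /\ S - eps <= sumR wgt l)) as [[l [Hl H]]|Hn].
  - destruct (square_cover l) as [N HN]. exists N. intros r Hr Hd.
    assert (sumR wgt (l ++ r) <= S).
    { apply HS1. exists (l ++ r). split; auto. apply NoDup_app; auto. intros p Hp Hq. apply (Hd p); auto. }
    rewrite sumR_app in H0. lra.
  - exfalso. assert (S <= S - eps); [|lra]. apply HS2. intros x [l [Hl E]]. subst.
    destruct (Rle_or_lt (sumR wgt l) (S - eps)); auto. exfalso. apply Hn. exists l. split; auto. lra.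
Qed.

Definition dominated (f : Z * Z -> C) : Prop := exists K, forall p, Cmod (f p) <= K * wgt p.

Lemma dominated_const_pos (f : Z * Z -> C) K : (forall p, Cmod (f p) <= K * wgt p) -> 0 <= K.
Proof.
  intros H. specialize (H (0, 0)%Z). pose proof (Cmod_ge_0 (f (0, 0)%Z)). pose proof (wgt_pos (0, 0)%Z). nra.
Qed.

Lemma dominated_cauchy f : dominated f -> forall eps, 0 < eps -> exists N, forall l, NoDup l -> incl (square N) l ->
  Cmod (sumC f l - sumC f (square N))%C <= eps.
Proof.
  intros [K HK] eps He. pose proof (dominated_const_pos _ _ HK) as HK0.
  destruct (wgt_tail (eps / (1 + K))) as [N HN]; [apply Rdiv_lt_0_compat; lra|].
  exists N. intros l Hl Hi. destruct (sumC_diff f (square N) l (NoDup_square N) Hl Hi) as [r [Hr1 [Hr2 Hr3]]].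
  rewrite Hr3. replace (sumC f (square N) + sumC f r - sumC f (square N))%C with (sumC f r) by ring.
  eapply Rle_trans; [apply (sumC_Cmod f (fun p => K * wgt p)); auto|]. rewrite sumR_scal.
  assert (sumR wgt r <= eps / (1 + K)) by (apply HN; auto; intros p Hp; apply Hr2; auto).
  apply Rle_trans with (K * (eps / (1 + K))); [apply Rmult_le_compat_l; auto|].
  apply Rmult_le_reg_r with (1 + K); [lra|]. unfold Rdiv.
  replace (K * (eps * / (1 + K)) * (1 + K)) with (K * eps) by (field; lra). nra.
Qed.

Lemma im_le_Cmod (c : C) : Rabs (Im c) <= Cmod c.
Proof. pose proof (Rmax_Cmod c). pose proof (Rmax_r (Rabs (fst c)) (Rabs (snd c))). unfold Im. lra. Qed.
Lemma Cmod_le_re_im (c : C) : Cmod c <= Rabs (Re c) + Rabs (Im c).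
Proof.
  replace c with (RtoC (Re c) + Ci * RtoC (Im c))%C at 1.
  - eapply Rle_trans; [apply Cmod_triangle|]. rewrite Cmod_mult, Cmod_Ci, !Cmod_R. lra.
  - apply injective_projections; simpl; unfold Re, Im; ring.
Qed.

Lemma dominated_is_sum f : dominated f -> exists s, is_sum f s.
Proof.
  intros Hf. pose proof (dominated_cauchy f Hf) as HC.
  assert (HU : forall eps, 0 < eps -> exists N, forall n m, (N <= n)%nat -> (N <= m)%nat ->
     Cmod (sumC f (square n) - sumC f (square m))%C < eps).
  { intros eps He. destruct (HC (eps / 3)) as [N HN]; [lra|]. exists N. intros n m Hn Hm.
    pose proof (HN (square n) (NoDup_square n) (square_mono _ _ Hn)). pose proof (HN (square m) (NoDup_square m) (square_mono _ _ Hm)).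
    replace (sumC f (square n) - sumC f (square m))%C with
      ((sumC f (square n) - sumC f (square N)) + - (sumC f (square m) - sumC f (square N)))%C by ring.
    eapply Rle_lt_trans; [apply Cmod_triangle|]. rewrite Cmod_opp. lra. }
  destruct (Rcomplete.R_complete (fun n => Re (sumC f (square n)))) as [x Hx].
  { intros eps He. destruct (HU eps He) as [N HN]. exists N. intros n m Hn Hm. unfold Rdist.
    eapply Rle_lt_trans; [|apply (HN n m); auto]. apply (re_le_Cmod (sumC f (square n) - sumC f (square m))%C). }
  destruct (Rcomplete.R_complete (fun n => Im (sumC f (square n)))) as [y Hy].
  { intros eps He. destruct (HU eps He) as [N HN]. exists N. intros n m Hn Hm. unfold Rdist.
    eapply Rle_lt_trans; [|apply (HN n m); auto]. apply (im_le_Cmod (sumC f (square n) - sumC f (square m))%C). }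
  exists (x, y). intros eps He.
  destruct (HC (eps / 4)) as [N HN]; [lra|]. exists N. intros l Hl Hi.
  destruct (Hx (eps / 4)) as [N1 H1]; [lra|]. destruct (Hy (eps / 4)) as [N2 H2]; [lra|].
  set (n := (N + N1 + N2)%nat).
  specialize (H1 n ltac:(unfold n; lia)). specialize (H2 n ltac:(unfold n; lia)). unfold Rdist in *.
  pose proof (HN (square n) (NoDup_square n) (square_mono N n ltac:(unfold n; lia))). pose proof (HN l Hl Hi).
  replace (sumC f l - (x, y))%C with
      ((sumC f l - sumC f (square N)) + (- (sumC f (square n) - sumC f (square N)) + (sumC f (square n) - (x, y))))%C by ring.
  eapply Rle_lt_trans; [apply Cmod_triangle|].
  pose proof (Cmod_triangle (- (sumC f (square n) - sumC f (square N)))%C (sumC f (square n) - (x, y))%C).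
  rewrite Cmod_opp in H3. pose proof (Cmod_le_re_im (sumC f (square n) - (x, y))%C).
  change (Re (sumC f (square n) - (x, y))%C) with (Re (sumC f (square n)) - x) in H4.
  change (Im (sumC f (square n) - (x, y))%C) with (Im (sumC f (square n)) - y) in H4.
  lra.
Qed.

Lemma dominated_total f : dominated f -> is_sum f (total f).
Proof. intros H. destruct (dominated_is_sum f H) as [s Hs]. rewrite (is_sum_total f s Hs). auto. Qed.

Lemma is_sum_bound f K s : (forall p, Cmod (f p) <= K * wgt p) -> is_sum f s -> Cmod s <= 100 * K.
Proof.
  intros HK Hs. pose proof (dominated_const_pos _ _ HK) as HK0. apply le_epsilon. intros eps He.
  destruct (Hs eps He) as [N HN]. specialize (HN (square N) (NoDup_square N) (incl_refl _)).
  replace s with (sumC f (square N) + - (sumC f (square N) - s))%C by ring.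
  eapply Rle_trans; [apply Cmod_triangle|]. rewrite Cmod_opp.
  pose proof (sumC_Cmod f (fun p => K * wgt p) (square N) HK). rewrite sumR_scal in H.
  pose proof (wgt_square N). nra.
Qed.

(** Dominated convergence for sums: the part outside a square is small uniformly in [N], and the
    part inside is a finite sum. One suitable [N] is enough, because in the application [s] does not
    depend on [N]. *)
Lemma tannery (F : nat -> Z * Z -> C) (s : nat -> C) K :
  (forall N, is_sum (F N) (s N)) -> (forall N p, Cmod (F N p) <= K * wgt p) ->
  (forall p eps, 0 < eps -> exists N0, forall N, (N0 <= N)%nat -> Cmod (F N p) <= eps) ->
  forall eps, 0 < eps -> exists N, Cmod (s N) <= eps.
Proof.
  intros Hs HK Hp eps He. pose proof (dominated_const_pos _ _ (HK O)) as HK0.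
  destruct (wgt_tail (eps / 3 / (1 + K))) as [M HM]; [apply Rdiv_lt_0_compat; lra|].
  assert (HT : K * (eps / 3 / (1 + K)) <= eps / 3).
  { apply Rmult_le_reg_r with (1 + K); [lra|].
    replace (K * (eps / 3 / (1 + K)) * (1 + K)) with (K * (eps / 3)) by (field; lra). nra. }
  assert (HF : forall l : list (Z * Z), forall e, 0 < e -> exists N0, forall N, (N0 <= N)%nat -> Cmod (sumC (F N) l) <= e).
  { induction l as [|p l IH]; intros e Hee.
    - exists O. intros. cbn [sumC]. rewrite Cmod_0. lra.
    - destruct (IH (e / 2)) as [N1 H1]; [lra|]. destruct (Hp p (e / 2)) as [N2 H2]; [lra|].
      exists (N1 + N2)%nat. intros N HN. cbn [sumC]. eapply Rle_trans; [apply Cmod_triangle|].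
      specialize (H1 N ltac:(lia)). specialize (H2 N ltac:(lia)). lra. }
  destruct (HF (square M) (eps / 3)) as [N HN]; [lra|]. exists N. specialize (HN N (le_n _)).
  destruct (Hs N (eps / 3)) as [M' HM']; [lra|].
  specialize (HM' (square (M + M')) (NoDup_square _) (square_mono M' (M + M') (Nat.le_add_l _ _))).
  destruct (sumC_diff (F N) (square M) (square (M + M')) (NoDup_square _) (NoDup_square _) (square_mono _ _ (Nat.le_add_r _ _)))
    as [r [Hr1 [Hr2 Hr3]]].
  replace (s N) with (sumC (F N) (square M) + (sumC (F N) r + - (sumC (F N) (square (M + M')) - s N)))%C
    by (rewrite Hr3; ring).
  eapply Rle_trans; [apply Cmod_triangle|].
  pose proof (Cmod_triangle (sumC (F N) r) (- (sumC (F N) (square (M + M')) - s N))%C).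
  rewrite Cmod_opp in H.
  assert (Cmod (sumC (F N) r) <= eps / 3).
  { eapply Rle_trans; [apply (sumC_Cmod _ (fun p => K * wgt p)); auto|]. rewrite sumR_scal.
    eapply Rle_trans; [|apply HT]. apply Rmult_le_compat_l; auto. apply HM; auto.
    intros p Hpp. apply Hr2; auto. }
  lra.
Qed.

(** * Weierstrass sums of a lattice *)

Lemma Cinv_0 : (/ 0)%C = 0%C.
Proof. apply injective_projections; simpl; unfold Rdiv; rewrite ?Rmult_0_l, ?Ropp_0, ?Rmult_0_l; auto; ring. Qed.
Lemma Cmod_inv' (x : C) : Cmod (/ x)%C = / Cmod x.
Proof.
  destruct (Ceq_dec x 0%C) as [->|H]; [|apply Cmod_inv; auto].
  rewrite Cinv_0, Cmod_0, Rinv_0; auto.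
Qed.
Lemma Cinv_conj' (x : C) : Cconj (/ x)%C = (/ Cconj x)%C.
Proof.
  destruct (Ceq_dec x 0%C) as [->|H]; [|apply Cinv_conj; auto].
  assert (E : Cconj 0 = 0%C) by (apply injective_projections; simpl; ring).
  rewrite Cinv_0, E, Cinv_0; auto.
Qed.
Lemma Cinv_opp (x : C) : (/ - x)%C = (- / x)%C.
Proof.
  destruct (Ceq_dec x 0%C) as [->|H]; [|field; auto].
  replace (Copp 0) with (RtoC 0) by ring. rewrite Cinv_0. ring.
Qed.
Lemma Cminus_eq0 (x y : C) : (x - y)%C = 0%C -> x = y.
Proof. intros E. replace x with ((x - y) + y)%C by ring. rewrite E; ring. Qed.

Definition pt (w1 w2 : C) (p : Z * Z) : C := lat_pt w1 w2 (fst p) (snd p).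
Definition padd (p q : Z * Z) : Z * Z := ((fst p + fst q)%Z, (snd p + snd q)%Z).
Definition popp (p : Z * Z) : Z * Z := ((- fst p)%Z, (- snd p)%Z).
Definition lnorm (p : Z * Z) : R := 1 + Rabs (IZR (fst p)) + Rabs (IZR (snd p)).

Lemma pt_add w1 w2 p q : pt w1 w2 (padd p q) = (pt w1 w2 p + pt w1 w2 q)%C.
Proof. unfold pt, padd, lat_pt; simpl. rewrite !plus_IZR, !RtoC_plus. ring. Qed.
Lemma pt_opp w1 w2 p : pt w1 w2 (popp p) = (- pt w1 w2 p)%C.
Proof. unfold pt, popp, lat_pt; simpl. rewrite !opp_IZR, !RtoC_opp. ring. Qed.
Lemma pt_0 w1 w2 : pt w1 w2 (0, 0)%Z = 0%C.
Proof. unfold pt, lat_pt; simpl. ring. Qed.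
Lemma pt_conj w1 w2 p : pt (Cconj w1) (Cconj w2) p = Cconj (pt w1 w2 p).
Proof.
  assert (E : forall r, Cconj (RtoC r) = RtoC r) by (intros; apply injective_projections; simpl; ring).
  unfold pt, lat_pt. rewrite Cplus_conj, !Cmult_conj, !E. auto.
Qed.
Lemma padd_cancel p q : padd (padd p q) (popp q) = p.
Proof. destruct p, q; unfold padd, popp; simpl; f_equal; ring. Qed.
Lemma padd_cancel' p q : padd (padd p (popp q)) q = p.
Proof. destruct p, q; unfold padd, popp; simpl; f_equal; ring. Qed.
Lemma popp_invol p : popp (popp p) = p.
Proof. destruct p; unfold popp; simpl; f_equal; ring. Qed.

Lemma is_sum_shift f s q : is_sum f s -> is_sum (fun p => f (padd p q)) s.
Proof. apply (is_sum_perm f s (fun p => padd p q) (fun p => padd p (popp q))); intros; [apply padd_cancel'|apply padd_cancel]. Qed.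
Lemma is_sum_popp f s : is_sum f s -> is_sum (fun p => f (popp p)) s.
Proof. apply (is_sum_perm f s popp popp); apply popp_invol. Qed.

Lemma is_sum_odd f s : is_sum f s -> (forall p, f (popp p) = (- f p)%C) -> s = 0%C.
Proof.
  intros Hs Ho. assert (E : s = (- (1) * s)%C).
  { apply (is_sum_unique f); auto. apply is_sum_popp in Hs.
    apply (is_sum_scal (- (1))%C) in Hs. revert Hs. apply is_sum_ext. intros p. rewrite Ho. ring. }
  assert (E2 : (2 * s)%C = 0%C) by (transitivity (s + s)%C; [ring|rewrite E at 2; ring]).
  replace s with (/ 2 * (2 * s))%C by (field; intros H; apply RtoC_inj in H; lra). rewrite E2. ring.
Qed.

Lemma lnorm_ge1 p : 1 <= lnorm p.
Proof. unfold lnorm. pose proof (Rabs_pos (IZR (fst p))). pose proof (Rabs_pos (IZR (snd p))). lra. Qed.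

(** The inverse half power of the norm is the unit in which all bounds become integer powers:
    [rnorm p ^ 5] lies below [wgt p], and [rnorm_tri] moves a single such unit. *)
Definition rnorm (p : Z * Z) : R := / sqrt (lnorm p).
Lemma rnorm_pos p : 0 < rnorm p.
Proof. apply Rinv_0_lt_compat, sqrt_lt_R0. pose proof (lnorm_ge1 p). lra. Qed.
Lemma rnorm_le1 p : rnorm p <= 1.
Proof.
  unfold rnorm. rewrite <- Rinv_1. apply Rinv_le_contravar; [lra|]. rewrite <- sqrt_1 at 1. apply sqrt_le_1_alt, lnorm_ge1.
Qed.
Lemma rnorm_square p : rnorm p ^ 2 = / lnorm p.
Proof.
  unfold rnorm. rewrite pow_inv. f_equal. simpl. rewrite Rmult_1_r. apply sqrt_sqrt. pose proof (lnorm_ge1 p). lra.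
Qed.
(** Each of [1 + |m|] and [1 + |n|] is at most [lnorm p], so the product of their powers 5/4 is at
    most the power 5/2 of [lnorm p]. *)
Lemma rnorm5_wgt p : rnorm p ^ 5 <= wgt p.
Proof.
  unfold rnorm, wgt, wgt1. rewrite pow_inv, <- Rinv_mult.
  assert (H1 := Rabs_pos (IZR (fst p))). assert (H2 := Rabs_pos (IZR (snd p))).
  pose proof (root4_ge1 (1 + Rabs (IZR (fst p)))). pose proof (root4_ge1 (1 + Rabs (IZR (snd p)))).
  apply Rinv_le_contravar; [apply Rmult_lt_0_compat; apply pow_lt; lra|].
  rewrite <- Rpow_mult_distr. apply pow_incr. split; [apply Rmult_le_pos; lra|].
  assert (Hr : forall x, 1 <= x -> x <= lnorm p -> 0 <= root4 x <= root4 (lnorm p)).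
  { intros x Hx Hx'. pose proof (root4_ge1 x Hx). split; [lra|]. unfold root4. apply sqrt_le_1_alt, sqrt_le_1_alt; auto. }
  assert (E : sqrt (lnorm p) = root4 (lnorm p) * root4 (lnorm p)).
  { unfold root4. rewrite sqrt_sqrt; auto. apply sqrt_pos. }
  rewrite E. destruct (Hr (1 + Rabs (IZR (fst p)))); [lra|unfold lnorm; lra|].
  destruct (Hr (1 + Rabs (IZR (snd p)))); [lra|unfold lnorm; lra|].
  apply Rmult_le_compat; auto.
Qed.
Lemma inv_lnorm3_wgt p : (/ lnorm p) ^ 3 <= wgt p.
Proof.
  eapply Rle_trans; [|apply rnorm5_wgt]. rewrite <- rnorm_square. pose proof (rnorm_pos p). pose proof (rnorm_le1 p).
  replace ((rnorm p ^ 2) ^ 3) with (rnorm p ^ 5 * rnorm p) by ring.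
  pose proof (pow_lt (rnorm p) 5 H). nra.
Qed.
Lemma inv_lnorm_range p : 0 < / lnorm p <= 1.
Proof.
  pose proof (lnorm_ge1 p). split; [apply Rinv_0_lt_compat; lra|]. rewrite <- Rinv_1. apply Rinv_le_contravar; lra.
Qed.

(** After division by [w1] a lattice point is [m + n t] with [t] not real: its imaginary part
    controls [n], and then the triangle inequality controls [m]. The constant [B] adds up the two
    bounds. *)
Lemma basis_low w1 w2 : is_lattice_basis w1 w2 -> exists c, 0 < c /\
  forall p, c * (lnorm p - 1) <= Cmod (pt w1 w2 p).
Proof.
  intros [H1 H2]. set (t := (w2 / w1)%C) in *.
  assert (Ht : 0 < Rabs (Im t)) by (apply Rabs_pos_lt; auto).
  assert (Hw : 0 < Cmod w1) by (apply Cmod_gt_0; auto).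
  set (B := 1 + (1 + Cmod t) / Rabs (Im t)).
  assert (HB : 0 < B).
  { unfold B. pose proof (Cmod_ge_0 t). assert (0 < (1 + Cmod t) / Rabs (Im t)) by (apply Rdiv_lt_0_compat; lra). lra. }
  exists (Cmod w1 / B). split; [apply Rdiv_lt_0_compat; auto|].
  intros [m n]. unfold pt, lat_pt, lnorm. simpl fst; simpl snd.
  set (x := (IZR m + IZR n * t)%C).
  replace (IZR m * w1 + IZR n * w2)%C with (w1 * x)%C by (unfold x, t; field; auto).
  rewrite Cmod_mult.
  assert (Hn : Rabs (IZR n) * Rabs (Im t) <= Cmod x).
  { eapply Rle_trans; [|apply im_le_Cmod]. right. rewrite <- Rabs_mult. f_equal. unfold x, Im; simpl. ring. }
  assert (Hm : Rabs (IZR m) <= Cmod x + Rabs (IZR n) * Cmod t).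
  { rewrite <- !Cmod_R, <- Cmod_mult. replace (RtoC (IZR m)) with (x + - (IZR n * t))%C by (unfold x; ring).
    eapply Rle_trans; [apply Cmod_triangle|]. rewrite Cmod_opp. lra. }
  assert (Hn' : Rabs (IZR n) <= Cmod x / Rabs (Im t)).
  { apply Rmult_le_reg_r with (Rabs (Im t)); auto.
    replace (Cmod x / Rabs (Im t) * Rabs (Im t)) with (Cmod x) by (field; lra). auto. }
  assert (Hs : Rabs (IZR m) + Rabs (IZR n) <= B * Cmod x).
  { unfold B. replace ((1 + (1 + Cmod t) / Rabs (Im t)) * Cmod x) with
      (Cmod x + (1 + Cmod t) * (Cmod x / Rabs (Im t))) by (field; lra).
    pose proof (Cmod_ge_0 t). nra. }
  apply Rmult_le_reg_r with B; auto.
  replace (Cmod w1 / B * (1 + Rabs (IZR m) + Rabs (IZR n) - 1) * B) with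
    (Cmod w1 * (Rabs (IZR m) + Rabs (IZR n))) by (field; lra). nra.
Qed.

Lemma in_square_lnorm p N : lnorm p <= INR N -> In p (square N).
Proof.
  unfold lnorm. intros H. apply in_square. rewrite <- !abs_IZR in H.
  pose proof (Rabs_pos (IZR (fst p))). pose proof (Rabs_pos (IZR (snd p))). rewrite <- abs_IZR in *.
  rewrite INR_IZR_INZ in H. split; apply le_IZR; lra.
Qed.

Lemma list_max_bound {A} (f : A -> R) (l : list A) : exists K, forall p, In p l -> f p <= K.
Proof.
  induction l as [|a l [K HK]]; [exists 0; intros p []|].
  exists (Rmax (f a) K). intros p [E|Hp]; [subst; apply Rmax_l|]. eapply Rle_trans; [apply HK; auto|apply Rmax_r].
Qed.

(** Far out, [basis_low] bounds [z - w] below by [c / 2 * lnorm p]; the finitely many other indices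
    are absorbed in a maximum. An index with [z = w] is harmless since [/ 0 = 0]. *)
Lemma inv_low w1 w2 : is_lattice_basis w1 w2 -> forall z, exists K, 0 < K /\
  forall p, Cmod (/ (z - pt w1 w2 p))%C <= K * / lnorm p.
Proof.
  intros HL z. destruct (basis_low _ _ HL) as [c [Hc Hlow]].
  pose proof (Cmod_ge_0 z) as Hz.
  destruct (INR_unbounded (2 * (c + Cmod z) / c)) as [N HN].
  destruct (list_max_bound (fun p => Cmod (/ (z - pt w1 w2 p))%C * lnorm p) (square N)) as [K0 HK0].
  exists (Rmax (2 / c) K0). split.
  { eapply Rlt_le_trans; [|apply Rmax_l]. apply Rdiv_lt_0_compat; lra. }
  intros p. pose proof (lnorm_ge1 p) as Hw.
  apply Rmult_le_reg_r with (lnorm p); [lra|].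
  replace (Rmax (2 / c) K0 * / lnorm p * lnorm p) with (Rmax (2 / c) K0) by (field; lra).
  destruct (Rle_or_lt (lnorm p) (INR N)) as [H|H].
  - eapply Rle_trans; [apply HK0, in_square_lnorm; auto|apply Rmax_r].
  - eapply Rle_trans; [|apply Rmax_l]. rewrite Cmod_inv'.
    assert (Hp : c / 2 * lnorm p <= Cmod (z - pt w1 w2 p)%C).
    { specialize (Hlow p).
      assert (2 * (c + Cmod z) <= lnorm p * c).
      { apply Rmult_le_reg_r with (/ c); [apply Rinv_0_lt_compat; auto|].
        replace (lnorm p * c * / c) with (lnorm p) by (field; lra). unfold Rdiv in HN. lra. }
      assert (Cmod (pt w1 w2 p) <= Cmod (z - pt w1 w2 p)%C + Cmod z).
      { replace (pt w1 w2 p) with (- (z - pt w1 w2 p) + z)%C at 1 by ring.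
        eapply Rle_trans; [apply Cmod_triangle|]. rewrite Cmod_opp. lra. }
      lra. }
    apply Rmult_le_reg_l with (Cmod (z - pt w1 w2 p)%C); [nra|].
    rewrite <- Rmult_assoc, Rinv_r, Rmult_1_l by nra.
    apply Rmult_le_reg_r with (c / 2); [lra|].
    replace (Cmod (z - pt w1 w2 p) * (2 / c) * (c / 2)) with (Cmod (z - pt w1 w2 p)%C) by (field; lra). lra.
Qed.

Lemma pt_eq0 w1 w2 p : is_lattice_basis w1 w2 -> pt w1 w2 p = 0%C -> p = (0, 0)%Z.
Proof.
  intros HL E. destruct (basis_low _ _ HL) as [c [Hc Hlow]]. specialize (Hlow p). rewrite E, Cmod_0 in Hlow.
  unfold lnorm in Hlow. destruct p as [m n]. simpl in *.
  pose proof (Rabs_pos (IZR m)). pose proof (Rabs_pos (IZR n)).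
  assert (Hm : Rabs (IZR m) = 0) by nra. assert (Hn : Rabs (IZR n) = 0) by nra.
  f_equal; apply eq_IZR; [destruct (Req_dec (IZR m) 0) as [|D]|destruct (Req_dec (IZR n) 0) as [|D]]; auto;
  apply Rabs_no_R0 in D; tauto.
Qed.

Definition off_lat (w1 w2 z : C) : Prop := forall p, z <> pt w1 w2 p.
Lemma off_lat_not_in w1 w2 z : ~ in_lattice w1 w2 z <-> off_lat w1 w2 z.
Proof.
  split.
  - intros H p E. apply H. exists (fst p), (snd p). auto.
  - intros H [m [n E]]. apply (H (m, n)). auto.
Qed.
Lemma off_lat_sub w1 w2 z p : off_lat w1 w2 z -> (z - pt w1 w2 p)%C <> 0%C.
Proof. intros H E. apply (H p). apply Cminus_eq0, E. Qed.
Lemma off_lat_shift w1 w2 z p : off_lat w1 w2 z -> off_lat w1 w2 (z + pt w1 w2 p)%C.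
Proof.
  intros H q E. apply (H (padd q (popp p))). rewrite pt_add, pt_opp, <- E. ring.
Qed.
Lemma off_lat_opp w1 w2 z : off_lat w1 w2 z -> off_lat w1 w2 (- z)%C.
Proof. intros H p E. apply (H (popp p)). rewrite pt_opp, <- E. ring. Qed.
Lemma off_lat_neq0 w1 w2 z : off_lat w1 w2 z -> z <> 0%C.
Proof. intros H E. apply (H (0,0)%Z). rewrite pt_0; auto. Qed.

(* Since [/ 0 = 0], the index [(0, 0)] needs no separate treatment: there [/ pt w1 w2 p] vanishes and
   the terms below reduce to the polar parts at the origin. *)
Definition E_term (w1 w2 : C) (k : nat) (z : C) (p : Z * Z) : C := ((/ (z - pt w1 w2 p)) ^ k)%C.
Definition wp_term (w1 w2 : C) (z : C) (p : Z * Z) : C := (E_term w1 w2 2 z p - (/ pt w1 w2 p) ^ 2)%C.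
Definition zeta_term (w1 w2 : C) (z : C) (p : Z * Z) : C :=
  (/ (z - pt w1 w2 p) + / pt w1 w2 p + z * (/ pt w1 w2 p) ^ 2)%C.
Definition E_fun w1 w2 k z := total (E_term w1 w2 k z).
Definition wp_fun w1 w2 z := total (wp_term w1 w2 z).
Definition zeta_fun w1 w2 z := total (zeta_term w1 w2 z).
Definition G_sum w1 w2 k := total (fun p => (/ pt w1 w2 p) ^ k)%C.

Lemma pow_le_3 x k : 0 <= x <= 1 -> (3 <= k)%nat -> x ^ k <= x ^ 3.
Proof.
  intros Hx Hk. replace k with (3 + (k - 3))%nat by lia. rewrite pow_add.
  pose proof (pow_le x 3 (proj1 Hx)). assert (x ^ (k - 3) <= 1).
  { rewrite <- (pow1 (k - 3)). apply pow_incr; auto. }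
  nra.
Qed.

Lemma dominated_E_term w1 w2 k z : is_lattice_basis w1 w2 -> (3 <= k)%nat -> dominated (E_term w1 w2 k z).
Proof.
  intros HL Hk. destruct (inv_low _ _ HL z) as [K [HK0 HK]]. exists (K ^ k). intros p. unfold E_term.
  rewrite Cmod_pow. pose proof (inv_lnorm_range p).
  apply Rle_trans with ((K * / lnorm p) ^ k); [apply pow_incr; split; [apply Cmod_ge_0|auto]|].
  rewrite Rpow_mult_distr. apply Rmult_le_compat_l; [apply pow_le; lra|].
  eapply Rle_trans; [apply pow_le_3; auto; lra|apply inv_lnorm3_wgt].
Qed.

Lemma dominated_pt_pow w1 w2 k : is_lattice_basis w1 w2 -> (3 <= k)%nat ->
  dominated (fun p => (/ pt w1 w2 p) ^ k)%C.
Proof.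
  intros HL Hk. destruct (dominated_E_term w1 w2 k 0%C HL Hk) as [K HK]. exists K. intros p.
  specialize (HK p). unfold E_term in HK. rewrite Cmod_pow, Cmod_inv' in *.
  replace (0 - pt w1 w2 p)%C with (- pt w1 w2 p)%C in HK by ring. rewrite Cmod_opp in HK. auto.
Qed.

Lemma pt_low w1 w2 : is_lattice_basis w1 w2 -> exists K, 0 < K /\ forall p, Cmod (/ pt w1 w2 p)%C <= K * / lnorm p.
Proof.
  intros HL. destruct (inv_low _ _ HL 0%C) as [K [HK0 HK]]. exists K. split; auto. intros p. specialize (HK p).
  rewrite Cmod_inv' in *. replace (0 - pt w1 w2 p)%C with (- pt w1 w2 p)%C in HK by ring. rewrite Cmod_opp in HK. auto.
Qed.

(** Pulling out the factor [x] turns a difference of terms of degree 2 into terms of degree 3, which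
    is what makes the sum converge absolutely. *)
Lemma inv_square_diff_bound (x v : C) : x <> 0%C -> v <> 0%C -> (x - v)%C <> 0%C ->
  Cmod ((/ (x - v)) ^ 2 - (/ v) ^ 2)%C <= Cmod x *
   (Cmod (/ (x - v))%C ^ 2 * Cmod (/ v)%C + Cmod (/ (x - v))%C * Cmod (/ v)%C ^ 2).
Proof.
  intros Hx Hv Hy.
  replace ((/ (x - v)) ^ 2 - (/ v) ^ 2)%C with
    (x * ((/ (x - v)) ^ 2 * / v + - (/ (x - v) * (/ v) ^ 2)))%C by (field; auto).
  rewrite Cmod_mult. apply Rmult_le_compat_l; [apply Cmod_ge_0|].
  eapply Rle_trans; [apply Cmod_triangle|]. rewrite Cmod_opp, !Cmod_mult, !Cmod_pow. lra.
Qed.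

Lemma dominated_wp_term w1 w2 z : is_lattice_basis w1 w2 -> off_lat w1 w2 z -> dominated (wp_term w1 w2 z).
Proof.
  intros HL Hz. destruct (inv_low _ _ HL z) as [K [HK0 HK]]. destruct (pt_low _ _ HL) as [L [HL0 HLp]].
  pose proof (Cmod_ge_0 z) as Hz0.
  exists (K ^ 2 + Cmod z * (K ^ 2 * L + K * L ^ 2)). intros p. unfold wp_term, E_term.
  pose proof (inv_lnorm_range p) as Hw. pose proof (inv_lnorm3_wgt p) as HW.
  assert (H3 : 0 < (/ lnorm p) ^ 3) by (apply pow_lt; lra).
  assert (HKL : 0 <= Cmod z * (K ^ 2 * L + K * L ^ 2)).
  { apply Rmult_le_pos; auto. apply Rplus_le_le_0_compat; apply Rmult_le_pos; try lra; apply pow_le; lra. }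
  (* The zero index contributes the polar part [(/ z) ^ 2], to which the factorization does not
     apply. *)
  destruct (Ceq_dec (pt w1 w2 p) 0%C) as [E|E].
  - assert (p = (0,0)%Z) by (apply (pt_eq0 w1 w2); auto). subst p. specialize (HK (0,0)%Z).
    rewrite E in *. rewrite Cinv_0. replace ((/ (z - 0)) ^ 2 - 0 ^ 2)%C with ((/ (z - 0)) ^ 2)%C by ring.
    rewrite Cmod_pow. assert (E1 : / lnorm (0,0)%Z = 1) by (unfold lnorm; simpl; rewrite Rabs_R0; field).
    rewrite E1 in *. rewrite Rmult_1_r in HK. rewrite pow1 in HW.
    assert (Cmod (/ (z - 0)) ^ 2 <= K ^ 2) by (apply pow_incr; split; [apply Cmod_ge_0|auto]).
    assert (0 < K ^ 2) by (apply pow_lt; auto). nra.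
  - eapply Rle_trans; [apply inv_square_diff_bound; auto; [apply off_lat_neq0 in Hz; auto|apply off_lat_sub; auto]|].
    specialize (HK p). specialize (HLp p).
    set (y := Cmod (/ (z - pt w1 w2 p))%C) in *. set (u := Cmod (/ pt w1 w2 p)%C) in *. set (t := / lnorm p) in *.
    assert (Hy0 : 0 <= y) by apply Cmod_ge_0. assert (Hu0 : 0 <= u) by apply Cmod_ge_0.
    assert (B1 : y ^ 2 * u <= (K * t) ^ 2 * (L * t)).
    { apply Rmult_le_compat; auto; [apply pow_le; auto|apply pow_incr; auto]. }
    assert (B2 : y * u ^ 2 <= (K * t) * (L * t) ^ 2).
    { apply Rmult_le_compat; auto; [apply pow_le; auto|apply pow_incr; auto]. }
    assert (B3 : Cmod z * (y ^ 2 * u + y * u ^ 2) <= Cmod z * (K ^ 2 * L + K * L ^ 2) * t ^ 3).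
    { rewrite Rmult_assoc. apply Rmult_le_compat_l; auto. lra. }
    assert (0 <= K ^ 2) by (apply pow_le; lra). pose proof (wgt_pos p).
    assert (0 <= K ^ 2 * wgt p) by (apply Rmult_le_pos; lra). nra.
Qed.

Lemma dominated_zeta_term w1 w2 z : is_lattice_basis w1 w2 -> off_lat w1 w2 z -> dominated (zeta_term w1 w2 z).
Proof.
  intros HL Hz. destruct (inv_low _ _ HL z) as [K [HK0 HK]]. destruct (pt_low _ _ HL) as [L [HL0 HLp]].
  exists (K + Cmod z ^ 2 * (K * L ^ 2)). intros p. unfold zeta_term.
  pose proof (inv_lnorm_range p) as Hw. pose proof (inv_lnorm3_wgt p) as HW. pose proof (wgt_pos p) as HW0.
  assert (HKL : 0 <= Cmod z ^ 2 * (K * L ^ 2)).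
  { apply Rmult_le_pos; [apply pow_le, Cmod_ge_0|]. apply Rmult_le_pos; try lra; apply pow_le; lra. }
  destruct (Ceq_dec (pt w1 w2 p) 0%C) as [E|E].
  - assert (p = (0,0)%Z) by (apply (pt_eq0 w1 w2); auto). subst p. specialize (HK (0,0)%Z).
    rewrite E in *. rewrite Cinv_0. replace (/ (z - 0) + 0 + z * 0 ^ 2)%C with (/ (z - 0))%C by ring.
    assert (E1 : / lnorm (0,0)%Z = 1) by (unfold lnorm; simpl; rewrite Rabs_R0; field).
    rewrite E1 in *. rewrite Rmult_1_r in HK. rewrite pow1 in HW. nra.
  - assert (Hx : (z - pt w1 w2 p)%C <> 0%C) by (apply off_lat_sub; auto).
    replace (/ (z - pt w1 w2 p) + / pt w1 w2 p + z * (/ pt w1 w2 p) ^ 2)%C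
      with (z ^ 2 * (/ (z - pt w1 w2 p) * (/ pt w1 w2 p) ^ 2))%C by (field; auto).
    rewrite !Cmod_mult, !Cmod_pow. specialize (HK p). specialize (HLp p).
    set (y := Cmod (/ (z - pt w1 w2 p))%C) in *. set (u := Cmod (/ pt w1 w2 p)%C) in *. set (t := / lnorm p) in *.
    assert (Hy0 : 0 <= y) by apply Cmod_ge_0. assert (Hu0 : 0 <= u) by apply Cmod_ge_0.
    assert (B2 : y * u ^ 2 <= (K * t) * (L * t) ^ 2).
    { apply Rmult_le_compat; auto; [apply pow_le; auto|apply pow_incr; auto]. }
    assert (B3 : Cmod z ^ 2 * (y * u ^ 2) <= Cmod z ^ 2 * (K * L ^ 2) * t ^ 3).
    { rewrite Rmult_assoc. apply Rmult_le_compat_l; [apply pow_le, Cmod_ge_0|]. lra. }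
    nra.
Qed.

Lemma is_sum_delta (c : C) : is_sum (fun p => if (Z.eqb (fst p) 0 && Z.eqb (snd p) 0)%bool then c else RtoC 0) c.
Proof.
  intros eps He. exists O. intros l Hl Hi.
  assert (E : forall l, NoDup l -> sumC (fun p : Z * Z => if (Z.eqb (fst p) 0 && Z.eqb (snd p) 0)%bool then c else RtoC 0) l
     = if in_dec (fun a b : Z * Z => ltac:(decide equality; apply Z.eq_dec)) (0,0)%Z l then c else RtoC 0).
  { clear. intros l Hl. induction Hl as [|x l Hx Hl IH].
    - cbn [sumC]. destruct in_dec as [[]|]; auto.
    - cbn [sumC]. rewrite IH. destruct x as [m n]. simpl fst; simpl snd.
      destruct (Z.eqb_spec m 0) as [E|E]; destruct (Z.eqb_spec n 0) as [E'|E'];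
        cbn [andb]; [subst|..]; repeat destruct in_dec as [?|?]; simpl in *;
        try (exfalso; tauto); try ring;
        exfalso; intuition congruence. }
  rewrite E by auto. destruct in_dec as [H|H].
  - replace (c - c)%C with (RtoC 0) by ring. rewrite Cmod_0. auto.
  - exfalso. apply H, Hi. apply in_square. simpl. lia.
Qed.

(** The definitions skip the zero index, while [is_sum] includes it. What is subtracted is the polar
    term at the origin for [wp] and [wzeta], and 0 for the invariants. *)
Lemma lattice_sum_eq (f : Z -> Z -> C) s : is_sum (fun p => f (fst p) (snd p)) s ->
  lattice_sum f = (s - f 0%Z 0%Z)%C.
Proof.
  intros Hs.
  set (f0 := fun m n => if (Z.eqb m 0 && Z.eqb n 0)%bool then RtoC 0 else f m n).
  assert (E : lattice_sum f = lattice_sum f0).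
  { unfold lattice_sum. f_equal. f_equal. apply functional_extensionality. intros N. unfold sq_partial.
    apply sum_n_ext; intros i. apply sum_n_ext; intros j. cbv zeta. unfold f0.
    destruct ((_ =? 0)%Z && (_ =? 0)%Z)%bool; auto. }
  rewrite E, lattice_sum_total by reflexivity. apply is_sum_total.
  generalize (is_sum_minus _ _ _ _ Hs (is_sum_delta (f 0%Z 0%Z))). apply is_sum_ext.
  intros [m n]. unfold f0. simpl. destruct (Z.eqb_spec m 0); destruct (Z.eqb_spec n 0); simpl; subst; ring.
Qed.

Lemma Cinv_mult' (x y : C) : (/ (x * y))%C = (/ x * / y)%C.
Proof.
  destruct (Ceq_dec x 0%C) as [->|Hx]; [replace (RtoC 0 * y)%C with (RtoC 0) by ring; rewrite Cinv_0; ring|].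
  destruct (Ceq_dec y 0%C) as [->|Hy]; [replace (x * RtoC 0)%C with (RtoC 0) by ring; rewrite Cinv_0; ring|].
  field; auto.
Qed.

Lemma wp_wp_fun w1 w2 z : is_lattice_basis w1 w2 -> off_lat w1 w2 z -> wp w1 w2 z = wp_fun w1 w2 z.
Proof.
  intros HL Hz. unfold wp.
  pose proof (dominated_total _ (dominated_wp_term w1 w2 z HL Hz)) as Hs. fold (wp_fun w1 w2 z) in Hs.
  erewrite lattice_sum_eq.
  2:{ eapply is_sum_ext; [|exact Hs]. intros p. unfold wp_term, E_term, pt. rewrite !Cinv_mult'. simpl. ring. }
  cbv zeta. change (lat_pt w1 w2 0 0) with (pt w1 w2 (0,0)%Z). rewrite pt_0.
  replace (RtoC 0 * RtoC 0)%C with (RtoC 0) by ring. rewrite Cinv_0. replace (z - 0)%C with z by ring. ring.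
Qed.
Lemma wzeta_zeta_fun w1 w2 z : is_lattice_basis w1 w2 -> off_lat w1 w2 z -> wzeta w1 w2 z = zeta_fun w1 w2 z.
Proof.
  intros HL Hz. unfold wzeta.
  pose proof (dominated_total _ (dominated_zeta_term w1 w2 z HL Hz)) as Hs. fold (zeta_fun w1 w2 z) in Hs.
  erewrite lattice_sum_eq.
  2:{ eapply is_sum_ext; [|exact Hs]. intros p. unfold zeta_term, pt. unfold Cdiv. rewrite !Cinv_mult'. simpl. ring. }
  cbv zeta. change (lat_pt w1 w2 0 0) with (pt w1 w2 (0,0)%Z). rewrite pt_0.
  replace (RtoC 0 * RtoC 0)%C with (RtoC 0) by ring. unfold Cdiv. rewrite !Cinv_0. replace (z - 0)%C with z by ring. ring.
Qed.
Lemma lat_g2_G_sum w1 w2 : is_lattice_basis w1 w2 -> lat_g2 w1 w2 = (60 * G_sum w1 w2 4)%C.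
Proof.
  intros HL. unfold lat_g2. f_equal.
  pose proof (dominated_total _ (dominated_pt_pow w1 w2 4 HL ltac:(lia))) as Hs.
  erewrite lattice_sum_eq.
  2:{ eapply is_sum_ext; [|exact Hs]. intros p. unfold pt. rewrite !Cinv_mult'. simpl. ring. }
  cbv zeta. change (lat_pt w1 w2 0 0) with (pt w1 w2 (0,0)%Z). rewrite pt_0, !Cinv_mult', Cinv_0. unfold G_sum. ring.
Qed.
Lemma lat_g3_G_sum w1 w2 : is_lattice_basis w1 w2 -> lat_g3 w1 w2 = (140 * G_sum w1 w2 6)%C.
Proof.
  intros HL. unfold lat_g3. f_equal.
  pose proof (dominated_total _ (dominated_pt_pow w1 w2 6 HL ltac:(lia))) as Hs.
  erewrite lattice_sum_eq.
  2:{ eapply is_sum_ext; [|exact Hs]. intros p. unfold pt. rewrite !Cinv_mult'. simpl. ring. }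
  cbv zeta. change (lat_pt w1 w2 0 0) with (pt w1 w2 (0,0)%Z). rewrite pt_0, !Cinv_mult', Cinv_0. unfold G_sum. ring.
Qed.

Lemma E_fun_sum w1 w2 k z : is_lattice_basis w1 w2 -> (3 <= k)%nat -> is_sum (E_term w1 w2 k z) (E_fun w1 w2 k z).
Proof. intros. apply dominated_total, dominated_E_term; auto. Qed.
Lemma wp_fun_sum w1 w2 z : is_lattice_basis w1 w2 -> off_lat w1 w2 z -> is_sum (wp_term w1 w2 z) (wp_fun w1 w2 z).
Proof. intros. apply dominated_total, dominated_wp_term; auto. Qed.
Lemma zeta_fun_sum w1 w2 z : is_lattice_basis w1 w2 -> off_lat w1 w2 z -> is_sum (zeta_term w1 w2 z) (zeta_fun w1 w2 z).
Proof. intros. apply dominated_total, dominated_zeta_term; auto. Qed.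
Lemma G_sum_sum w1 w2 k : is_lattice_basis w1 w2 -> (3 <= k)%nat -> is_sum (fun p => (/ pt w1 w2 p) ^ k)%C (G_sum w1 w2 k).
Proof. intros. apply dominated_total, dominated_pt_pow; auto. Qed.

Lemma off_lat_shift_m w1 w2 z p : off_lat w1 w2 z -> off_lat w1 w2 (z - pt w1 w2 p)%C.
Proof. intros H. unfold Cminus. rewrite <- pt_opp. apply off_lat_shift, H. Qed.

(** A shift of the index by [q] aligns the singular terms at [z - pt w1 w2 q] with those at [z].
    Only the corrections [(/ w) ^ 2] remain, so the possible failure of periodicity is a sum with
    terms free of [z]. *)
Lemma kappa_wp_fun w1 w2 z q : is_lattice_basis w1 w2 -> off_lat w1 w2 z ->
  is_sum (fun p => (/ pt w1 w2 (padd p q)) ^ 2 - (/ pt w1 w2 p) ^ 2)%C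
    (wp_fun w1 w2 (z - pt w1 w2 q)%C - wp_fun w1 w2 z)%C.
Proof.
  intros HL Hz.
  eapply is_sum_ext; [|apply (is_sum_minus _ _ _ _ (wp_fun_sum w1 w2 (z - pt w1 w2 q)%C HL (off_lat_shift_m _ _ _ _ Hz))
    (is_sum_shift _ _ q (wp_fun_sum w1 w2 z HL Hz)))].
  intros p. unfold wp_term, E_term. rewrite pt_add.
  replace (z - (pt w1 w2 p + pt w1 w2 q))%C with (z - pt w1 w2 q - pt w1 w2 p)%C by ring. ring.
Qed.

(** The substitution [p -> - (p + q)] exchanges the two squares in each term of the defect, so the
    defect equals its own negative. *)
Lemma wp_fun_shift_m w1 w2 z q : is_lattice_basis w1 w2 -> off_lat w1 w2 z -> wp_fun w1 w2 (z - pt w1 w2 q)%C = wp_fun w1 w2 z.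
Proof.
  intros HL Hz. pose proof (kappa_wp_fun w1 w2 z q HL Hz) as H. apply Cminus_eq0.
  set (s := (wp_fun w1 w2 (z - pt w1 w2 q) - wp_fun w1 w2 z)%C) in *.
  assert (E : s = (- (1) * s)%C).
  { apply (is_sum_unique _ _ _ H).
    apply (is_sum_perm _ _ (fun p => popp (padd p q)) (fun p => popp (padd p q))) in H.
    - apply (is_sum_scal (- (1))%C) in H. eapply is_sum_ext; [|exact H]. intros p. simpl.
      replace (padd (popp (padd p q)) q) with (popp p)
        by (destruct p, q; unfold popp, padd; simpl; f_equal; ring).
      rewrite !pt_opp, !Cinv_opp. ring.
    - intros [m n]; destruct q; unfold popp, padd; simpl; f_equal; ring.
    - intros [m n]; destruct q; unfold popp, padd; simpl; f_equal; ring. }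
  assert (E2 : (2 * s)%C = 0%C) by (transitivity (s + s)%C; [ring|rewrite E at 2; ring]).
  replace s with (/ 2 * (2 * s))%C by (field; intros F; apply RtoC_inj in F; lra). rewrite E2. ring.
Qed.

Lemma wp_fun_shift w1 w2 z q : is_lattice_basis w1 w2 -> off_lat w1 w2 z -> wp_fun w1 w2 (z + pt w1 w2 q)%C = wp_fun w1 w2 z.
Proof.
  intros HL Hz. rewrite <- (wp_fun_shift_m w1 w2 z (popp q)) by auto. rewrite pt_opp. f_equal. ring.
Qed.

Lemma kappa_zero w1 w2 z q : is_lattice_basis w1 w2 -> off_lat w1 w2 z ->
  is_sum (fun p => (/ pt w1 w2 (padd p q)) ^ 2 - (/ pt w1 w2 p) ^ 2)%C 0%C.
Proof.
  intros HL Hz. pose proof (kappa_wp_fun w1 w2 z q HL Hz) as H. rewrite wp_fun_shift_m in H by auto.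
  replace (RtoC 0) with (wp_fun w1 w2 z - wp_fun w1 w2 z)%C by ring. auto.
Qed.

Lemma E_fun_shift w1 w2 k z q : is_lattice_basis w1 w2 -> (3 <= k)%nat -> E_fun w1 w2 k (z + pt w1 w2 q)%C = E_fun w1 w2 k z.
Proof.
  intros HL Hk. apply is_sum_total.
  eapply is_sum_ext; [|apply (is_sum_shift _ _ (popp q) (E_fun_sum w1 w2 k z HL Hk))].
  intros p. unfold E_term. rewrite pt_add, pt_opp. f_equal. f_equal. ring.
Qed.

(** Subtracting the value at a second point cancels the quasi-period. What is left, term by term, is
    [z - z0] times the defect of [wp], whose sum is 0 by [kappa_zero]. *)
Lemma zeta_fun_diff_shift_m w1 w2 z z0 q : is_lattice_basis w1 w2 -> off_lat w1 w2 z -> off_lat w1 w2 z0 ->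
  (zeta_fun w1 w2 (z - pt w1 w2 q) - zeta_fun w1 w2 (z0 - pt w1 w2 q))%C = (zeta_fun w1 w2 z - zeta_fun w1 w2 z0)%C.
Proof.
  intros HL Hz Hz0.
  pose proof (is_sum_minus _ _ _ _ (zeta_fun_sum w1 w2 z HL Hz) (zeta_fun_sum w1 w2 z0 HL Hz0)) as H1.
  apply (is_sum_shift _ _ q) in H1.
  pose proof (is_sum_minus _ _ _ _ (zeta_fun_sum w1 w2 _ HL (off_lat_shift_m w1 w2 z q Hz)) (zeta_fun_sum w1 w2 _ HL (off_lat_shift_m w1 w2 z0 q Hz0))) as H2.
  symmetry. apply Cminus_eq0.
  apply (is_sum_unique _ _ _ (is_sum_minus _ _ _ _ H1 H2)).
  replace (RtoC 0) with ((z - z0) * 0)%C by ring.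
  eapply is_sum_ext; [|apply (is_sum_scal (z - z0) _ _ (kappa_zero w1 w2 z q HL Hz))].
  intros p. unfold zeta_term. rewrite pt_add.
  replace (z - (pt w1 w2 p + pt w1 w2 q))%C with (z - pt w1 w2 q - pt w1 w2 p)%C by ring.
  replace (z0 - (pt w1 w2 p + pt w1 w2 q))%C with (z0 - pt w1 w2 q - pt w1 w2 p)%C by ring. ring.
Qed.

Lemma inv_sub_popp w1 w2 z p : (/ (- z - pt w1 w2 (popp p)))%C = (- / (z - pt w1 w2 p))%C.
Proof. rewrite pt_opp, <- Cinv_opp. f_equal. ring. Qed.

Lemma wp_fun_even w1 w2 z : is_lattice_basis w1 w2 -> off_lat w1 w2 z -> wp_fun w1 w2 (- z)%C = wp_fun w1 w2 z.
Proof.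
  intros HL Hz. apply (is_sum_unique (fun p => wp_term w1 w2 (- z)%C (popp p))).
  - apply is_sum_popp, wp_fun_sum; auto. apply off_lat_opp; auto.
  - eapply is_sum_ext; [|apply (wp_fun_sum w1 w2 z HL Hz)]. intros p. unfold wp_term, E_term.
    rewrite inv_sub_popp, pt_opp, Cinv_opp. ring.
Qed.
Lemma E3_fun_odd w1 w2 z : is_lattice_basis w1 w2 -> E_fun w1 w2 3 (- z)%C = (- E_fun w1 w2 3 z)%C.
Proof.
  intros HL. apply (is_sum_unique (fun p => E_term w1 w2 3 (- z)%C (popp p))).
  - apply is_sum_popp, E_fun_sum; auto.
  - replace (- E_fun w1 w2 3 z)%C with (- (1) * E_fun w1 w2 3 z)%C by ring.
    eapply is_sum_ext; [|apply is_sum_scal, (E_fun_sum w1 w2 3 z HL); auto]. intros p. unfold E_term.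
    rewrite inv_sub_popp. ring.
Qed.
Lemma zeta_fun_odd w1 w2 z : is_lattice_basis w1 w2 -> off_lat w1 w2 z -> zeta_fun w1 w2 (- z)%C = (- zeta_fun w1 w2 z)%C.
Proof.
  intros HL Hz. apply (is_sum_unique (fun p => zeta_term w1 w2 (- z)%C (popp p))).
  - apply is_sum_popp, zeta_fun_sum; auto. apply off_lat_opp; auto.
  - replace (- zeta_fun w1 w2 z)%C with (- (1) * zeta_fun w1 w2 z)%C by ring.
    eapply is_sum_ext; [|apply is_sum_scal, (zeta_fun_sum w1 w2 z HL); auto]. intros p. unfold zeta_term.
    rewrite inv_sub_popp, pt_opp, Cinv_opp. ring.
Qed.

(** Expressed through complements because [matched] decides at each point whether both lattices or
    neither contain it. *)
Definition same_lattice (w1 w2 v1 v2 : C) : Prop := forall z, off_lat w1 w2 z <-> off_lat v1 v2 z.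

Lemma not_off_lat w1 w2 z : ~ off_lat w1 w2 z -> exists p, z = pt w1 w2 p.
Proof. intros H. apply not_all_not_ex. intros H'. apply H. intros p E. apply (H' p); auto. Qed.

Lemma pt_inj w1 w2 p q : is_lattice_basis w1 w2 -> pt w1 w2 p = pt w1 w2 q -> p = q.
Proof.
  intros HL E. assert (H : padd p (popp q) = (0,0)%Z).
  { apply (pt_eq0 w1 w2); auto. rewrite pt_add, pt_opp, E. ring. }
  destruct p, q; unfold padd, popp in H; simpl in H. injection H; intros. f_equal; lia.
Qed.

(** Two bases of one lattice enumerate the same points. The index maps are picked by choice and are
    inverse to each other by [pt_inj], so the sum is merely permuted. *)
Lemma same_lattice_sum w1 w2 v1 v2 (g : C -> C) s :
  is_lattice_basis w1 w2 -> is_lattice_basis v1 v2 -> same_lattice w1 w2 v1 v2 ->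
  is_sum (fun p => g (pt w1 w2 p)) s -> is_sum (fun p => g (pt v1 v2 p)) s.
Proof.
  intros HL HL' HS Hs.
  assert (H1 : forall p, exists q, pt v1 v2 p = pt w1 w2 q).
  { intros p. apply not_off_lat. intros H. apply HS in H. apply (H p); auto. }
  assert (H2 : forall p, exists q, pt w1 w2 p = pt v1 v2 q).
  { intros p. apply not_off_lat. intros H. apply HS in H. apply (H p); auto. }
  set (h := fun p => proj1_sig (constructive_indefinite_description _ (H1 p))).
  set (k := fun p => proj1_sig (constructive_indefinite_description _ (H2 p))).
  assert (Hh : forall p, pt v1 v2 p = pt w1 w2 (h p)) by (intros p; unfold h; destruct constructive_indefinite_description; auto).
  assert (Hk : forall p, pt w1 w2 p = pt v1 v2 (k p)) by (intros p; unfold k; destruct constructive_indefinite_description; auto).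
  eapply is_sum_ext; [|apply (is_sum_perm (fun p => g (pt w1 w2 p)) s h k); [| |exact Hs]].
  - intros p. simpl. rewrite Hh. auto.
  - intros p. apply (pt_inj w1 w2); auto. rewrite <- Hh, <- Hk. auto.
  - intros p. apply (pt_inj v1 v2); auto. rewrite <- Hk, <- Hh. auto.
Qed.

Lemma same_lattice_wp_fun w1 w2 v1 v2 z : is_lattice_basis w1 w2 -> is_lattice_basis v1 v2 ->
  same_lattice w1 w2 v1 v2 -> off_lat w1 w2 z -> wp_fun w1 w2 z = wp_fun v1 v2 z.
Proof.
  intros HL HL' HS Hz. symmetry. apply is_sum_total.
  apply (same_lattice_sum w1 w2 v1 v2 (fun w => (/ (z - w)) ^ 2 - (/ w) ^ 2)%C); auto. apply wp_fun_sum; auto.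
Qed.
Lemma same_lattice_E_fun w1 w2 v1 v2 k z : is_lattice_basis w1 w2 -> is_lattice_basis v1 v2 ->
  same_lattice w1 w2 v1 v2 -> (3 <= k)%nat -> E_fun w1 w2 k z = E_fun v1 v2 k z.
Proof.
  intros HL HL' HS Hk. symmetry. apply is_sum_total.
  apply (same_lattice_sum w1 w2 v1 v2 (fun w => (/ (z - w)) ^ k)%C); auto. apply E_fun_sum; auto.
Qed.
Lemma same_lattice_zeta_fun w1 w2 v1 v2 z : is_lattice_basis w1 w2 -> is_lattice_basis v1 v2 ->
  same_lattice w1 w2 v1 v2 -> off_lat w1 w2 z -> zeta_fun w1 w2 z = zeta_fun v1 v2 z.
Proof.
  intros HL HL' HS Hz. symmetry. apply is_sum_total.
  apply (same_lattice_sum w1 w2 v1 v2 (fun w => / (z - w) + / w + z * (/ w) ^ 2)%C); auto. apply zeta_fun_sum; auto.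
Qed.

Lemma basis_conj w1 w2 : is_lattice_basis w1 w2 -> is_lattice_basis (Cconj w1) (Cconj w2).
Proof.
  intros [H1 H2]. split.
  - intros E. apply H1. rewrite <- (Cconj_conj w1), E. apply injective_projections; simpl; ring.
  - rewrite <- Cdiv_conj, im_conj by auto. lra.
Qed.
Lemma off_lat_conj w1 w2 z : off_lat w1 w2 z -> off_lat (Cconj w1) (Cconj w2) (Cconj z).
Proof. intros H p E. apply (H p). rewrite pt_conj in E. rewrite <- (Cconj_conj z), E, Cconj_conj. auto. Qed.

Lemma wp_fun_conj w1 w2 z : is_lattice_basis w1 w2 -> off_lat w1 w2 z ->
  wp_fun (Cconj w1) (Cconj w2) (Cconj z) = Cconj (wp_fun w1 w2 z).
Proof.
  intros HL Hz. apply is_sum_total. eapply is_sum_ext; [|apply is_sum_conj, (wp_fun_sum w1 w2 z HL Hz)].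
  intros p. unfold wp_term, E_term. rewrite pt_conj, Cminus_conj, !Cpow_conj, !Cinv_conj', Cminus_conj. auto.
Qed.
Lemma zeta_fun_conj w1 w2 z : is_lattice_basis w1 w2 -> off_lat w1 w2 z ->
  zeta_fun (Cconj w1) (Cconj w2) (Cconj z) = Cconj (zeta_fun w1 w2 z).
Proof.
  intros HL Hz. apply is_sum_total. eapply is_sum_ext; [|apply is_sum_conj, (zeta_fun_sum w1 w2 z HL Hz)].
  intros p. unfold zeta_term. rewrite pt_conj, !Cplus_conj, Cmult_conj, !Cpow_conj, !Cinv_conj', Cminus_conj. auto.
Qed.
Lemma E_fun_conj w1 w2 k z : is_lattice_basis w1 w2 -> (3 <= k)%nat ->
  E_fun (Cconj w1) (Cconj w2) k (Cconj z) = Cconj (E_fun w1 w2 k z).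
Proof.
  intros HL Hk. apply is_sum_total. eapply is_sum_ext; [|apply is_sum_conj, (E_fun_sum w1 w2 k z HL Hk)].
  intros p. unfold E_term. rewrite pt_conj, Cpow_conj, !Cinv_conj', Cminus_conj. auto.
Qed.
Lemma G_sum_conj w1 w2 k : is_lattice_basis w1 w2 -> (3 <= k)%nat ->
  G_sum (Cconj w1) (Cconj w2) k = Cconj (G_sum w1 w2 k).
Proof.
  intros HL Hk. apply is_sum_total. eapply is_sum_ext; [|apply is_sum_conj, (G_sum_sum w1 w2 k HL Hk)].
  intros p. simpl. rewrite pt_conj, Cpow_conj, !Cinv_conj'. auto.
Qed.

(** * Eisenstein's identity *)

Lemma sumC_perm {A} (f : A -> C) l l' : Permutation l l' -> sumC f l = sumC f l'.
Proof.
  induction 1; cbn [sumC]; [auto|rewrite IHPermutation; auto|ring|congruence].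
Qed.
Lemma sumC_square_odd (f : Z * Z -> C) N : (forall q, f (popp q) = (- f q)%C) -> sumC f (square N) = 0%C.
Proof.
  intros Ho. set (s := sumC f (square N)).
  assert (E : s = (- (1) * s)%C).
  { unfold s. rewrite <- sumC_scal. rewrite (sumC_perm f (square N) (map popp (square N))).
    - rewrite sumC_map. apply sumC_ext. intros p. rewrite Ho. ring.
    - apply NoDup_Permutation; [apply NoDup_square| |].
      + apply FinFun.Injective_map_NoDup; [|apply NoDup_square]. intros a b E.
        rewrite <- (popp_invol a), <- (popp_invol b), E; auto.
      + intros p. rewrite in_map_iff. split.
        * intros Hp. exists (popp p). split; [apply popp_invol|]. apply in_square in Hp. apply in_square.
          destruct p; simpl in *; lia.
        * intros [q [E Hq]]. subst p. apply in_square in Hq. apply in_square. destruct q; simpl in *; lia. }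
  assert (E2 : (2 * s)%C = 0%C) by (transitivity (s + s)%C; [ring|rewrite E at 2; ring]).
  replace s with (/ 2 * (2 * s))%C by (field; intros F; apply RtoC_inj in F; lra). rewrite E2. ring.
Qed.

(** The triangle inequality and the subadditivity of the square root, divided by the product of the
    three roots. It trades decay in [q] and [p + q] for half a power of decay in [p]. *)
Lemma rnorm_tri p q : rnorm q * rnorm (padd p q) <= rnorm p * (rnorm q + rnorm (padd p q)).
Proof.
  assert (H : sqrt (lnorm p) <= sqrt (lnorm q) + sqrt (lnorm (padd p q))).
  { assert (H0 : lnorm p <= lnorm q + lnorm (padd p q)).
    { unfold lnorm, padd; simpl. rewrite !plus_IZR.
      assert (T : forall a b, Rabs a <= Rabs b + Rabs (a + b)).
      { intros a b. replace a with (- b + (a + b)) at 1 by ring. rewrite <- (Rabs_Ropp b). apply Rabs_triang. }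
      pose proof (T (IZR (fst p)) (IZR (fst q))). pose proof (T (IZR (snd p)) (IZR (snd q))). lra. }
    pose proof (lnorm_ge1 q) as Hq. pose proof (lnorm_ge1 (padd p q)) as Hr.
    pose proof (sqrt_pos (lnorm q)). pose proof (sqrt_pos (lnorm (padd p q))).
    rewrite <- (sqrt_pow2 (sqrt (lnorm q) + sqrt (lnorm (padd p q)))) by lra. apply sqrt_le_1_alt.
    pose proof (sqrt_sqrt (lnorm q)). pose proof (sqrt_sqrt (lnorm (padd p q))). nra. }
  unfold rnorm. assert (Hpos : forall p, 0 < sqrt (lnorm p)) by (intros r; apply sqrt_lt_R0; pose proof (lnorm_ge1 r); lra).
  pose proof (Hpos p). pose proof (Hpos q). pose proof (Hpos (padd p q)).
  set (a := sqrt (lnorm p)) in *. set (b := sqrt (lnorm q)) in *. set (d := sqrt (lnorm (padd p q))) in *.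
  replace (/ a * (/ b + / d)) with (/ b * / d * (/ a * (b + d))) by (field; lra).
  rewrite <- (Rmult_1_r (/ b * / d)) at 1. apply Rmult_le_compat_l.
  - left; apply Rmult_lt_0_compat; apply Rinv_0_lt_compat; auto.
  - apply Rmult_le_reg_l with a; auto. replace (a * (/ a * (b + d))) with (b + d) by (field; lra). lra.
Qed.

Lemma pow5_mix (b d : R) (i j : nat) : 0 < b -> 0 < d -> (i + j = 5)%nat -> b ^ i * d ^ j <= b ^ 5 + d ^ 5.
Proof.
  intros Hb Hd E.
  assert (P : forall x, 0 < x -> 0 < x ^ 5) by (intros; apply pow_lt; auto).
  pose proof (P b Hb). pose proof (P d Hd).
  destruct (Rle_or_lt b d).
  - apply Rle_trans with (d ^ 5); [|lra]. rewrite <- E, pow_add. apply Rmult_le_compat_r; [apply pow_le; lra|].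
    apply pow_incr; lra.
  - apply Rle_trans with (b ^ 5); [|lra]. rewrite <- E, pow_add. apply Rmult_le_compat_l; [apply pow_le; lra|].
    apply pow_incr; lra.
Qed.

(* Summed over [q] this gives [wp z / x ^ 3 - 1 / x ^ 5] with [x = z - pt w1 w2 p]; summed over [p] it is
   odd in [q]. *)
Definition eis (w1 w2 z : C) (p q : Z * Z) : C :=
  if (Z.eqb (fst q) 0 && Z.eqb (snd q) 0)%bool then RtoC 0
  else ((/ (z - pt w1 w2 p)) ^ 3 * wp_term w1 w2 (z - pt w1 w2 p) q)%C.

(** The factor [x] from [inv_square_diff_bound] cancels one of the three inverse powers and leaves
    decay of degree 2 in [p], which is not summable over a plane lattice. In units of [rnorm] the
    bound is [a ^ 4] times a monomial of degree 6 in [b] and [d]; replacing one factor [b d] by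
    [a (b + d)] gives [a ^ 5] and degree 5, both controlled by the weights. *)
Lemma eis_bound w1 w2 z : is_lattice_basis w1 w2 -> off_lat w1 w2 z ->
  exists K, 0 <= K /\ forall p q, Cmod (eis w1 w2 z p q) <= K * wgt p * (wgt q + wgt (padd p q)).
Proof.
  intros HL Hz. destruct (inv_low _ _ HL z) as [K [HK0 HK]]. destruct (pt_low _ _ HL) as [L [HL0 HLp]].
  assert (HC : 0 <= 2 * K ^ 2 * (K ^ 2 * L + K * L ^ 2)).
  { repeat apply Rmult_le_pos; try lra.
    apply Rplus_le_le_0_compat; repeat apply Rmult_le_pos; lra. }
  exists (2 * K ^ 2 * (K ^ 2 * L + K * L ^ 2)). split; [exact HC|].
  intros p q. unfold eis.
  pose proof (wgt_pos p). pose proof (wgt_pos q). pose proof (wgt_pos (padd p q)).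
  destruct ((fst q =? 0)%Z && (snd q =? 0)%Z)%bool eqn:Hq.
  { rewrite Cmod_0. apply Rmult_le_pos; [apply Rmult_le_pos|]; lra. }
  assert (Hv : pt w1 w2 q <> 0%C).
  { intros F. apply (pt_eq0 w1 w2 q HL) in F. subst q. discriminate Hq. }
  assert (Hx : (z - pt w1 w2 p)%C <> 0%C) by (apply off_lat_sub; auto).
  assert (Hy : (z - pt w1 w2 p - pt w1 w2 q)%C <> 0%C).
  { replace (z - pt w1 w2 p - pt w1 w2 q)%C with (z - pt w1 w2 (padd p q))%C by (rewrite pt_add; ring).
    apply off_lat_sub; auto. }
  unfold wp_term, E_term. rewrite Cmod_mult, Cmod_pow.
  pose proof (inv_square_diff_bound _ _ Hx Hv Hy) as HB.
  pose proof (HK p) as HX. pose proof (HLp q) as HV. pose proof (HK (padd p q)) as HY.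
  rewrite <- rnorm_square in HX, HV, HY. rewrite pt_add in HY.
  replace (z - (pt w1 w2 p + pt w1 w2 q))%C with (z - pt w1 w2 p - pt w1 w2 q)%C in HY by ring.
  assert (HX1 : Cmod (/ (z - pt w1 w2 p))%C * Cmod (z - pt w1 w2 p)%C = 1)
    by (rewrite <- Cmod_mult, Cinv_l by auto; apply Cmod_1).
  pose proof (rnorm_tri p q) as HT.
  pose proof (rnorm_pos p) as Ha. pose proof (rnorm_pos q) as Hb. pose proof (rnorm_pos (padd p q)) as Hd.
  pose proof (rnorm5_wgt p) as Wa. pose proof (rnorm5_wgt q) as Wb. pose proof (rnorm5_wgt (padd p q)) as Wd.
  set (X := Cmod (/ (z - pt w1 w2 p))%C) in *. set (V := Cmod (/ pt w1 w2 q)%C) in *.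
  set (Y := Cmod (/ (z - pt w1 w2 p - pt w1 w2 q))%C) in *.
  set (a := rnorm p) in *. set (b := rnorm q) in *. set (d := rnorm (padd p q)) in *.
  set (M := 2 * (wgt p * (wgt q + wgt (padd p q)))).
  assert (HX0 : 0 <= X) by apply Cmod_ge_0. assert (HV0 : 0 <= V) by apply Cmod_ge_0.
  assert (HY0 : 0 <= Y) by apply Cmod_ge_0.
  apply Rle_trans with (X ^ 3 * (Cmod (z - pt w1 w2 p)%C * (Y ^ 2 * V + Y * V ^ 2))).
  { apply Rmult_le_compat_l; [apply pow_le; auto|exact HB]. }
  replace (X ^ 3 * (Cmod (z - pt w1 w2 p)%C * (Y ^ 2 * V + Y * V ^ 2))) with
     ((X * Cmod (z - pt w1 w2 p)%C) * (X ^ 2 * (Y ^ 2 * V + Y * V ^ 2))) by ring.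
  rewrite HX1, Rmult_1_l.
  assert (B0 : X ^ 2 <= (K * a ^ 2) ^ 2) by (apply pow_incr; auto).
  assert (B1 : Y ^ 2 * V <= (K * d ^ 2) ^ 2 * (L * b ^ 2)).
  { apply Rmult_le_compat; auto; [apply pow_le; auto|apply pow_incr; auto]. }
  assert (B2 : Y * V ^ 2 <= (K * d ^ 2) * (L * b ^ 2) ^ 2).
  { apply Rmult_le_compat; auto; [apply pow_le; auto|apply pow_incr; auto]. }
  assert (HYV : 0 <= Y ^ 2 * V + Y * V ^ 2).
  { apply Rplus_le_le_0_compat; apply Rmult_le_pos; auto; apply pow_le; auto. }
  assert (HX2 : 0 <= X ^ 2) by (apply pow_le; auto).
  assert (Hmix : forall i j, (i + j = 4)%nat -> a ^ 4 * (b ^ i * d ^ j * (b * d)) <= M).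
  { intros i j Eij. unfold M.
    apply Rle_trans with (2 * (a ^ 5 * (b ^ 5 + d ^ 5))).
    - apply Rle_trans with (a ^ 4 * (b ^ i * d ^ j * (a * (b + d)))).
      + apply Rmult_le_compat_l; [apply pow_le; lra|]. apply Rmult_le_compat_l; auto.
        apply Rmult_le_pos; apply pow_le; lra.
      + replace (a ^ 4 * (b ^ i * d ^ j * (a * (b + d)))) with (a ^ 5 * (b ^ S i * d ^ j + b ^ i * d ^ S j))
          by (simpl; ring).
        pose proof (pow5_mix b d (S i) j Hb Hd ltac:(lia)). pose proof (pow5_mix b d i (S j) Hb Hd ltac:(lia)).
        assert (0 < a ^ 5) by (apply pow_lt; auto).
        replace (2 * (a ^ 5 * (b ^ 5 + d ^ 5))) with (a ^ 5 * (2 * (b ^ 5 + d ^ 5))) by ring.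
        apply Rmult_le_compat_l; lra.
    - apply Rmult_le_compat_l; [lra|]. apply Rmult_le_compat; try lra; [apply pow_le; lra|].
      apply Rplus_le_le_0_compat; apply pow_le; lra. }
  apply Rle_trans with ((K * a ^ 2) ^ 2 * ((K * d ^ 2) ^ 2 * (L * b ^ 2) + (K * d ^ 2) * (L * b ^ 2) ^ 2)).
  { apply Rmult_le_compat; auto; lra. }
  replace ((K * a ^ 2) ^ 2 * ((K * d ^ 2) ^ 2 * (L * b ^ 2) + (K * d ^ 2) * (L * b ^ 2) ^ 2)) with
     (K ^ 2 * (K ^ 2 * L) * (a ^ 4 * (b ^ 1 * d ^ 3 * (b * d)))
      + K ^ 2 * (K * L ^ 2) * (a ^ 4 * (b ^ 3 * d ^ 1 * (b * d)))) by ring.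
  replace (2 * K ^ 2 * (K ^ 2 * L + K * L ^ 2) * wgt p * (wgt q + wgt (padd p q))) with
     (K ^ 2 * (K ^ 2 * L) * M + K ^ 2 * (K * L ^ 2) * M) by (unfold M; ring).
  apply Rplus_le_compat; (apply Rmult_le_compat_l; [|apply Hmix; auto]);
    repeat apply Rmult_le_pos; lra.
Qed.

Lemma eis_row w1 w2 z p : is_lattice_basis w1 w2 -> off_lat w1 w2 z ->
  is_sum (eis w1 w2 z p) ((/ (z - pt w1 w2 p)) ^ 3 * wp_fun w1 w2 z - (/ (z - pt w1 w2 p)) ^ 5)%C.
Proof.
  intros HL Hz. pose proof (wp_fun_sum w1 w2 _ HL (off_lat_shift_m w1 w2 z p Hz)) as H. rewrite wp_fun_shift_m in H by auto.
  apply (is_sum_scal ((/ (z - pt w1 w2 p)) ^ 3)%C) in H.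
  eapply is_sum_ext; [|apply (is_sum_minus _ _ _ _ H (is_sum_delta ((/ (z - pt w1 w2 p)) ^ 5)%C))].
  intros [m n]. unfold eis. cbn beta. destruct (Z.eqb_spec (fst (m, n)) 0) as [E|E];
  destruct (Z.eqb_spec (snd (m, n)) 0) as [E'|E']; cbn [andb]; try ring.
  simpl in E, E'; subst. unfold wp_term, E_term. rewrite pt_0, Cinv_0.
  replace (z - pt w1 w2 p - 0)%C with (z - pt w1 w2 p)%C by ring. ring.
Qed.

Lemma eis_col_dominated w1 w2 z q : is_lattice_basis w1 w2 -> off_lat w1 w2 z -> dominated (fun p => eis w1 w2 z p q).
Proof.
  intros HL Hz. destruct (eis_bound w1 w2 z HL Hz) as [K [HK0 HK]]. exists (K * 200). intros p.
  eapply Rle_trans; [apply HK|].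
  assert (B : forall r, wgt r <= 100).
  { intros r. assert (H := wgt_bound (r :: nil)). cbn [sumR] in H.
    assert (NoDup (r :: nil)) by (constructor; [intros []|constructor]). specialize (H H0). lra. }
  pose proof (B q). pose proof (B (padd p q)). pose proof (wgt_pos p).
  replace (K * 200 * wgt p) with (K * wgt p * 200) by ring. apply Rmult_le_compat_l; [nra|lra].
Qed.

(* With [v] the lattice point of index [q], [x = z - w] and [y = x - v]:
   [x^-3 (y^-2 - v^-2) + y^-3 (x^-2 - v^-2) = - v^-3 (y^-2 - x^-2)], whose sum over [w] vanishes by
   periodicity of [wp]. *)
Lemma eis_col_odd w1 w2 z q : is_lattice_basis w1 w2 -> off_lat w1 w2 z ->
  total (fun p => eis w1 w2 z p (popp q)) = (- total (fun p => eis w1 w2 z p q))%C.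
Proof.
  intros HL Hz.
  pose proof (dominated_total _ (eis_col_dominated w1 w2 z q HL Hz)) as H1.
  pose proof (is_sum_shift _ _ q (dominated_total _ (eis_col_dominated w1 w2 z (popp q) HL Hz))) as H2.
  set (s := total (fun p => eis w1 w2 z p q)) in *. set (t := total (fun p => eis w1 w2 z p (popp q))) in *.
  cut ((s + t)%C = 0%C). { intros E. replace t with ((s + t) - s)%C by ring. rewrite E. ring. }
  apply (is_sum_unique _ _ _ (is_sum_plus _ _ _ _ H1 H2)).
  pose proof (is_sum_minus _ _ _ _ (wp_fun_sum w1 w2 _ HL (off_lat_shift_m w1 w2 z q Hz)) (wp_fun_sum w1 w2 z HL Hz)) as H3.
  rewrite wp_fun_shift_m in H3 by auto. replace (wp_fun w1 w2 z - wp_fun w1 w2 z)%C with (RtoC 0) in H3 by ring.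
  destruct (Ceq_dec (pt w1 w2 q) 0%C) as [E|E].
  - assert (q = (0,0)%Z) by (apply (pt_eq0 w1 w2); auto). subst q.
    apply (is_sum_scal 0%C) in H3. replace (RtoC 0 * RtoC 0)%C with (RtoC 0) in H3 by ring.
    eapply is_sum_ext; [|exact H3]. intros p. unfold eis. simpl. ring.
  - apply (is_sum_scal (- (/ pt w1 w2 q) ^ 3)%C) in H3.
    replace (- (/ pt w1 w2 q) ^ 3 * 0)%C with (RtoC 0) in H3 by ring.
    eapply is_sum_ext; [|exact H3]. intros p. unfold eis.
    assert (Hb : ((fst q =? 0)%Z && (snd q =? 0)%Z)%bool = false).
    { destruct (Z.eqb_spec (fst q) 0) as [Ea|Ea]; destruct (Z.eqb_spec (snd q) 0) as [Eb|Eb]; auto.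
      exfalso. apply E. destruct q. simpl in *. subst. apply pt_0. }
    assert (Hb' : ((fst (popp q) =? 0)%Z && (snd (popp q) =? 0)%Z)%bool = false).
    { rewrite <- Hb. destruct q as [m n]. simpl. destruct m, n; auto. }
    rewrite Hb, Hb'. unfold wp_term, E_term. rewrite pt_opp, pt_add.
    assert (Hx : (z - pt w1 w2 p)%C <> 0%C) by (apply off_lat_sub; auto).
    assert (Hy : (z - pt w1 w2 p - pt w1 w2 q)%C <> 0%C)
    by (replace (z - pt w1 w2 p - pt w1 w2 q)%C with (z - pt w1 w2 (padd p q))%C by (rewrite pt_add; ring);
        apply off_lat_sub; auto).
    set (v := pt w1 w2 q) in *. set (w := pt w1 w2 p) in *.
    replace (z - (w + v) - - v)%C with (z - w)%C by ring.
    replace (z - (w + v))%C with (z - w - v)%C by ring.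
    replace (z - v - w)%C with (z - w - v)%C by ring.
    rewrite Cinv_opp. set (x := (z - w)%C) in *. set (u := ((/ w) ^ 2)%C). field. auto.
Qed.

(** The rows sum to the difference [s] of the two sides, whereas the column sums are odd in [q], so
    a symmetric square of columns contributes 0. Removing from every row its part in [square N]
    therefore leaves the total [s] unchanged, while what remains of each row tends to 0 under a
    common summable bound; [tannery] yields [s = 0]. *)
Lemma eisenstein w1 w2 z : is_lattice_basis w1 w2 -> off_lat w1 w2 z ->
  E_fun w1 w2 5 z = (wp_fun w1 w2 z * E_fun w1 w2 3 z)%C.
Proof.
  intros HL Hz. destruct (eis_bound w1 w2 z HL Hz) as [K [HK0 HK]].
  set (row := fun p => ((/ (z - pt w1 w2 p)) ^ 3 * wp_fun w1 w2 z - (/ (z - pt w1 w2 p)) ^ 5)%C).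
  set (F := fun (N : nat) p => (row p - sumC (eis w1 w2 z p) (square N))%C).
  (* The weights of [q] and those of [p + q] each sum to at most 100. *)
  assert (Hl : forall p l, NoDup l -> Cmod (sumC (eis w1 w2 z p) l) <= 200 * K * wgt p).
  { intros p l Hl. eapply Rle_trans; [apply (sumC_Cmod _ (fun q => K * wgt p * (wgt q + wgt (padd p q)))); auto|].
    rewrite sumR_scal.
    assert (E : sumR (fun q => wgt q + wgt (padd p q)) l = sumR wgt l + sumR wgt (map (padd p) l)).
    { clear. induction l; cbn [sumR map]; [ring|rewrite IHl; ring]. }
    rewrite E. pose proof (wgt_bound l Hl).
    assert (sumR wgt (map (padd p) l) <= 100).
    { apply wgt_bound. apply FinFun.Injective_map_NoDup; auto. intros [a b] [a' b'] Eq. unfold padd in Eq.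
      simpl in Eq. injection Eq; intros. f_equal; lia. }
    pose proof (wgt_pos p). assert (0 <= K * wgt p) by nra. nra. }
  assert (Hrow : forall p, is_sum (eis w1 w2 z p) (row p)) by (intros; apply eis_row; auto).
  assert (Hrb : forall p, Cmod (row p) <= 200 * K * wgt p).
  { intros p. apply le_epsilon. intros eps He. destruct (Hrow p eps He) as [N HN].
    specialize (HN (square N) (NoDup_square N) (incl_refl _)). specialize (Hl p (square N) (NoDup_square N)).
    replace (row p) with (sumC (eis w1 w2 z p) (square N) + - (sumC (eis w1 w2 z p) (square N) - row p))%C by ring.
    eapply Rle_trans; [apply Cmod_triangle|]. rewrite Cmod_opp. lra. }
  assert (HS : is_sum row (wp_fun w1 w2 z * E_fun w1 w2 3 z - E_fun w1 w2 5 z)%C).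
  { eapply is_sum_ext; [|apply (is_sum_minus _ _ _ _ (is_sum_scal (wp_fun w1 w2 z) _ _ (E_fun_sum w1 w2 3 z HL ltac:(lia)))
       (E_fun_sum w1 w2 5 z HL ltac:(lia)))]. intros p. unfold row, E_term. ring. }
  assert (HF : forall N, is_sum (F N) (wp_fun w1 w2 z * E_fun w1 w2 3 z - E_fun w1 w2 5 z)%C).
  { intros N. unfold F.
    (* The sum over [p] is exchanged only with finitely many columns, where additivity suffices. *)
    assert (Hc : forall l, is_sum (fun p => sumC (eis w1 w2 z p) l) (sumC (fun q => total (fun p => eis w1 w2 z p q)) l)).
    { induction l as [|q l IH]; cbn [sumC].
      - intros eps He. exists O. intros l _ _.
        assert (E : sumC (fun _ : Z * Z => RtoC 0) l = 0%C) by (clear; induction l; cbn [sumC]; [auto|rewrite IHl; ring]).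
        rewrite E. replace (0 - 0)%C with (RtoC 0) by ring. rewrite Cmod_0; auto.
      - apply is_sum_plus; auto. apply dominated_total, eis_col_dominated; auto. }
    pose proof (is_sum_minus _ _ _ _ HS (Hc (square N))) as H.
    rewrite sumC_square_odd in H by (intros; apply eis_col_odd; auto).
    replace (wp_fun w1 w2 z * E_fun w1 w2 3 z - E_fun w1 w2 5 z - 0)%C with (wp_fun w1 w2 z * E_fun w1 w2 3 z - E_fun w1 w2 5 z)%C in H by ring.
    exact H. }
  set (s := (wp_fun w1 w2 z * E_fun w1 w2 3 z - E_fun w1 w2 5 z)%C) in *.
  assert (E : Cmod s = 0).
  { apply Rle_antisym; [|apply Cmod_ge_0]. apply le_epsilon. intros eps He.
    destruct (tannery F (fun _ => s) (400 * K) HF) with (eps := eps) as [N HN]; auto; [| |lra].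
    - intros N p. unfold F. unfold Cminus. eapply Rle_trans; [apply Cmod_triangle|]. rewrite Cmod_opp.
      pose proof (Hrb p). pose proof (Hl p (square N) (NoDup_square N)). lra.
    - intros p e Hee. destruct (Hrow p e Hee) as [N HN]. exists N. intros M HM. unfold F.
      specialize (HN (square M) (NoDup_square M) (square_mono _ _ HM)).
      rewrite <- Cmod_opp. replace (- (row p - sumC (eis w1 w2 z p) (square M)))%C with
       (sumC (eis w1 w2 z p) (square M) - row p)%C by ring. lra. }
  apply Cmod_eq_0 in E. symmetry. apply Cminus_eq0. exact E.
Qed.

(** * Complex derivatives and Laurent expansions *)

(* A derivative with quadratic remainder: it is what term by term estimates of lattice sums give, and it
   spares all uniform convergence arguments. *)
Definition cderiv (f : C -> C) (z l : C) : Prop :=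
  exists K d, 0 < d /\ forall h, Cmod h < d -> Cmod (f (z + h) - f z - h * l)%C <= K * Cmod h ^ 2.

Lemma cderiv_pos f z l : cderiv f z l -> exists K d, 0 <= K /\ 0 < d <= 1 /\
  forall h, Cmod h < d -> Cmod (f (z + h) - f z - h * l)%C <= K * Cmod h ^ 2.
Proof.
  intros [K [d [Hd H]]]. exists (Rmax K 0), (Rmin d 1). split; [apply Rmax_r|]. split.
  - split; [apply Rmin_glb_lt; lra|apply Rmin_r].
  - intros h Hh. eapply Rle_trans; [apply H; eapply Rlt_le_trans; [exact Hh|apply Rmin_l]|].
    apply Rmult_le_compat_r; [apply pow_le, Cmod_ge_0|apply Rmax_l].
Qed.

Lemma cderiv_plus f g z l m : cderiv f z l -> cderiv g z m -> cderiv (fun x => f x + g x)%C z (l + m)%C.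
Proof.
  intros Hf Hg. apply cderiv_pos in Hf, Hg.
  destruct Hf as [K [d [HK [Hd H]]]]. destruct Hg as [L [e [HL [He G]]]].
  exists (K + L), (Rmin d e). split; [apply Rmin_glb_lt; lra|]. intros h Hh.
  specialize (H h (Rlt_le_trans _ _ _ Hh (Rmin_l _ _))). specialize (G h (Rlt_le_trans _ _ _ Hh (Rmin_r _ _))).
  replace (f (z + h) + g (z + h) - (f z + g z) - h * (l + m))%C with
    ((f (z + h) - f z - h * l) + (g (z + h) - g z - h * m))%C by ring.
  eapply Rle_trans; [apply Cmod_triangle|]. lra.
Qed.

Lemma cderiv_mult f g z l m : cderiv f z l -> cderiv g z m -> cderiv (fun x => f x * g x)%C z (l * g z + f z * m)%C.
Proof.
  intros Hf Hg. apply cderiv_pos in Hf, Hg.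
  destruct Hf as [K [d [HK [Hd H]]]]. destruct Hg as [L [e [HL [He G]]]].
  exists ((Cmod l + K) * (Cmod m + L) + Cmod (f z) * L + Cmod (g z) * K), (Rmin d e).
  split; [apply Rmin_glb_lt; lra|]. intros h Hh.
  assert (Hh1 : Cmod h <= 1) by (pose proof (Rmin_l d e); lra).
  specialize (H h (Rlt_le_trans _ _ _ Hh (Rmin_l _ _))). specialize (G h (Rlt_le_trans _ _ _ Hh (Rmin_r _ _))).
  set (Rf := (f (z + h) - f z - h * l)%C) in *. set (Rg := (g (z + h) - g z - h * m)%C) in *.
  pose proof (Cmod_ge_0 h) as Hh0. pose proof (Cmod_ge_0 l). pose proof (Cmod_ge_0 m).
  assert (Hh2 : Cmod h ^ 2 <= Cmod h) by nra.
  assert (HKh : K * Cmod h ^ 2 <= K * Cmod h) by (apply Rmult_le_compat_l; auto).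
  assert (HLh : L * Cmod h ^ 2 <= L * Cmod h) by (apply Rmult_le_compat_l; auto).
  assert (HF : Cmod (h * l + Rf)%C <= Cmod h * (Cmod l + K)).
  { eapply Rle_trans; [apply Cmod_triangle|]. rewrite Cmod_mult. lra. }
  assert (HG : Cmod (h * m + Rg)%C <= Cmod h * (Cmod m + L)).
  { eapply Rle_trans; [apply Cmod_triangle|]. rewrite Cmod_mult. lra. }
  replace (f (z + h) * g (z + h) - f z * g z - h * (l * g z + f z * m))%C with
    ((h * l + Rf) * (h * m + Rg) + (f z * Rg + g z * Rf))%C by (unfold Rf, Rg; ring).
  eapply Rle_trans; [apply Cmod_triangle|]. rewrite Cmod_mult.
  pose proof (Cmod_triangle (f z * Rg)%C (g z * Rf)%C) as HT. rewrite !Cmod_mult in HT.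
  assert (P1 : Cmod (h * l + Rf)%C * Cmod (h * m + Rg)%C <= (Cmod h * (Cmod l + K)) * (Cmod h * (Cmod m + L))).
  { apply Rmult_le_compat; auto; apply Cmod_ge_0. }
  assert (P2 : Cmod (f z) * Cmod Rg <= Cmod (f z) * (L * Cmod h ^ 2)).
  { apply Rmult_le_compat_l; auto; apply Cmod_ge_0. }
  assert (P3 : Cmod (g z) * Cmod Rf <= Cmod (g z) * (K * Cmod h ^ 2)).
  { apply Rmult_le_compat_l; auto; apply Cmod_ge_0. }
  lra.
Qed.

Lemma cderiv_const c z : cderiv (fun _ => c) z 0%C.
Proof.
  exists 0, 1. split; [lra|]. intros h _. replace (c - c - h * 0)%C with (RtoC 0) by ring. rewrite Cmod_0. lra.
Qed.

Lemma cderiv_val f z l l' : l = l' -> cderiv f z l -> cderiv f z l'.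
Proof. intros ->; auto. Qed.

Lemma cderiv_scal c f z l : cderiv f z l -> cderiv (fun x => c * f x)%C z (c * l)%C.
Proof. intros H. eapply cderiv_val; [|apply (cderiv_mult _ _ _ _ _ (cderiv_const c z) H)]. simpl. ring. Qed.

Lemma cderiv_lip f z l : cderiv f z l -> exists K d, 0 <= K /\ 0 < d /\
  forall h, Cmod h < d -> Cmod (f (z + h) - f z)%C <= K * Cmod h.
Proof.
  intros H. apply cderiv_pos in H. destruct H as [K [d [HK [Hd H]]]]. exists (Cmod l + K), d.
  pose proof (Cmod_ge_0 l). split; [lra|]. split; [lra|]. intros h Hh. specialize (H h Hh).
  replace (f (z + h) - f z)%C with ((f (z + h) - f z - h * l) + h * l)%C by ring.
  eapply Rle_trans; [apply Cmod_triangle|]. rewrite Cmod_mult. pose proof (Cmod_ge_0 h).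
  assert (K * Cmod h ^ 2 <= K * Cmod h) by (apply Rmult_le_compat_l; nra). lra.
Qed.

Lemma is_derive_quad (f : R -> R) x l K d : 0 < d ->
  (forall h, Rabs h < d -> Rabs (f (x + h) - f x - h * l) <= K * h ^ 2) -> is_derive f x l.
Proof.
  intros Hd H. apply is_derive_Reals. intros eps He.
  assert (Hdel : 0 < Rmin d (eps / (Rabs K + 1))).
  { apply Rmin_glb_lt; auto. apply Rdiv_lt_0_compat; auto. pose proof (Rabs_pos K); lra. }
  exists (mkposreal _ Hdel). intros h Hh0 Hh. simpl in Hh.
  specialize (H h (Rlt_le_trans _ _ _ Hh (Rmin_l _ _))).
  assert (Hh2 := Rlt_le_trans _ _ _ Hh (Rmin_r _ _)).
  assert (Hp : 0 < Rabs h) by (apply Rabs_pos_lt; auto).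
  replace ((f (x + h) - f x) / h - l) with ((f (x + h) - f x - h * l) / h) by (field; auto).
  unfold Rdiv. rewrite Rabs_mult, Rabs_inv.
  apply Rmult_lt_reg_r with (Rabs h); auto. rewrite Rmult_assoc, Rinv_l, Rmult_1_r by lra.
  eapply Rle_lt_trans; [exact H|]. rewrite <- (pow2_abs h).
  pose proof (Rle_abs K). pose proof (Rabs_pos K).
  assert (Rabs h * (Rabs K + 1) < eps).
  { apply Rmult_lt_reg_r with (/ (Rabs K + 1)); [apply Rinv_0_lt_compat; lra|].
    rewrite Rmult_assoc, Rinv_r, Rmult_1_r by lra. exact Hh2. }
  nra.
Qed.

(** Testing against a multiplier [u] and taking real parts brings the real mean value theorem into
    play; [Cmod_le_of_Re] later recovers the modulus. *)
Lemma cderiv_line f a d s l u : cderiv f (a + RtoC s * d)%C l ->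
  is_derive (fun t : R => Re (u * f (a + RtoC t * d))%C) s (Re (u * (d * l))%C).
Proof.
  intros H. apply cderiv_pos in H. destruct H as [K [e [HK [He H]]]].
  pose proof (Cmod_ge_0 d) as Hd0. pose proof (Cmod_ge_0 u) as Hu0.
  apply (is_derive_quad _ _ _ (Cmod u * (K * Cmod d ^ 2)) (e / (1 + Cmod d))); [apply Rdiv_lt_0_compat; lra|].
  intros h Hh.
  assert (Hhd : Cmod (RtoC h * d)%C < e).
  { rewrite Cmod_mult, Cmod_R. apply Rmult_lt_compat_r with (r := 1 + Cmod d) in Hh; [|lra].
    replace (e / (1 + Cmod d) * (1 + Cmod d)) with e in Hh by (field; lra). pose proof (Rabs_pos h). nra. }
  specialize (H _ Hhd).
  replace (Re (u * f (a + RtoC (s + h) * d))%C - Re (u * f (a + RtoC s * d))%C - h * Re (u * (d * l))%C)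
    with (Re (u * (f (a + s * d + RtoC h * d) - f (a + s * d) - RtoC h * d * l))%C).
  - eapply Rle_trans; [apply re_le_Cmod|]. rewrite Cmod_mult, Rmult_assoc.
    apply Rmult_le_compat_l; auto. eapply Rle_trans; [exact H|].
    rewrite Cmod_mult, Cmod_R, Rpow_mult_distr, pow2_abs. right; ring.
  - replace (a + RtoC (s + h) * d)%C with (a + RtoC s * d + RtoC h * d)%C by (rewrite RtoC_plus; ring).
    unfold Re; simpl. ring.
Qed.

(** The remainders of the terms are quadratic in [h] with weights [wgt p] of total at most 100, so
    the remainder of the sum is quadratic again. *)
Lemma cderiv_sum (f : C -> C) (F : C -> Z * Z -> C) F' z l K d : 0 < d ->
  (forall h, Cmod h < d -> is_sum (F (z + h)%C) (f (z + h)%C)) -> is_sum F' l ->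
  (forall h p, Cmod h < d -> Cmod (F (z + h)%C p - F z p - h * F' p)%C <= K * Cmod h ^ 2 * wgt p) -> cderiv f z l.
Proof.
  intros Hd HF HF' HB. exists (100 * K), d. split; auto. intros h Hh.
  assert (HFz : is_sum (F z) (f z)).
  { replace z with (z + 0)%C by ring. apply HF. rewrite Cmod_0. auto. }
  pose proof (is_sum_minus _ _ _ _ (is_sum_minus _ _ _ _ (HF h Hh) HFz) (is_sum_scal h _ _ HF')) as Hs.
  pose proof (is_sum_bound _ (K * Cmod h ^ 2) _ (fun p => HB h p Hh) Hs). lra.
Qed.

Lemma inv_near (x h : C) : x <> 0%C -> Cmod h * Cmod (/ x)%C <= / 2 ->
  (x + h)%C <> 0%C /\ Cmod (/ (x + h))%C <= 2 * Cmod (/ x)%C.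
Proof.
  intros Hx H. assert (Hp : 0 < Cmod x) by (apply Cmod_gt_0; auto). rewrite Cmod_inv in H by auto.
  assert (Hh : Cmod h <= Cmod x / 2).
  { apply Rmult_le_reg_r with (/ Cmod x); [apply Rinv_0_lt_compat; auto|].
    replace (Cmod x / 2 * / Cmod x) with (/ 2) by (field; lra). auto. }
  assert (Hl : Cmod x / 2 <= Cmod (x + h)%C).
  { assert (Cmod x <= Cmod (x + h)%C + Cmod h); [|lra].
    replace x with ((x + h) + - h)%C at 1 by ring. eapply Rle_trans; [apply Cmod_triangle|].
    rewrite Cmod_opp. lra. }
  split.
  - apply Cmod_gt_0. lra.
  - rewrite !Cmod_inv'. replace (2 * / Cmod x) with (/ (Cmod x / 2)) by (field; lra).
    apply Rinv_le_contravar; lra.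
Qed.

Lemma Cmod_triangle3 a b c : Cmod (a + b + c)%C <= Cmod a + Cmod b + Cmod c.
Proof. eapply Rle_trans; [apply Cmod_triangle|]. pose proof (Cmod_triangle a b). lra. Qed.
Lemma Cmod_nat (r : R) (z : C) : 0 <= r -> Cmod (RtoC r * z)%C = r * Cmod z.
Proof. intros H. rewrite Cmod_mult, Cmod_R, Rabs_right; lra. Qed.

(** By [y' = y - h y y'] the remainder is [h ^ 2 y ^ 2 y' X] with [X] homogeneous of degree [k - 1].
    Since [|y'| <= 2 |y|], the worst case [k = 4] gives [4 + 3 * 2 + 2 * 4 + 8 = 26], and the
    remaining factor [y'] doubles this to 52. *)
Lemma inv_pow_taylor (k : nat) (x h : C) : (2 <= k <= 4)%nat -> x <> 0%C -> Cmod h * Cmod (/ x)%C <= / 2 ->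
  Cmod ((/ (x + h)) ^ k - (/ x) ^ k - h * (- RtoC (INR k) * (/ x) ^ S k))%C
    <= 52 * Cmod (/ x)%C ^ (S (S k)) * Cmod h ^ 2.
Proof.
  intros Hk Hx Hh. destruct (inv_near x h Hx Hh) as [Hxh Hy].
  set (y := (/ x)%C) in *. set (y' := (/ (x + h))%C) in *.
  assert (E : y' = (y - h * y * y')%C) by (unfold y, y'; field; auto).
  pose proof (Cmod_ge_0 y) as H0. pose proof (Cmod_ge_0 y') as H0'. pose proof (Cmod_ge_0 h) as Hh0.
  assert (Q : forall X, (y' ^ k - y ^ k - h * (- RtoC (INR k) * y ^ S k))%C = (h ^ 2 * (y ^ 2 * y' * X))%C ->
     Cmod X <= 26 * Cmod y ^ (k - 1) ->
     Cmod (y' ^ k - y ^ k - h * (- RtoC (INR k) * y ^ S k))%C <= 52 * Cmod y ^ (S (S k)) * Cmod h ^ 2).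
  { intros X -> HX. rewrite !Cmod_mult, !Cmod_pow.
    replace (S (S k)) with (3 + (k - 1))%nat by lia. rewrite pow_add.
    assert (0 <= Cmod y ^ 2) by (apply pow_le; auto). assert (0 <= Cmod h ^ 2) by (apply pow_le; auto).
    pose proof (Cmod_ge_0 X).
    assert (Cmod y ^ 2 * Cmod y' * Cmod X <= Cmod y ^ 2 * (2 * Cmod y) * (26 * Cmod y ^ (k - 1))).
    { apply Rmult_le_compat; auto; [apply Rmult_le_pos; auto|]. apply Rmult_le_compat_l; auto. }
    replace (52 * (Cmod y ^ 3 * Cmod y ^ (k - 1)) * Cmod h ^ 2) with
      (Cmod h ^ 2 * (Cmod y ^ 2 * (2 * Cmod y) * (26 * Cmod y ^ (k - 1)))) by ring.
    apply Rmult_le_compat_l; auto. }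
  assert (D1 : (y - y')%C = (h * y * y')%C) by (rewrite E at 1; ring).
  assert (D2 : (y' - y)%C = (- (h * y * y'))%C) by (rewrite E at 1; ring).
  assert (Hy2 : Cmod y' ^ 2 <= 4 * Cmod y ^ 2) by nra.
  assert (Hy3 : Cmod y' ^ 3 <= 8 * Cmod y ^ 3).
  { replace (8 * Cmod y ^ 3) with ((2 * Cmod y) ^ 3) by ring. apply pow_incr; auto. }
  destruct k as [|[|[|[|[|k]]]]]; try lia.
  - apply (Q (2 * y + y')%C).
    + transitivity (h * y * ((y - y') * (2 * y + y')) + (y' - y + h * y * y') * (y + y'))%C.
      { simpl INR. replace (1 + 1) with 2 by ring. simpl. ring. }
      rewrite D1, D2. simpl. ring.
    + simpl pow. eapply Rle_trans; [apply Cmod_triangle|]. rewrite Cmod_nat by lra. lra.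
  - apply (Q (3 * y ^ 2 + 2 * (y * y') + y' ^ 2)%C).
    + transitivity (h * y * ((y - y') * (3 * y ^ 2 + 2 * (y * y') + y' ^ 2))
        + (y' - y + h * y * y') * (y ^ 2 + y * y' + y' ^ 2))%C.
      { simpl INR. replace (1 + 1 + 1) with 3 by ring. simpl. ring. }
      rewrite D1, D2. simpl. ring.
    + simpl (3 - 1)%nat. eapply Rle_trans; [apply Cmod_triangle3|]. rewrite !Cmod_nat by lra.
      rewrite Cmod_mult, !Cmod_pow. nra.
  - apply (Q (4 * y ^ 3 + 3 * (y ^ 2 * y') + 2 * (y * y' ^ 2) + y' ^ 3)%C).
    + transitivity (h * y * ((y - y') * (4 * y ^ 3 + 3 * (y ^ 2 * y') + 2 * (y * y' ^ 2) + y' ^ 3))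
        + (y' - y + h * y * y') * (y ^ 3 + y ^ 2 * y' + y * y' ^ 2 + y' ^ 3))%C.
      { simpl INR. replace (1 + 1 + 1 + 1) with 4 by ring. simpl. ring. }
      rewrite D1, D2. simpl. ring.
    + simpl (4 - 1)%nat. eapply Rle_trans; [apply Cmod_triangle|].
      eapply Rle_trans; [apply Rplus_le_compat_r, Cmod_triangle3|]. rewrite !Cmod_nat by lra.
      rewrite !Cmod_mult, !Cmod_pow.
      assert (0 <= Cmod y ^ 2) by (apply pow_le; auto).
      assert (Cmod y ^ 2 * Cmod y' <= Cmod y ^ 2 * (2 * Cmod y)) by (apply Rmult_le_compat_l; auto).
      assert (Cmod y * Cmod y' ^ 2 <= Cmod y * (4 * Cmod y ^ 2)) by (apply Rmult_le_compat_l; auto).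
      lra.
Qed.

(** The constants [c p] make the series for [wp], where [k = 2], converge, and they drop out of the
    derivative; for [E_fun] they are 0. The radius [/ (2 * K)] keeps [h] below half the distance
    from [z] to every lattice point. *)
Lemma cderiv_family w1 w2 z k (c : Z * Z -> C) f : is_lattice_basis w1 w2 -> off_lat w1 w2 z -> (2 <= k <= 4)%nat ->
  (forall x, off_lat w1 w2 x -> is_sum (fun p => (/ (x - pt w1 w2 p)) ^ k - c p)%C (f x)) ->
  cderiv f z (- RtoC (INR k) * E_fun w1 w2 (S k) z)%C.
Proof.
  intros HL Hz Hk Hf. destruct (inv_low _ _ HL z) as [K [HK0 HK]].
  assert (Hd : 0 < / (2 * K)) by (apply Rinv_0_lt_compat; lra).
  assert (Hsm : forall h p, Cmod h < / (2 * K) -> Cmod h * Cmod (/ (z - pt w1 w2 p))%C <= / 2).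
  { intros h p Hh. pose proof (inv_lnorm_range p). specialize (HK p). pose proof (Cmod_ge_0 h).
    apply Rle_trans with (/ (2 * K) * K); [|right; field; lra].
    apply Rmult_le_compat; try apply Cmod_ge_0; try lra. nra. }
  apply (cderiv_sum f (fun x p => (/ (x - pt w1 w2 p)) ^ k - c p)%C
    (fun p => - RtoC (INR k) * E_term w1 w2 (S k) z p)%C z _ (52 * K ^ S (S k)) (/ (2 * K))); auto.
  - intros h Hh. apply Hf. intros p E.
    destruct (inv_near (z - pt w1 w2 p)%C h) as [H _]; auto; [apply off_lat_sub; auto|].
    apply H. rewrite <- E. ring.
  - apply is_sum_scal, E_fun_sum; auto. lia.
  - intros h p Hh. pose proof (inv_pow_taylor k (z - pt w1 w2 p)%C h Hk (off_lat_sub _ _ _ _ Hz) (Hsm h p Hh)) as HT.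
    unfold E_term. set (y := (/ (z - pt w1 w2 p))%C) in *.
    replace (z + h - pt w1 w2 p)%C with (z - pt w1 w2 p + h)%C by ring.
    match goal with |- Cmod ?e <= _ => replace e with
      ((/ (z - pt w1 w2 p + h)) ^ k - y ^ k - h * (- RtoC (INR k) * y ^ S k))%C by ring end.
    eapply Rle_trans; [exact HT|].
    assert (Hy : Cmod y ^ S (S k) <= K ^ S (S k) * wgt p).
    { pose proof (inv_lnorm_range p).
      apply Rle_trans with ((K * / lnorm p) ^ S (S k)); [apply pow_incr; split; [apply Cmod_ge_0|apply HK]|].
      rewrite Rpow_mult_distr. apply Rmult_le_compat_l; [apply pow_le; lra|].
      eapply Rle_trans; [apply pow_le_3; [lra|lia]|apply inv_lnorm3_wgt]. }
    assert (0 <= Cmod h ^ 2) by (apply pow_le, Cmod_ge_0).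
    replace (52 * K ^ S (S k) * Cmod h ^ 2 * wgt p) with (52 * (K ^ S (S k) * wgt p) * Cmod h ^ 2) by ring.
    apply Rmult_le_compat_r; auto. lra.
Qed.

Lemma cderiv_wp_fun w1 w2 z : is_lattice_basis w1 w2 -> off_lat w1 w2 z -> cderiv (wp_fun w1 w2) z (- (2) * E_fun w1 w2 3 z)%C.
Proof.
  intros HL Hz. eapply cderiv_val; [|apply (cderiv_family w1 w2 z 2 (fun p => (/ pt w1 w2 p) ^ 2)%C); auto].
  - simpl INR. replace (1 + 1) with 2 by ring. reflexivity.
  - intros x Hx. apply wp_fun_sum; auto.
Qed.
Lemma cderiv_E_fun w1 w2 k z : is_lattice_basis w1 w2 -> off_lat w1 w2 z -> (3 <= k <= 4)%nat ->
  cderiv (E_fun w1 w2 k) z (- RtoC (INR k) * E_fun w1 w2 (S k) z)%C.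
Proof.
  intros HL Hz Hk. apply (cderiv_family w1 w2 z k (fun _ => 0%C)); auto; [lia|].
  intros x Hx. eapply is_sum_ext; [|apply (E_fun_sum w1 w2 k x HL)]; [|lia]. intros p. unfold E_term. ring.
Qed.

(** * Laurent expansions at the origin *)

Lemma G_sum_odd w1 w2 k : is_lattice_basis w1 w2 -> (3 <= k)%nat -> Nat.odd k = true -> G_sum w1 w2 k = 0%C.
Proof.
  intros HL Hk Ho. apply (is_sum_odd _ _ (G_sum_sum w1 w2 k HL Hk)). intros p. rewrite pt_opp, Cinv_opp.
  apply Nat.odd_spec in Ho. destruct Ho as [m ->]. rewrite Nat.add_1_r, !Cpow_S, !Cpow_mult_r.
  replace ((- / pt w1 w2 p) ^ 2)%C with ((/ pt w1 w2 p) ^ 2)%C by ring. ring.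
Qed.

Definition bounded_near0 (f : C -> C) : Prop := exists K d, 0 < d /\ forall z : C, z <> 0%C -> Cmod z < d -> Cmod (f z) <= K.
Lemma bounded_near0_plus f g : bounded_near0 f -> bounded_near0 g -> bounded_near0 (fun z => f z + g z)%C.
Proof.
  intros [K [d [Hd H]]] [L [e [He G]]]. exists (K + L), (Rmin d e). split; [apply Rmin_glb_lt; auto|].
  intros z Hz Hz'. specialize (H z Hz (Rlt_le_trans _ _ _ Hz' (Rmin_l _ _))).
  specialize (G z Hz (Rlt_le_trans _ _ _ Hz' (Rmin_r _ _))). eapply Rle_trans; [apply Cmod_triangle|]. lra.
Qed.
Lemma bounded_near0_mult f g : bounded_near0 f -> bounded_near0 g -> bounded_near0 (fun z => f z * g z)%C.
Proof.
  intros [K [d [Hd H]]] [L [e [He G]]]. exists (K * L), (Rmin d e). split; [apply Rmin_glb_lt; auto|].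
  intros z Hz Hz'. specialize (H z Hz (Rlt_le_trans _ _ _ Hz' (Rmin_l _ _))).
  specialize (G z Hz (Rlt_le_trans _ _ _ Hz' (Rmin_r _ _))). rewrite Cmod_mult.
  apply Rmult_le_compat; auto; apply Cmod_ge_0.
Qed.
Lemma bounded_near0_const c : bounded_near0 (fun _ => c).
Proof. exists (Cmod c), 1. split; [lra|]. intros; lra. Qed.
Lemma bounded_near0_id : bounded_near0 (fun z => z).
Proof. exists 1, 1. split; [lra|]. intros; lra. Qed.
Lemma bounded_near0_pow f n : bounded_near0 f -> bounded_near0 (fun z => f z ^ n)%C.
Proof. intros H; induction n; [apply (bounded_near0_const (RtoC 1))|]. apply (bounded_near0_mult f (fun z => f z ^ n)%C); auto. Qed.
Lemma bounded_near0_opp f : bounded_near0 f -> bounded_near0 (fun z => - f z)%C.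
Proof. intros [K [d [Hd H]]]. exists K, d. split; auto. intros. rewrite Cmod_opp. auto. Qed.
Lemma bounded_near0_minus f g : bounded_near0 f -> bounded_near0 g -> bounded_near0 (fun z => f z - g z)%C.
Proof. intros. apply (bounded_near0_plus f (fun z => - g z)%C); auto. apply bounded_near0_opp; auto. Qed.

Ltac bounded_near0_tac := repeat first [assumption | apply bounded_near0_const | apply bounded_near0_id
  | apply (bounded_near0_minus (fun z => _) (fun z => _)) | apply (bounded_near0_plus (fun z => _) (fun z => _))
  | apply (bounded_near0_opp (fun z => _)) | apply (bounded_near0_mult (fun z => _) (fun z => _)) | apply (bounded_near0_pow (fun z => _))].

(** The expansion is removed through [z ^ 4]: two lattices with equal [G_sum] at 4 and 6 then have
    functions [wp_fun] differing by [O(z ^ 5)], one order above the critical exponent 4 at a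
    pole. *)
Definition wp_rem w1 w2 z := ((wp_fun w1 w2 z - (/ z) ^ 2 - 3 * z ^ 2 * G_sum w1 w2 4 - 5 * z ^ 4 * G_sum w1 w2 6) / z ^ 5)%C.
Definition E3_rem w1 w2 z := ((E_fun w1 w2 3 z - (/ z) ^ 3 + 3 * z * G_sum w1 w2 4 + 10 * z ^ 3 * G_sum w1 w2 6) / z ^ 4)%C.
Definition E4_rem w1 w2 z := ((E_fun w1 w2 4 z - (/ z) ^ 4 - G_sum w1 w2 4) / z)%C.

(** Within half the distance from 0 to the other lattice points, [z - w] is comparable with [w]
    uniformly in the index. *)
Lemma near0 w1 w2 : is_lattice_basis w1 w2 -> exists L, 0 < L /\ forall z : C, z <> 0%C -> Cmod z < / (2 * L) ->
  off_lat w1 w2 z /\ forall p, pt w1 w2 p <> 0%C ->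
    Cmod (/ pt w1 w2 p)%C <= L * / lnorm p /\ Cmod z * Cmod (/ pt w1 w2 p)%C <= / 2 /\
    (z - pt w1 w2 p)%C <> 0%C /\ Cmod (/ (z - pt w1 w2 p))%C <= 2 * Cmod (/ pt w1 w2 p)%C.
Proof.
  intros HL. destruct (pt_low _ _ HL) as [L [HL0 HLp]]. exists L. split; auto. intros z Hz Hs.
  assert (A : forall p, pt w1 w2 p <> 0%C ->
    Cmod (/ pt w1 w2 p)%C <= L * / lnorm p /\ Cmod z * Cmod (/ pt w1 w2 p)%C <= / 2 /\
    (z - pt w1 w2 p)%C <> 0%C /\ Cmod (/ (z - pt w1 w2 p))%C <= 2 * Cmod (/ pt w1 w2 p)%C).
  { intros p Hp. split; [apply HLp|].
    assert (Hq : Cmod z * Cmod (/ pt w1 w2 p)%C <= / 2).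
    { specialize (HLp p). pose proof (inv_lnorm_range p). pose proof (Cmod_ge_0 z).
      apply Rle_trans with (/ (2 * L) * L); [|right; field; lra].
      apply Rmult_le_compat; try apply Cmod_ge_0; try lra. nra. }
    split; auto.
    assert (Hn : (- pt w1 w2 p)%C <> 0%C).
    { intros E. apply Hp. replace (pt w1 w2 p) with (- - pt w1 w2 p)%C by ring. rewrite E. ring. }
    destruct (inv_near (- pt w1 w2 p)%C z Hn) as [B1 B2].
    - rewrite Cinv_opp, Cmod_opp. auto.
    - rewrite Cinv_opp, Cmod_opp in B2. replace (- pt w1 w2 p + z)%C with (z - pt w1 w2 p)%C in * by ring. auto. }
  split; auto. intros p E. destruct (Ceq_dec (pt w1 w2 p) 0%C) as [F|F]; [congruence|].
  destruct (A p F) as [_ [_ [B _]]]. apply B. rewrite E. ring.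
Qed.

(** [R0 z p] stands for the Taylor remainder of the term of index [p], with the pole removed at the
    zero index. The exponent [m] is left free because the remainders in use decay with powers 5 or
    7, and [(1 + L) ^ 7] bounds every [L ^ m]. *)
Lemma laurent_bounded_near0 w1 w2 (f : C -> C) (R0 : C -> Z * Z -> C) (n : nat) K : is_lattice_basis w1 w2 ->
  (forall z, off_lat w1 w2 z -> is_sum (R0 z) (f z)) ->
  (forall (z : C) p, z <> 0%C -> pt w1 w2 p = 0%C -> R0 z p = 0%C) ->
  (forall (z : C) p, z <> 0%C -> pt w1 w2 p <> 0%C -> Cmod z * Cmod (/ pt w1 w2 p)%C <= / 2 ->
     (z - pt w1 w2 p)%C <> 0%C -> Cmod (/ (z - pt w1 w2 p))%C <= 2 * Cmod (/ pt w1 w2 p)%C ->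
     exists m, (3 <= m <= 7)%nat /\ Cmod (R0 z p) <= K * Cmod z ^ n * Cmod (/ pt w1 w2 p)%C ^ m) ->
  0 <= K -> bounded_near0 (fun z => f z / z ^ n)%C.
Proof.
  intros HL Hs H0 HB HK. destruct (near0 w1 w2 HL) as [L [HL0 HN]].
  exists (100 * (K * (1 + L) ^ 7)), (/ (2 * L)). split; [apply Rinv_0_lt_compat; lra|].
  intros z Hz Hd. destruct (HN z Hz Hd) as [Hnl Hp].
  assert (Hzp : 0 < Cmod z) by (apply Cmod_gt_0; auto).
  assert (Hzn : 0 < Cmod z ^ n) by (apply pow_lt; auto).
  rewrite Cmod_div by (apply Cpow_nz; auto). rewrite Cmod_pow.
  apply Rmult_le_reg_r with (Cmod z ^ n); auto.
  replace (Cmod (f z) / Cmod z ^ n * Cmod z ^ n) with (Cmod (f z)) by (field; lra).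
  rewrite Rmult_assoc. apply is_sum_bound with (f := R0 z); [|apply Hs; auto].
  intros p. pose proof (wgt_pos p) as HW.
  assert (HP7 : 0 <= (1 + L) ^ 7) by (apply pow_le; lra).
  destruct (Ceq_dec (pt w1 w2 p) 0%C) as [E|E].
  - rewrite H0, Cmod_0 by auto. apply Rmult_le_pos; [|lra]. apply Rmult_le_pos; [|lra]. apply Rmult_le_pos; lra.
  - destruct (Hp p E) as [B1 [B2 [B3 B4]]]. destruct (HB z p Hz E B2 B3 B4) as [m [Hm HR]].
    eapply Rle_trans; [exact HR|]. pose proof (inv_lnorm_range p) as Hw.
    assert (Cmod (/ pt w1 w2 p)%C ^ m <= (1 + L) ^ 7 * wgt p).
    { apply Rle_trans with ((L * / lnorm p) ^ m); [apply pow_incr; split; [apply Cmod_ge_0|auto]|].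
      rewrite Rpow_mult_distr. apply Rmult_le_compat; try (apply pow_le; lra).
      - apply Rle_trans with ((1 + L) ^ m); [apply pow_incr; lra|]. apply Rle_pow; [lra|lia].
      - eapply Rle_trans; [apply pow_le_3; [lra|lia]|apply inv_lnorm3_wgt]. }
    replace (K * (1 + L) ^ 7 * Cmod z ^ n * wgt p) with (K * Cmod z ^ n * ((1 + L) ^ 7 * wgt p)) by ring.
    apply Rmult_le_compat_l; auto. apply Rmult_le_pos; lra.
Qed.

Lemma is_sum_pole w1 w2 (c : C) : is_lattice_basis w1 w2 ->
  is_sum (fun p => if Ceq_dec (pt w1 w2 p) 0%C then c else RtoC 0) c.
Proof.
  intros HL. eapply is_sum_ext; [|apply (is_sum_delta c)]. intros p. cbn beta.
  destruct (Ceq_dec (pt w1 w2 p) 0%C) as [E|E].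
  - apply (pt_eq0 w1 w2 p HL) in E. subst. reflexivity.
  - destruct (Z.eqb_spec (fst p) 0) as [Ea|Ea]; destruct (Z.eqb_spec (snd p) 0) as [Eb|Eb]; auto.
    exfalso. apply E. destruct p. simpl in *. subst. apply pt_0.
Qed.

Lemma bounded_near0_wp_rem w1 w2 : is_lattice_basis w1 w2 -> bounded_near0 (wp_rem w1 w2).
Proof.
  intros HL. unfold wp_rem.
  apply (laurent_bounded_near0 w1 w2 _ (fun z p => wp_term w1 w2 z p - (if Ceq_dec (pt w1 w2 p) 0%C then (/ z) ^ 2 else RtoC 0)
    - 2 * z * (/ pt w1 w2 p) ^ 3 - 3 * z ^ 2 * (/ pt w1 w2 p) ^ 4 - 4 * z ^ 3 * (/ pt w1 w2 p) ^ 5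
    - 5 * z ^ 4 * (/ pt w1 w2 p) ^ 6)%C 5 34 HL); [| | |lra].
  - intros z Hz. pose proof (is_sum_minus _ _ _ _ (wp_fun_sum w1 w2 z HL Hz) (is_sum_pole w1 w2 ((/ z) ^ 2)%C HL)) as H.
    pose proof (is_sum_scal (2 * z)%C _ _ (G_sum_sum w1 w2 3 HL ltac:(lia))) as H3. rewrite G_sum_odd in H3 by auto.
    pose proof (is_sum_scal (3 * z ^ 2)%C _ _ (G_sum_sum w1 w2 4 HL ltac:(lia))) as H4.
    pose proof (is_sum_scal (4 * z ^ 3)%C _ _ (G_sum_sum w1 w2 5 HL ltac:(lia))) as H5. rewrite G_sum_odd in H5 by (auto; lia).
    pose proof (is_sum_scal (5 * z ^ 4)%C _ _ (G_sum_sum w1 w2 6 HL ltac:(lia))) as H6.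
    pose proof (is_sum_minus _ _ _ _ (is_sum_minus _ _ _ _ (is_sum_minus _ _ _ _ (is_sum_minus _ _ _ _ H H3) H4) H5) H6) as HH.
    match type of HH with is_sum _ ?s => match goal with |- is_sum _ ?t => replace t with s by ring end end. exact HH.
  - intros z p Hz E. destruct Ceq_dec as [_|F]; [|contradiction]. unfold wp_term, E_term. rewrite E, Cinv_0.
    replace (z - 0)%C with z by ring. ring.
  - intros z p Hz E Hq Hx Hy. exists 7%nat. split; [lia|]. destruct Ceq_dec as [F|_]; [contradiction|].
    unfold wp_term, E_term. set (w := pt w1 w2 p) in *.
    assert (Hw : Cmod (/ w)%C * Cmod w = 1) by (rewrite <- Cmod_mult, Cinv_l by auto; apply Cmod_1).
    (* Closed form of the remainder of [(z - w) ^ (-2)] after five terms. With [|z / w| <= 1/2] its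
       last factor is at most [(6 + 5/2) |w|], and [34 = 4 * 17/2]. *)
    match goal with |- Cmod ?e <= _ => replace e with
      (z ^ 5 * ((/ (z - w)) ^ 2 * (/ w) ^ 6 * (6 * w - 5 * z)))%C by (field; auto) end.
    rewrite !Cmod_mult, !Cmod_pow.
    assert (H6 : Cmod (6 * w - 5 * z)%C <= 6 * Cmod w + 5 * Cmod z).
    { unfold Cminus. eapply Rle_trans; [apply Cmod_triangle|]. rewrite Cmod_opp, !Cmod_nat; lra. }
    set (u := Cmod (/ w)%C) in *. set (y := Cmod (/ (z - w))%C) in *.
    assert (Hu : 0 <= u) by apply Cmod_ge_0. assert (Hy0 : 0 <= y) by apply Cmod_ge_0.
    replace (34 * Cmod z ^ 5 * u ^ 7) with (Cmod z ^ 5 * (34 * u ^ 7)) by ring.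
    apply Rmult_le_compat_l; [apply pow_le, Cmod_ge_0|].
    assert (Hu6 : 0 <= u ^ 6) by (apply pow_le; auto).
    apply Rle_trans with ((2 * u) ^ 2 * u ^ 6 * (6 * Cmod w + 5 * Cmod z)).
    + apply Rmult_le_compat; auto; [apply Rmult_le_pos; auto; apply pow_le; auto|apply Cmod_ge_0|].
      apply Rmult_le_compat_r; auto. apply pow_incr; auto.
    + replace ((2 * u) ^ 2 * u ^ 6 * (6 * Cmod w + 5 * Cmod z)) with
        (4 * u ^ 7 * (6 * (u * Cmod w) + 5 * (Cmod z * u))) by ring.
      rewrite Hw. assert (0 <= u ^ 7) by (apply pow_le; auto).
      replace (34 * u ^ 7) with (4 * u ^ 7 * (17/2)) by field. apply Rmult_le_compat_l; lra.
Qed.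

Lemma bounded_near0_E3_rem w1 w2 : is_lattice_basis w1 w2 -> bounded_near0 (E3_rem w1 w2).
Proof.
  intros HL. unfold E3_rem.
  apply (laurent_bounded_near0 w1 w2 _ (fun z p => E_term w1 w2 3 z p - (if Ceq_dec (pt w1 w2 p) 0%C then (/ z) ^ 3 else RtoC 0)
    - (- (1)) * (/ pt w1 w2 p) ^ 3 - (- (3) * z) * (/ pt w1 w2 p) ^ 4 - (- (6) * z ^ 2) * (/ pt w1 w2 p) ^ 5
    - (- (10) * z ^ 3) * (/ pt w1 w2 p) ^ 6)%C 4 (8 * 30) HL); [| | |lra].
  - intros z Hz. pose proof (is_sum_minus _ _ _ _ (E_fun_sum w1 w2 3 z HL ltac:(lia)) (is_sum_pole w1 w2 ((/ z) ^ 3)%C HL)) as H.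
    pose proof (is_sum_scal (- (1))%C _ _ (G_sum_sum w1 w2 3 HL ltac:(lia))) as H3. rewrite G_sum_odd in H3 by auto.
    pose proof (is_sum_scal (- (3) * z)%C _ _ (G_sum_sum w1 w2 4 HL ltac:(lia))) as H4.
    pose proof (is_sum_scal (- (6) * z ^ 2)%C _ _ (G_sum_sum w1 w2 5 HL ltac:(lia))) as H5. rewrite G_sum_odd in H5 by (auto; lia).
    pose proof (is_sum_scal (- (10) * z ^ 3)%C _ _ (G_sum_sum w1 w2 6 HL ltac:(lia))) as H6.
    pose proof (is_sum_minus _ _ _ _ (is_sum_minus _ _ _ _ (is_sum_minus _ _ _ _ (is_sum_minus _ _ _ _ H H3) H4) H5) H6) as HH.
    match type of HH with is_sum _ ?s => match goal with |- is_sum _ ?t => replace t with s by ring end end. exact HH.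
  - intros z p Hz E. destruct Ceq_dec as [_|F]; [|contradiction]. unfold E_term. rewrite E, Cinv_0.
    replace (z - 0)%C with z by ring. ring.
  - intros z p Hz E Hq Hx Hy. exists 7%nat. split; [lia|]. destruct Ceq_dec as [F|_]; [contradiction|].
    unfold E_term. set (w := pt w1 w2 p) in *.
    match goal with |- Cmod ?e <= _ => replace e with
      (z ^ 4 * ((/ (z - w)) ^ 3 * (/ w) ^ 4 * (15 - 24 * (z * / w) + 10 * (z * / w) ^ 2)))%C by (field; auto) end.
    rewrite !Cmod_mult, !Cmod_pow.
    (* Indeed [15 + 24/2 + 10/4 < 30]; the other factor 8 of the constant is [2 ^ 3], from the bound
       on [/ (z - w)]. *)
    assert (H6 : Cmod (15 - 24 * (z * / w) + 10 * (z * / w) ^ 2)%C <= 30).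
    { unfold Cminus. eapply Rle_trans; [apply Cmod_triangle3|]. rewrite Cmod_opp, !Cmod_nat, Cmod_pow, Cmod_mult, Cmod_R, Rabs_right by lra.
      pose proof (Cmod_ge_0 z). pose proof (Cmod_ge_0 (/ w)%C). assert (0 <= Cmod z * Cmod (/ w)%C) by (apply Rmult_le_pos; auto). nra. }
    set (u := Cmod (/ w)%C) in *. set (y := Cmod (/ (z - w))%C) in *.
    assert (Hu : 0 <= u) by apply Cmod_ge_0. assert (Hy0 : 0 <= y) by apply Cmod_ge_0.
    replace (8 * 30 * Cmod z ^ 4 * u ^ 7) with (Cmod z ^ 4 * ((2 * u) ^ 3 * u ^ 4 * 30)) by ring.
    apply Rmult_le_compat_l; [apply pow_le, Cmod_ge_0|].
    assert (Hu6 : 0 <= u ^ 4) by (apply pow_le; auto).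
    apply Rmult_le_compat; auto; [apply Rmult_le_pos; auto; apply pow_le; auto|apply Cmod_ge_0|].
    apply Rmult_le_compat_r; auto. apply pow_incr; auto.
Qed.

Lemma bounded_near0_E4_rem w1 w2 : is_lattice_basis w1 w2 -> bounded_near0 (E4_rem w1 w2).
Proof.
  intros HL.
  assert (H : bounded_near0 (fun z => (E_fun w1 w2 4 z - (/ z) ^ 4 - G_sum w1 w2 4) / z ^ 1)%C).
  2:{ destruct H as [K [d [Hd H]]]. exists K, d. split; auto. intros z Hz Hz'. specialize (H z Hz Hz'). unfold E4_rem.
      replace z with (z ^ 1)%C at 3 by (simpl; ring). exact H. }
  apply (laurent_bounded_near0 w1 w2 _ (fun z p => E_term w1 w2 4 z p - (if Ceq_dec (pt w1 w2 p) 0%C then (/ z) ^ 4 else RtoC 0)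
    - (/ pt w1 w2 p) ^ 4)%C 1 (16 * 10) HL); [| | |lra].
  - intros z Hz. apply is_sum_minus; [apply is_sum_minus|]; [apply E_fun_sum; auto|apply is_sum_pole; auto|apply G_sum_sum; auto; lia].
  - intros z p Hz E. destruct Ceq_dec as [_|F]; [|contradiction]. unfold E_term. rewrite E, Cinv_0.
    replace (z - 0)%C with z by ring. ring.
  - intros z p Hz E Hq Hx Hy. exists 5%nat. split; [lia|]. destruct Ceq_dec as [F|_]; [contradiction|].
    unfold E_term. set (w := pt w1 w2 p) in *.
    match goal with |- Cmod ?e <= _ => replace e with
      (z ^ 1 * ((/ (z - w)) ^ 4 * (/ w) ^ 1 * (4 - 6 * (z * / w) + 4 * (z * / w) ^ 2 - (z * / w) ^ 3)))%C by (field; auto) end.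
    rewrite !Cmod_mult, !Cmod_pow.
    (* Here [4 + 6/2 + 4/4 + 1 < 10], and the factor 16 is [2 ^ 4]. *)
    assert (H6 : Cmod (4 - 6 * (z * / w) + 4 * (z * / w) ^ 2 - (z * / w) ^ 3)%C <= 10).
    { unfold Cminus. eapply Rle_trans; [apply Cmod_triangle|].
      eapply Rle_trans; [apply Rplus_le_compat_r, Cmod_triangle3|].
      rewrite !Cmod_opp, !Cmod_nat, !Cmod_pow, Cmod_mult, Cmod_R, Rabs_right by lra.
      pose proof (Cmod_ge_0 z). pose proof (Cmod_ge_0 (/ w)%C). assert (0 <= Cmod z * Cmod (/ w)%C) by (apply Rmult_le_pos; auto).
      set (q := Cmod z * Cmod (/ w)%C) in *. assert (q ^ 2 <= (/ 2) ^ 2) by (apply pow_incr; lra). assert (q ^ 3 <= 1 ^ 3) by (apply pow_incr; lra). lra. }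
    set (u := Cmod (/ w)%C) in *. set (y := Cmod (/ (z - w))%C) in *.
    assert (Hu : 0 <= u) by apply Cmod_ge_0. assert (Hy0 : 0 <= y) by apply Cmod_ge_0.
    replace (16 * 10 * Cmod z ^ 1 * u ^ 5) with (Cmod z ^ 1 * ((2 * u) ^ 4 * u ^ 1 * 10)) by ring.
    apply Rmult_le_compat_l; [apply pow_le, Cmod_ge_0|].
    assert (Hu6 : 0 <= u ^ 1) by (apply pow_le; auto).
    apply Rmult_le_compat; auto; [apply Rmult_le_pos; auto; apply pow_le; auto|apply Cmod_ge_0|].
    apply Rmult_le_compat_r; auto. apply pow_incr; auto.
Qed.

(** * Differential equations for the Weierstrass function *)

Lemma mean_value (f df : R -> R) (a b : R) : a < b ->
  (forall x, a <= x <= b -> is_derive f x (df x)) -> exists c, a <= c <= b /\ f b - f a = df c * (b - a).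
Proof.
  intros Hab H. destruct (MVT_gen f a b df) as [c [Hc E]].
  - rewrite Rmin_left, Rmax_right by lra. intros x Hx. apply H. lra.
  - rewrite Rmin_left, Rmax_right by lra. intros x Hx. apply derivable_continuous_pt.
    exists (df x). apply is_derive_Reals. apply H. lra.
  - rewrite Rmin_left, Rmax_right in Hc by lra. exists c. auto.
Qed.

(** The choice [u = Cconj x] turns the left side into [|x| ^ 2]. *)
Lemma Cmod_le_of_Re (x : C) B : (forall u, Re (u * x)%C <= Cmod u * B) -> Cmod x <= B.
Proof.
  intros H. pose proof (Cmod_ge_0 x) as H0. destruct (Req_dec (Cmod x) 0) as [Z|Z].
  - specialize (H 1%C). apply Cmod_eq_0 in Z. subst x. rewrite Cmod_1, Cmod_0 in *.
    replace (Re (1 * 0)%C) with 0 in H by (unfold Re; simpl; ring). lra.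
  - specialize (H (Cconj x)). rewrite Cmod_conj in H.
    replace (Re (Cconj x * x)%C) with (Cmod x ^ 2) in H by (rewrite Cmod2_alt; unfold Re, Im; simpl; ring).
    nra.
Qed.

(** Outside a large square no lattice point is nearer to [z] than the origin is, so a minimum over
    finitely many indices suffices. *)
Lemma nearest w1 w2 z : is_lattice_basis w1 w2 ->
  exists p, forall q, Cmod (z - pt w1 w2 p)%C <= Cmod (z - pt w1 w2 q)%C.
Proof.
  intros HL. destruct (basis_low _ _ HL) as [c [Hc Hlow]]. pose proof (Cmod_ge_0 z) as Hz.
  destruct (INR_unbounded (2 * Cmod z / c + 1)) as [N HN].
  assert (Hmin : forall l : list (Z * Z), l <> nil -> exists p, forall q, In q l ->
    Cmod (z - pt w1 w2 p)%C <= Cmod (z - pt w1 w2 q)%C).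
  { induction l as [|a l IH]; [congruence|]. intros _. destruct l as [|b l].
    - exists a. intros q [->|[]]. lra.
    - destruct IH as [p Hp]; [congruence|].
      destruct (Rle_or_lt (Cmod (z - pt w1 w2 a)%C) (Cmod (z - pt w1 w2 p)%C)) as [H|H].
      + exists a. intros q [->|Hq]; [lra|]. specialize (Hp q Hq). lra.
      + exists p. intros q [->|Hq]; [lra|]. auto. }
  assert (H0 : In (0,0)%Z (square N)) by (apply in_square; simpl; lia).
  destruct (Hmin (square N)) as [p Hp]; [intros E; rewrite E in H0; destruct H0|].
  exists p. intros q. destruct (Rle_or_lt (lnorm q) (INR N)) as [H|H]; [apply Hp, in_square_lnorm, H|].
  eapply Rle_trans; [apply (Hp _ H0)|]. rewrite pt_0. replace (z - 0)%C with z by ring.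
  specialize (Hlow q).
  assert (2 * Cmod z <= c * (lnorm q - 1)).
  { replace (2 * Cmod z) with (c * (2 * Cmod z / c)) by (field; lra). apply Rmult_le_compat_l; lra. }
  assert (Cmod (pt w1 w2 q) <= Cmod (z - pt w1 w2 q)%C + Cmod z); [|lra].
  replace (pt w1 w2 q) with (- (z - pt w1 w2 q) + z)%C at 1 by ring.
  eapply Rle_trans; [apply Cmod_triangle|]. rewrite Cmod_opp. lra.
Qed.

(** The segment from [z] to its nearest lattice point [a] meets no further lattice point, as such a
    point would be nearer. Along it, up to [a], [H] is constant, and near [a] it tends to [l] by
    periodicity, because [X] is bounded. *)
Lemma constant_off_lattice w1 w2 (H X : C -> C) (l : C) : is_lattice_basis w1 w2 ->
  (forall z, off_lat w1 w2 z -> cderiv H z 0%C) -> (forall z p, off_lat w1 w2 z -> H (z + pt w1 w2 p)%C = H z) ->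
  bounded_near0 X -> (forall z : C, z <> 0%C -> H z = (l + z * X z)%C) -> forall z, off_lat w1 w2 z -> H z = l.
Proof.
  intros HL Hd Hper [K [e [He HX]]] HlX z Hz.
  destruct (nearest w1 w2 z HL) as [p Hp]. set (a := pt w1 w2 p) in *. set (d := (z - a)%C) in *.
  assert (Hd0 : 0 < Cmod d) by (apply Cmod_gt_0, off_lat_sub; auto).
  assert (Hn : forall s, 0 < s <= 1 -> off_lat w1 w2 (a + RtoC s * d)%C).
  { intros s Hs q E. specialize (Hp q). rewrite <- E in Hp.
    replace (z - (a + RtoC s * d))%C with (RtoC (1 - s) * d)%C in Hp by (rewrite RtoC_minus; unfold d; ring).
    rewrite Cmod_nat in Hp by lra. nra. }
  assert (Hconst : forall u s, 0 < s < 1 -> Re (u * H z)%C = Re (u * H (a + RtoC s * d)%C)%C).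
  { intros u s Hs. destruct (mean_value (fun t => Re (u * H (a + RtoC t * d)%C)%C) (fun _ => 0) s 1) as [c [_ E]]; [lra| |].
    - intros x Hx. replace 0 with (Re (u * (d * 0))%C) by (unfold Re; simpl; ring).
      apply cderiv_line. apply Hd, Hn. lra.
    - cbv beta in E. replace (a + 1 * d)%C with z in E by (unfold d; ring). lra. }
  apply Cminus_eq0. apply Cmod_eq_0. apply Rle_antisym; [|apply Cmod_ge_0].
  apply Cmod_le_of_Re. intros u. rewrite Rmult_0_r. apply le_epsilon. intros eps Heps.
  pose proof (Rabs_pos K) as HK0. pose proof (Rle_abs K) as HK1. pose proof (Cmod_ge_0 u) as Hu0.
  set (B := Cmod u * Cmod d * Rabs K + 1). assert (HB : 0 < B).
  { unfold B. assert (0 <= Cmod u * Cmod d * Rabs K) by (repeat apply Rmult_le_pos; lra). lra. }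
  (* Small enough for the bound on [X] to apply at [s d] and for [s |u| |d| |K|] to stay below
     [eps]. *)
  set (s := Rmin (/ 2) (Rmin (eps / B) (e / (2 * Cmod d)))).
  assert (Hs : 0 < s).
  { unfold s. repeat apply Rmin_glb_lt; try lra; apply Rdiv_lt_0_compat; lra. }
  assert (Hs1 : s <= / 2) by apply Rmin_l.
  assert (Hs2 : s <= eps / B) by (eapply Rle_trans; [apply Rmin_r|apply Rmin_l]).
  assert (Hs3 : s <= e / (2 * Cmod d)) by (eapply Rle_trans; [apply Rmin_r|apply Rmin_r]).
  assert (Hsd : (RtoC s * d)%C <> 0%C).
  { apply Cmod_gt_0. rewrite Cmod_nat by lra. apply Rmult_lt_0_compat; auto. }
  assert (Hsd' : Cmod (RtoC s * d)%C < e).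
  { rewrite Cmod_nat by lra. apply Rle_lt_trans with (e / (2 * Cmod d) * Cmod d); [apply Rmult_le_compat_r; lra|].
    replace (e / (2 * Cmod d) * Cmod d) with (e / 2) by (field; lra). lra. }
  assert (E : Re (u * (H z - l))%C = Re (u * ((RtoC s * d) * X (RtoC s * d)%C))%C).
  { assert (E1 := Hconst u s ltac:(lra)).
    assert (E2 : H (a + RtoC s * d)%C = (l + RtoC s * d * X (RtoC s * d))%C).
    { rewrite <- HlX by auto. rewrite Cplus_comm. unfold a.
      assert (N : off_lat w1 w2 (RtoC s * d)%C).
      { replace (RtoC s * d)%C with (a + RtoC s * d - pt w1 w2 p)%C by (unfold a; ring). apply off_lat_shift_m, Hn. lra. }
      apply Hper; auto. }
    rewrite E2 in E1. revert E1. unfold Re; simpl. intros. lra. }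
  rewrite E. eapply Rle_trans; [apply Rle_abs|]. eapply Rle_trans; [apply re_le_Cmod|].
  rewrite !Cmod_mult, Cmod_R, Rabs_right by lra. specialize (HX _ Hsd Hsd').
  apply Rle_trans with (Cmod u * (s * Cmod d * Rabs K)).
  - apply Rmult_le_compat_l; auto. apply Rmult_le_compat_l; [apply Rmult_le_pos|]; lra.
  - apply Rle_trans with (s * B); [unfold B; lra|].
    apply Rle_trans with (eps / B * B); [apply Rmult_le_compat_r; lra|]. right. field. lra.
Qed.

Lemma wp_fun_laurent w1 w2 (z : C) : z <> 0%C ->
  wp_fun w1 w2 z = ((/ z) ^ 2 + 3 * z ^ 2 * G_sum w1 w2 4 + 5 * z ^ 4 * G_sum w1 w2 6 + z ^ 5 * wp_rem w1 w2 z)%C.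
Proof. intros Hz. unfold wp_rem. field. auto. Qed.
Lemma E3_fun_laurent w1 w2 (z : C) : z <> 0%C ->
  E_fun w1 w2 3 z = ((/ z) ^ 3 - 3 * z * G_sum w1 w2 4 - 10 * z ^ 3 * G_sum w1 w2 6 + z ^ 4 * E3_rem w1 w2 z)%C.
Proof. intros Hz. unfold E3_rem. field. auto. Qed.
Lemma E4_fun_laurent w1 w2 (z : C) : z <> 0%C ->
  E_fun w1 w2 4 z = ((/ z) ^ 4 + G_sum w1 w2 4 + z * E4_rem w1 w2 z)%C.
Proof. intros Hz. unfold E4_rem. field. auto. Qed.

(** By Eisenstein's identity the fourth power sum and [wp_fun ^ 2] have equal derivatives. The
    constant is read off at the origin, where the former contributes [G_sum w1 w2 4] and the latter
    6 times it. This is one sixth of [wp'' = 6 wp ^ 2 - g2 / 2]. *)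
Lemma E4_fun_ode w1 w2 z : is_lattice_basis w1 w2 -> off_lat w1 w2 z ->
  E_fun w1 w2 4 z = (wp_fun w1 w2 z ^ 2 - 5 * G_sum w1 w2 4)%C.
Proof.
  intros HL Hz. set (g4 := G_sum w1 w2 4). set (g6 := G_sum w1 w2 6).
  assert (B1 := bounded_near0_wp_rem w1 w2 HL). assert (B2 := bounded_near0_E4_rem w1 w2 HL).
  assert (E : (E_fun w1 w2 4 z + (- (1)) * (wp_fun w1 w2 z * wp_fun w1 w2 z))%C = (- (5) * g4)%C).
  2:{ replace (E_fun w1 w2 4 z) with ((E_fun w1 w2 4 z + - (1) * (wp_fun w1 w2 z * wp_fun w1 w2 z)) + wp_fun w1 w2 z ^ 2)%C by ring.
      rewrite E. ring. }
  apply (constant_off_lattice w1 w2 (fun z => E_fun w1 w2 4 z + (- (1)) * (wp_fun w1 w2 z * wp_fun w1 w2 z))%C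
    (fun z => E4_rem w1 w2 z - 10 * z * g6 - 2 * z ^ 2 * wp_rem w1 w2 z
      - z ^ 3 * (3 * g4 + 5 * z ^ 2 * g6 + z ^ 3 * wp_rem w1 w2 z) ^ 2)%C); auto.
  - intros x Hx. eapply cderiv_val; [|apply cderiv_plus; [apply (cderiv_E_fun w1 w2 4 x HL Hx); lia|
      apply cderiv_scal, cderiv_mult; apply (cderiv_wp_fun w1 w2 x HL Hx)]].
    rewrite eisenstein by auto. simpl INR. replace (1 + 1 + 1 + 1) with 4 by ring. ring.
  - intros x p Hx. rewrite E_fun_shift, wp_fun_shift by (auto; lia). auto.
  - bounded_near0_tac.
  - intros x Hx. rewrite E4_fun_laurent, wp_fun_laurent by auto. fold g4 g6. field. auto.
Qed.

(** A quarter of the first order equation, as [wp'] is -2 times the cubic power sum and the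
    invariants are 60 and 140 times [G_sum]. Its derivative is a multiple of [E4_fun_ode]. *)
Lemma E3_fun_ode w1 w2 z : is_lattice_basis w1 w2 -> off_lat w1 w2 z ->
  (E_fun w1 w2 3 z ^ 2 = wp_fun w1 w2 z ^ 3 - 15 * G_sum w1 w2 4 * wp_fun w1 w2 z - 35 * G_sum w1 w2 6)%C.
Proof.
  intros HL Hz. set (g4 := G_sum w1 w2 4). set (g6 := G_sum w1 w2 6).
  assert (B1 := bounded_near0_wp_rem w1 w2 HL). assert (B2 := bounded_near0_E3_rem w1 w2 HL).
  assert (E : (E_fun w1 w2 3 z * E_fun w1 w2 3 z + ((- (1)) * (wp_fun w1 w2 z * (wp_fun w1 w2 z * wp_fun w1 w2 z))
     + (15 * g4) * wp_fun w1 w2 z))%C = (- (35) * g6)%C).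
  2:{ replace (E_fun w1 w2 3 z ^ 2)%C with ((E_fun w1 w2 3 z * E_fun w1 w2 3 z + ((- (1)) * (wp_fun w1 w2 z * (wp_fun w1 w2 z * wp_fun w1 w2 z))
     + (15 * g4) * wp_fun w1 w2 z)) + wp_fun w1 w2 z ^ 3 - 15 * g4 * wp_fun w1 w2 z)%C by ring.
      rewrite E. ring. }
  apply (constant_off_lattice w1 w2 (fun z => E_fun w1 w2 3 z * E_fun w1 w2 3 z + ((- (1)) * (wp_fun w1 w2 z * (wp_fun w1 w2 z * wp_fun w1 w2 z))
     + (15 * g4) * wp_fun w1 w2 z))%C
    (fun z => 2 * E3_rem w1 w2 z - 3 * wp_rem w1 w2 z
      + z * ((- (3) * g4 - 10 * z ^ 2 * g6 + z ^ 3 * E3_rem w1 w2 z) ^ 2)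
      - 3 * z * (3 * g4 + 5 * z ^ 2 * g6 + z ^ 3 * wp_rem w1 w2 z) ^ 2
      - z ^ 5 * (3 * g4 + 5 * z ^ 2 * g6 + z ^ 3 * wp_rem w1 w2 z) ^ 3
      + 15 * g4 * z * (3 * g4 + 5 * z ^ 2 * g6 + z ^ 3 * wp_rem w1 w2 z))%C); auto.
  - intros x Hx. eapply cderiv_val; [|apply cderiv_plus; [apply cderiv_mult; apply (cderiv_E_fun w1 w2 3 x HL Hx); lia|
      apply cderiv_plus; [apply cderiv_scal, cderiv_mult; [|apply cderiv_mult]; apply (cderiv_wp_fun w1 w2 x HL Hx)|
        apply cderiv_scal, (cderiv_wp_fun w1 w2 x HL Hx)]]].
    rewrite E4_fun_ode by auto. fold g4. simpl INR. replace (1 + 1 + 1) with 3 by ring. ring.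
  - intros x p Hx. rewrite E_fun_shift, wp_fun_shift by (auto; lia). auto.
  - bounded_near0_tac.
  - intros x Hx. rewrite E3_fun_laurent, wp_fun_laurent by auto. fold g4 g6. field. auto.
Qed.

(** * A lattice is determined by its invariants *)

(** The point 0 may be a pole of the functions behind [f], so the initial condition enters as
    [|f s| <= K s]. The real part of [u f] minus the primitive of the bound is nonincreasing, and
    its value at the left end [s0] is at most [eps]. *)
Lemma integrate_bound (f f' : R -> C) d c K j : 0 <= c ->
  (forall u s, 0 < s < d -> is_derive (fun t => Re (u * f t)%C) s (Re (u * f' s)%C)) ->
  (forall s, 0 < s < d -> Cmod (f' s) <= c * s ^ j) ->
  (forall s, 0 < s < d -> Cmod (f s) <= K * s) ->
  forall s, 0 < s < d -> Cmod (f s) <= c / INR (S j) * s ^ S j.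
Proof.
  intros Hc Hder Hb H0 s Hs. apply Cmod_le_of_Re. intros u.
  pose proof (Cmod_ge_0 u) as Hu. pose proof (lt_0_INR (S j) ltac:(lia)) as Hj.
  pose proof (Rabs_pos K) as HK0. pose proof (Rle_abs K) as HK1.
  apply le_epsilon. intros eps He.
  set (B := Cmod u * Rabs K + 1). assert (HB : 0 < B) by (unfold B; nra).
  set (s0 := Rmin (s / 2) (eps / B)).
  assert (Hs0 : 0 < s0) by (apply Rmin_glb_lt; [lra|apply Rdiv_lt_0_compat; lra]).
  assert (Hs01 : s0 <= s / 2) by apply Rmin_l. assert (Hs02 : s0 <= eps / B) by apply Rmin_r.
  destruct (mean_value (fun t => Re (u * f t)%C - Cmod u * (c / INR (S j)) * t ^ S j)
    (fun t => Re (u * f' t)%C - Cmod u * c * t ^ j) s0 s) as [x [Hx E]]; [lra| |].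
  - intros x Hx. apply (is_derive_minus (fun t => Re (u * f t)%C)); [apply Hder; lra|].
    replace (Cmod u * c * x ^ j) with (Cmod u * (c / INR (S j)) * (INR (S j) * 1 * x ^ j)) by (field; lra).
    apply (is_derive_scal (fun t => t ^ S j)). apply (is_derive_pow (fun t => t) (S j) x 1). apply is_derive_Reals, derivable_pt_lim_id.
  - assert (HR : Re (u * f' x)%C <= Cmod u * (c * x ^ j)).
    { eapply Rle_trans; [apply Rle_abs|]. eapply Rle_trans; [apply re_le_Cmod|]. rewrite Cmod_mult.
      apply Rmult_le_compat_l; auto. apply Hb. lra. }
    assert (H1 : (Re (u * f' x)%C - Cmod u * c * x ^ j) * (s - s0) <= 0) by nra.
    assert (H2 : Re (u * f s0)%C <= Cmod u * (Rabs K * s0)).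
    { eapply Rle_trans; [apply Rle_abs|]. eapply Rle_trans; [apply re_le_Cmod|]. rewrite Cmod_mult.
      apply Rmult_le_compat_l; auto. specialize (H0 s0 ltac:(lra)). nra. }
    assert (H3 : 0 <= Cmod u * (c / INR (S j)) * s0 ^ S j).
    { repeat apply Rmult_le_pos; auto; [left; apply Rinv_0_lt_compat; auto|lra|apply pow_le; lra]. }
    assert (H4 : Cmod u * (Rabs K * s0) <= eps).
    { apply Rle_trans with (s0 * B); [unfold B; lra|].
      apply Rle_trans with (eps / B * B); [apply Rmult_le_compat_r; lra|]. right. field. lra. }
    cbv beta in E. lra.
Qed.

(* The coefficient bound [a / s^2] is singular, but [a < k (k - 1)] makes integrating twice a
   contraction on functions of size [s^k]. *)
Lemma singular_uniqueness (D D1 D2 : R -> C) d a K K1 k : (2 <= k)%nat -> 0 <= a < INR k * INR (k - 1) ->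
  (forall u s, 0 < s < d -> is_derive (fun t => Re (u * D t)%C) s (Re (u * D1 s)%C)) ->
  (forall u s, 0 < s < d -> is_derive (fun t => Re (u * D1 t)%C) s (Re (u * D2 s)%C)) ->
  (forall s, 0 < s < d -> Cmod (D2 s) <= a / s ^ 2 * Cmod (D s)) ->
  (forall s, 0 < s < d -> Cmod (D s) <= K * s ^ k) ->
  (forall s, 0 < s < d -> Cmod (D1 s) <= K1 * s) ->
  d <= 1 -> forall s, 0 < s < d -> D s = 0%C /\ D1 s = 0%C.
Proof.
  intros Hk Ha HD HD1 HD2 HK HK1 Hd1.
  destruct k as [|[|k]]; try lia. replace (S (S k) - 1)%nat with (S k) in Ha by lia.
  pose proof (lt_0_INR (S k) ltac:(lia)) as P1. pose proof (lt_0_INR (S (S k)) ltac:(lia)) as P2.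
  set (q := a / (INR (S (S k)) * INR (S k))).
  assert (Hq : 0 <= q < 1).
  { unfold q. split; [apply Rmult_le_pos; [lra|left; apply Rinv_0_lt_compat, Rmult_lt_0_compat; auto]|].
    apply Rmult_lt_reg_r with (INR (S (S k)) * INR (S k)); [apply Rmult_lt_0_compat; auto|].
    unfold Rdiv. rewrite Rmult_assoc, Rinv_l, Rmult_1_l, Rmult_1_r; [lra|]. apply Rgt_not_eq, Rmult_lt_0_compat; auto. }
  assert (Step : forall M, 0 <= M -> (forall s, 0 < s < d -> Cmod (D s) <= M * s ^ S (S k)) ->
    (forall s, 0 < s < d -> Cmod (D1 s) <= a * M / INR (S k) * s ^ S k) /\
    (forall s, 0 < s < d -> Cmod (D s) <= q * M * s ^ S (S k))).
  { intros M HM H.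
    assert (HaM : 0 <= a * M) by (apply Rmult_le_pos; lra).
    assert (S1 : forall s, 0 < s < d -> Cmod (D1 s) <= a * M / INR (S k) * s ^ S k).
    { apply (integrate_bound D1 D2 d (a * M) K1 k); auto. intros s Hs.
      eapply Rle_trans; [apply HD2; auto|]. specialize (H s Hs).
      assert (0 < s ^ 2) by (apply pow_lt; lra).
      apply Rle_trans with (a / s ^ 2 * (M * s ^ S (S k))).
      - apply Rmult_le_compat_l; auto. apply Rmult_le_pos; [lra|left; apply Rinv_0_lt_compat; auto].
      - right. simpl. field. lra. }
    split; auto. intros s Hs.
    replace (q * M * s ^ S (S k)) with ((a * M / INR (S k)) / INR (S (S k)) * s ^ S (S k)) by (unfold q; field; lra).
    apply (integrate_bound D D1 d (a * M / INR (S k)) (Rabs K) (S k)); auto.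
    - apply Rmult_le_pos; auto. left; apply Rinv_0_lt_compat; auto.
    - intros t Ht. eapply Rle_trans; [apply HK; auto|]. pose proof (Rle_abs K). pose proof (Rabs_pos K).
      assert (t ^ S (S k) <= t).
      { rewrite <- (Rmult_1_r t) at 2. rewrite <- tech_pow_Rmult. apply Rmult_le_compat_l; [lra|].
        rewrite <- (pow1 (S k)). apply pow_incr. lra. }
      assert (0 <= t ^ S (S k)) by (apply pow_le; lra).
      apply Rle_trans with (Rabs K * t ^ S (S k)); [apply Rmult_le_compat_r; auto|apply Rmult_le_compat_l; auto]. }
  assert (It : forall n s, 0 < s < d -> Cmod (D s) <= Rabs K * q ^ n * s ^ S (S k)).
  { induction n as [|n IH].
    - intros s Hs. simpl (q ^ 0). rewrite Rmult_1_r. eapply Rle_trans; [apply HK; auto|].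
      apply Rmult_le_compat_r; [apply pow_le; lra|apply Rle_abs].
    - replace (Rabs K * q ^ S n) with (q * (Rabs K * q ^ n)) by (simpl; ring).
      apply Step; auto. apply Rmult_le_pos; [apply Rabs_pos|apply pow_le; lra]. }
  assert (D0 : forall s, 0 < s < d -> Cmod (D s) <= 0).
  { intros s Hs. apply le_epsilon. intros eps He. rewrite Rplus_0_l.
    destruct (pow_lt_1_zero q) with (y := eps / (Rabs K + 1)) as [n Hn].
    - rewrite Rabs_right; lra.
    - apply Rdiv_lt_0_compat; auto. pose proof (Rabs_pos K); lra.
    - specialize (Hn n (le_n _)). rewrite Rabs_right in Hn by (apply Rle_ge, pow_le; lra).
      eapply Rle_trans; [apply (It n); auto|]. pose proof (Rabs_pos K).
      assert (0 <= q ^ n) by (apply pow_le; lra).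
      assert (0 <= s ^ S (S k) <= 1).
      { split; [apply pow_le; lra|]. rewrite <- (pow1 (S (S k))). apply pow_incr; lra. }
      assert (Rabs K * q ^ n <= eps).
      { apply Rle_trans with ((Rabs K + 1) * q ^ n); [nra|].
        apply Rle_trans with ((Rabs K + 1) * (eps / (Rabs K + 1))); [apply Rmult_le_compat_l; lra|].
        right; field; lra. }
      assert (0 <= Rabs K * q ^ n) by (apply Rmult_le_pos; auto). nra. }
  intros s Hs. split.
  - apply Cmod_eq_0, Rle_antisym; [apply D0; auto|apply Cmod_ge_0].
  - destruct (Step 0) as [S1 _]; [lra| |].
    + intros t Ht. rewrite Rmult_0_l. auto.
    + apply Cmod_eq_0, Rle_antisym; [|apply Cmod_ge_0]. eapply Rle_trans; [apply S1; auto|].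
      rewrite Rmult_0_r. unfold Rdiv. rewrite !Rmult_0_l. lra.
Qed.

Lemma cderiv_line_diff f g a b d s l m u : cderiv f (a + RtoC s * d)%C l -> cderiv g (b + RtoC s * d)%C m ->
  is_derive (fun t : R => Re (u * (f (a + RtoC t * d) - g (b + RtoC t * d)))%C) s (Re (u * (d * (l - m)))%C).
Proof.
  intros Hf Hg.
  replace (Re (u * (d * (l - m)))%C) with (Re (u * (d * l))%C - Re (u * (d * m))%C) by (unfold Re; simpl; ring).
  apply (is_derive_ext (fun t => Re (u * f (a + RtoC t * d))%C - Re (u * g (b + RtoC t * d))%C)).
  - intros t. unfold Re; simpl; ring.
  - apply (is_derive_minus (fun t => Re (u * f (a + RtoC t * d))%C)); apply cderiv_line; auto.
Qed.

(* Applied with [A = 1], [k = 2] at regular points and with [A = 13], [k = 5] at poles, where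
   [6 (P + Q)] is close to [12 / s ^ 2]. *)
Lemma flow_uniqueness w1 w2 v1 v2 (a b d : C) e A K K1 k :
  is_lattice_basis w1 w2 -> is_lattice_basis v1 v2 -> G_sum w1 w2 4 = G_sum v1 v2 4 ->
  Cmod d = 1 -> (2 <= k)%nat -> 0 <= A < INR k * INR (k - 1) -> e <= 1 ->
  (forall s, 0 < s < e -> off_lat w1 w2 (a + RtoC s * d)%C /\ off_lat v1 v2 (b + RtoC s * d)%C) ->
  (forall s, 0 < s < e -> Cmod (wp_fun w1 w2 (a + RtoC s * d) - wp_fun v1 v2 (b + RtoC s * d))%C <= K * s ^ k) ->
  (forall s, 0 < s < e -> Cmod (E_fun w1 w2 3 (a + RtoC s * d) - E_fun v1 v2 3 (b + RtoC s * d))%C <= K1 * s) ->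
  (forall s, 0 < s < e -> 6 * Cmod (wp_fun w1 w2 (a + RtoC s * d) + wp_fun v1 v2 (b + RtoC s * d))%C <= A / s ^ 2) ->
  forall s, 0 < s < e -> wp_fun w1 w2 (a + RtoC s * d)%C = wp_fun v1 v2 (b + RtoC s * d)%C /\
    E_fun w1 w2 3 (a + RtoC s * d)%C = E_fun v1 v2 3 (b + RtoC s * d)%C.
Proof.
  intros HL HL' HG Hd Hk HA He Hn HK HK1 HB s Hs.
  destruct (singular_uniqueness
    (fun t => wp_fun w1 w2 (a + RtoC t * d) - wp_fun v1 v2 (b + RtoC t * d))%C
    (fun t => (- (2) * d) * (E_fun w1 w2 3 (a + RtoC t * d) - E_fun v1 v2 3 (b + RtoC t * d)))%C
    (fun t => (6 * d ^ 2) * (E_fun w1 w2 4 (a + RtoC t * d) - E_fun v1 v2 4 (b + RtoC t * d)))%C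
    e A K (2 * K1) k) with (s := s) as [E1 E2]; auto.
  - intros u t Ht. destruct (Hn t Ht) as [N1 N2].
    pose proof (cderiv_line_diff _ _ a b d t _ _ u (cderiv_wp_fun w1 w2 _ HL N1) (cderiv_wp_fun v1 v2 _ HL' N2)) as H.
    match type of H with is_derive _ _ ?x => match goal with |- is_derive _ _ ?y => replace y with x; auto end end.
    f_equal. ring.
  - intros u t Ht. destruct (Hn t Ht) as [N1 N2].
    pose proof (cderiv_line_diff _ _ a b d t _ _ (u * (- (2) * d))%C (cderiv_E_fun w1 w2 3 _ HL N1 ltac:(lia)) (cderiv_E_fun v1 v2 3 _ HL' N2 ltac:(lia))) as H.
    match type of H with is_derive _ _ ?x => match goal with |- is_derive _ _ ?y => replace y with x end end.
    + eapply is_derive_ext; [|exact H]. intros x. cbv beta. f_equal. ring.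
    + f_equal. simpl INR. replace (1 + 1 + 1) with 3 by ring. ring.
  - intros t Ht. destruct (Hn t Ht) as [N1 N2]. rewrite !E4_fun_ode, HG by auto. specialize (HB t Ht).
    set (P := wp_fun w1 w2 (a + RtoC t * d)%C) in *. set (Q := wp_fun v1 v2 (b + RtoC t * d)%C) in *.
    replace (6 * d ^ 2 * (P ^ 2 - 5 * G_sum v1 v2 4 - (Q ^ 2 - 5 * G_sum v1 v2 4)))%C with (6 * (d ^ 2 * (P + Q) * (P - Q)))%C by ring.
    rewrite Cmod_nat, !Cmod_mult, Cmod_pow, Hd by lra. pose proof (Cmod_ge_0 (P - Q)%C).
    replace (6 * (1 ^ 2 * Cmod (P + Q)%C * Cmod (P - Q)%C)) with (6 * Cmod (P + Q)%C * Cmod (P - Q)%C) by ring.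
    apply Rmult_le_compat_r; auto.
  - intros t Ht. rewrite Cmod_mult. replace (Cmod (- (2) * d)%C) with 2; [specialize (HK1 t Ht); lra|].
    rewrite Cmod_mult, Cmod_opp, Cmod_R, Hd, Rabs_right; lra.
  - split; apply Cminus_eq0; auto.
    assert (Hdn : d <> 0%C) by (apply Cmod_gt_0; lra).
    match type of E2 with (?c * ?x)%C = _ => replace x with (/ c * (c * x))%C end.
    + rewrite E2. ring.
    + field. auto.
Qed.

(** Two poles count as matched, so that the relation is open and closed under simultaneous
    translation and can be carried through poles. *)
Definition matched (w1 w2 v1 v2 a b : C) : Prop :=
  (~ off_lat w1 w2 a /\ ~ off_lat v1 v2 b) \/
  (off_lat w1 w2 a /\ off_lat v1 v2 b /\ wp_fun w1 w2 a = wp_fun v1 v2 b /\ E_fun w1 w2 3 a = E_fun v1 v2 3 b).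

Lemma matched_sym w1 w2 v1 v2 a b : matched w1 w2 v1 v2 a b -> matched v1 v2 w1 w2 b a.
Proof. unfold matched. intuition. Qed.

Lemma off_lat_open w1 w2 z : is_lattice_basis w1 w2 -> off_lat w1 w2 z ->
  exists e, 0 < e /\ forall h, Cmod h < e -> off_lat w1 w2 (z + h)%C.
Proof.
  intros HL Hz. destruct (inv_low _ _ HL z) as [K [HK0 HK]].
  exists (/ (2 * K)). split; [apply Rinv_0_lt_compat; lra|]. intros h Hh p E.
  destruct (inv_near (z - pt w1 w2 p)%C h) as [H _]; [apply off_lat_sub; auto| |].
  - pose proof (inv_lnorm_range p). specialize (HK p). pose proof (Cmod_ge_0 h).
    apply Rle_trans with (/ (2 * K) * K); [|right; field; lra].
    apply Rmult_le_compat; try apply Cmod_ge_0; try lra. nra.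
  - apply H. rewrite <- E. ring.
Qed.

Lemma polar (h : C) : h <> 0%C -> exists d, Cmod d = 1 /\ h = (RtoC (Cmod h) * d)%C.
Proof.
  intros Hh. assert (Hp : 0 < Cmod h) by (apply Cmod_gt_0; auto).
  assert (Hn : RtoC (Cmod h) <> 0%C) by (intros E; apply RtoC_inj in E; lra).
  exists (h / RtoC (Cmod h))%C. split; [|field; auto].
  rewrite Cmod_div, Cmod_R, Rabs_right by (auto; lra). field. lra.
Qed.

(** Equal values and equal derivatives make the difference [O(s ^ 2)], whence [k = 2]. The
    coefficient is bounded near regular points, and a radius at most [/ B] puts that bound below
    [1 / s ^ 2]. *)
Lemma matched_open_regular w1 w2 v1 v2 a b :
  is_lattice_basis w1 w2 -> is_lattice_basis v1 v2 -> G_sum w1 w2 4 = G_sum v1 v2 4 ->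
  off_lat w1 w2 a -> off_lat v1 v2 b -> wp_fun w1 w2 a = wp_fun v1 v2 b -> E_fun w1 w2 3 a = E_fun v1 v2 3 b ->
  exists e, 0 < e /\ forall h, Cmod h < e -> matched w1 w2 v1 v2 (a + h)%C (b + h)%C.
Proof.
  intros HL HL' HG Ha Hb EP E3.
  destruct (off_lat_open _ _ _ HL Ha) as [e1 [He1 N1]]. destruct (off_lat_open _ _ _ HL' Hb) as [e2 [He2 N2]].
  destruct (cderiv_pos _ _ _ (cderiv_wp_fun w1 w2 a HL Ha)) as [K1 [e3 [HK1 [He3 C1]]]].
  destruct (cderiv_pos _ _ _ (cderiv_wp_fun v1 v2 b HL' Hb)) as [K2 [e4 [HK2 [He4 C2]]]].
  destruct (cderiv_lip _ _ _ (cderiv_wp_fun w1 w2 a HL Ha)) as [L1 [e5 [HL1 [He5 D1]]]].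
  destruct (cderiv_lip _ _ _ (cderiv_wp_fun v1 v2 b HL' Hb)) as [L2 [e6 [HL2 [He6 D2]]]].
  destruct (cderiv_lip _ _ _ (cderiv_E_fun w1 w2 3 a HL Ha ltac:(lia))) as [M1 [e7 [HM1 [He7 F1]]]].
  destruct (cderiv_lip _ _ _ (cderiv_E_fun v1 v2 3 b HL' Hb ltac:(lia))) as [M2 [e8 [HM2 [He8 F2]]]].
  set (B := 6 * (Cmod (wp_fun w1 w2 a) + Cmod (wp_fun v1 v2 b) + L1 + L2) + 1).
  pose proof (Cmod_ge_0 (wp_fun w1 w2 a)). pose proof (Cmod_ge_0 (wp_fun v1 v2 b)).
  assert (HB : 1 <= B) by (unfold B; lra).
  set (e := Rmin (/ B) (Rmin (Rmin (Rmin e1 e2) (Rmin e3 e4)) (Rmin (Rmin e5 e6) (Rmin e7 e8)))).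
  assert (HBi : 0 < / B <= 1).
  { split; [apply Rinv_0_lt_compat; lra|]. rewrite <- Rinv_1. apply Rinv_le_contravar; lra. }
  assert (He : 0 < e) by (unfold e; repeat apply Rmin_glb_lt; lra).
  assert (Hmin : e <= / B /\ e <= e1 /\ e <= e2 /\ e <= e3 /\ e <= e4 /\ e <= e5 /\ e <= e6 /\ e <= e7 /\ e <= e8).
  { unfold e. repeat split; repeat (apply Rle_refl || (eapply Rle_trans; [apply Rmin_l|apply Rle_refl])
      || idtac); unfold Rmin; repeat destruct Rle_dec; lra. }
  destruct Hmin as [m0 [m1 [m2 [m3 [m4 [m5 [m6 [m7 m8]]]]]]]].
  exists e. split; auto. intros h Hh.
  destruct (Ceq_dec h 0%C) as [->|Hh0].
  { right. replace (a + 0)%C with a by ring. replace (b + 0)%C with b by ring. auto. }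
  destruct (polar h Hh0) as [d [Hd Eh]]. assert (Hhp : 0 < Cmod h) by (apply Cmod_gt_0; auto).
  assert (Hsd : forall s, 0 < s < e -> Cmod (RtoC s * d)%C = s).
  { intros s Hs. rewrite Cmod_nat, Hd by lra. ring. }
  right. split; [apply N1; lra|]. split; [apply N2; lra|]. rewrite Eh.
  apply (flow_uniqueness w1 w2 v1 v2 a b d e 1 (K1 + K2) (M1 + M2) 2); auto; try (simpl; lra).
  - intros s Hs. split; [apply N1|apply N2]; rewrite Hsd; lra.
  - intros s Hs. specialize (C1 (RtoC s * d)%C ltac:(rewrite Hsd; lra)).
    specialize (C2 (RtoC s * d)%C ltac:(rewrite Hsd; lra)). rewrite Hsd in C1, C2 by auto.
    rewrite EP, E3 in C1.
    match type of C1 with Cmod ?x <= _ => match type of C2 with Cmod ?y <= _ =>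
      match goal with |- Cmod ?z <= _ => replace z with (x + - y)%C by ring end end end.
    eapply Rle_trans; [apply Cmod_triangle|]. rewrite Cmod_opp. lra.
  - intros s Hs. specialize (F1 (RtoC s * d)%C ltac:(rewrite Hsd; lra)).
    specialize (F2 (RtoC s * d)%C ltac:(rewrite Hsd; lra)). rewrite Hsd in F1, F2 by auto.
    rewrite E3 in F1.
    match type of F1 with Cmod ?x <= _ => match type of F2 with Cmod ?y <= _ =>
      match goal with |- Cmod ?z <= _ => replace z with (x + - y)%C by ring end end end.
    eapply Rle_trans; [apply Cmod_triangle|]. rewrite Cmod_opp. lra.
  - intros s Hs. specialize (D1 (RtoC s * d)%C ltac:(rewrite Hsd; lra)).
    specialize (D2 (RtoC s * d)%C ltac:(rewrite Hsd; lra)). rewrite Hsd in D1, D2 by auto.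
    assert (L1 * s <= L1) by nra. assert (L2 * s <= L2) by nra.
    set (P := wp_fun w1 w2 (a + RtoC s * d)%C) in *. set (Q := wp_fun v1 v2 (b + RtoC s * d)%C) in *.
    apply Rle_trans with B.
    + replace (P + Q)%C with ((P - wp_fun w1 w2 a) + (Q - wp_fun v1 v2 b) + (wp_fun w1 w2 a + wp_fun v1 v2 b))%C by ring.
      pose proof (Cmod_triangle3 (P - wp_fun w1 w2 a)%C (Q - wp_fun v1 v2 b)%C (wp_fun w1 w2 a + wp_fun v1 v2 b)%C).
      pose proof (Cmod_triangle (wp_fun w1 w2 a) (wp_fun v1 v2 b)). unfold B. lra.
    + assert (Hs2 : 0 < s ^ 2) by (apply pow_lt; lra).
      apply Rmult_le_reg_r with (s ^ 2); auto. replace (1 / s ^ 2 * s ^ 2) with 1 by (field; lra).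
      assert (s * B <= 1). { apply Rle_trans with (/ B * B); [apply Rmult_le_compat_r; lra|]. right; field; lra. }
      assert (s <= 1) by lra. replace (B * s ^ 2) with (s * B * s) by ring. nra.
Qed.

(** After translation to the origin, equal invariants make the two expansions agree through [z ^ 4],
    whence [k = 5]; the requirement on the coefficient is [13 < 5 * 4]. *)
Lemma matched_open_pole w1 w2 v1 v2 a b :
  is_lattice_basis w1 w2 -> is_lattice_basis v1 v2 -> G_sum w1 w2 4 = G_sum v1 v2 4 -> G_sum w1 w2 6 = G_sum v1 v2 6 ->
  ~ off_lat w1 w2 a -> ~ off_lat v1 v2 b ->
  exists e, 0 < e /\ forall h, Cmod h < e -> matched w1 w2 v1 v2 (a + h)%C (b + h)%C.
Proof.
  intros HL HL' HG4 HG6 Ha Hb.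
  destruct (not_off_lat _ _ _ Ha) as [p Ep]. destruct (not_off_lat _ _ _ Hb) as [q Eq].
  destruct (near0 _ _ HL) as [L1 [HL1 N1]]. destruct (near0 _ _ HL') as [L2 [HL2 N2]].
  destruct (bounded_near0_wp_rem _ _ HL) as [K1 [e1 [He1 C1]]]. destruct (bounded_near0_wp_rem _ _ HL') as [K2 [e2 [He2 C2]]].
  destruct (bounded_near0_E3_rem _ _ HL) as [M1 [e3 [He3 D1]]]. destruct (bounded_near0_E3_rem _ _ HL') as [M2 [e4 [He4 D2]]].
  set (g4 := G_sum w1 w2 4) in *. set (g6 := G_sum w1 w2 6) in *.
  assert (HX : bounded_near0 (fun z => 3 * z * g4 + 5 * z ^ 3 * g6 + z ^ 4 * wp_rem w1 w2 z +
     (3 * z * g4 + 5 * z ^ 3 * g6 + z ^ 4 * wp_rem v1 v2 z))%C).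
  { pose proof (bounded_near0_wp_rem _ _ HL). pose proof (bounded_near0_wp_rem _ _ HL'). bounded_near0_tac. }
  destruct HX as [K3 [e5 [He5 C3]]].
  pose proof (Rabs_pos K3) as HK30. pose proof (Rle_abs K3) as HK31.
  (* This radius makes [6 s |Y| <= 1 <= / s ^ 2] below, which fills the margin between 12 and 13. *)
  set (e6 := / (6 * Rabs K3 + 1)).
  assert (He6 : 0 < e6 <= 1).
  { unfold e6. split; [apply Rinv_0_lt_compat; lra|]. rewrite <- Rinv_1. apply Rinv_le_contravar; lra. }
  assert (Hl1 : 0 < / (2 * L1)) by (apply Rinv_0_lt_compat; lra).
  assert (Hl2 : 0 < / (2 * L2)) by (apply Rinv_0_lt_compat; lra).
  set (e := Rmin (Rmin (/ (2 * L1)) (/ (2 * L2))) (Rmin (Rmin e1 e2) (Rmin (Rmin e3 e4) (Rmin e5 e6)))).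
  assert (He : 0 < e) by (unfold e; repeat apply Rmin_glb_lt; lra).
  assert (Hmin : e <= / (2 * L1) /\ e <= / (2 * L2) /\ e <= e1 /\ e <= e2 /\ e <= e3 /\ e <= e4 /\ e <= e5 /\ e <= e6).
  { unfold e, Rmin. repeat destruct Rle_dec; lra. }
  destruct Hmin as [m1 [m2 [m3 [m4 [m5 [m6 [m7 m8]]]]]]].
  exists e. split; auto. intros h Hh.
  destruct (Ceq_dec h 0%C) as [->|Hh0].
  { left. replace (a + 0)%C with a by ring. replace (b + 0)%C with b by ring. auto. }
  destruct (polar h Hh0) as [d [Hd Eh]]. assert (Hhp : 0 < Cmod h) by (apply Cmod_gt_0; auto).
  assert (Hsd : forall s, 0 < s < e -> Cmod (RtoC s * d)%C = s).
  { intros s Hs. rewrite Cmod_nat, Hd by lra. ring. }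
  assert (Hsd0 : forall s, 0 < s < e -> (RtoC s * d)%C <> 0%C).
  { intros s Hs. apply Cmod_gt_0. rewrite Hsd; lra. }
  assert (Nw : forall s, 0 < s < e -> off_lat w1 w2 (RtoC s * d)%C).
  { intros s Hs. apply N1; auto. rewrite Hsd; lra. }
  assert (Nv : forall s, 0 < s < e -> off_lat v1 v2 (RtoC s * d)%C).
  { intros s Hs. apply N2; auto. rewrite Hsd; lra. }
  assert (Na : forall s, 0 < s < e -> off_lat w1 w2 (a + RtoC s * d)%C).
  { intros s Hs. rewrite Ep, Cplus_comm. apply off_lat_shift; auto. }
  assert (Nb : forall s, 0 < s < e -> off_lat v1 v2 (b + RtoC s * d)%C).
  { intros s Hs. rewrite Eq, Cplus_comm. apply off_lat_shift; auto. }
  right. rewrite Eh. split; [apply Na; lra|]. split; [apply Nb; lra|].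
  assert (EPw : forall s, 0 < s < e -> wp_fun w1 w2 (a + RtoC s * d)%C = wp_fun w1 w2 (RtoC s * d)%C).
  { intros s Hs. rewrite Ep, Cplus_comm. apply wp_fun_shift; auto. }
  assert (EPv : forall s, 0 < s < e -> wp_fun v1 v2 (b + RtoC s * d)%C = wp_fun v1 v2 (RtoC s * d)%C).
  { intros s Hs. rewrite Eq, Cplus_comm. apply wp_fun_shift; auto. }
  assert (EEw : forall s, 0 < s < e -> E_fun w1 w2 3 (a + RtoC s * d)%C = E_fun w1 w2 3 (RtoC s * d)%C).
  { intros s Hs. rewrite Ep, Cplus_comm. apply E_fun_shift; auto. }
  assert (EEv : forall s, 0 < s < e -> E_fun v1 v2 3 (b + RtoC s * d)%C = E_fun v1 v2 3 (RtoC s * d)%C).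
  { intros s Hs. rewrite Eq, Cplus_comm. apply E_fun_shift; auto. }
  apply (flow_uniqueness w1 w2 v1 v2 a b d e 13 (K1 + K2) (Rabs M1 + Rabs M2) 5); auto; try (simpl; lra); try lia.
  - intros s Hs. rewrite EPw, EPv, !wp_fun_laurent, <- HG4, <- HG6 by auto. fold g4 g6. set (z := (RtoC s * d)%C) in *.
    match goal with |- Cmod ?x <= _ => replace x with (z ^ 5 * (wp_rem w1 w2 z + - wp_rem v1 v2 z))%C by ring end.
    specialize (C1 z (Hsd0 s Hs) ltac:(unfold z; rewrite Hsd; lra)).
    specialize (C2 z (Hsd0 s Hs) ltac:(unfold z; rewrite Hsd; lra)).
    rewrite Cmod_mult, Cmod_pow. unfold z at 1. rewrite Hsd by auto.
    rewrite Rmult_comm. apply Rmult_le_compat_r; [apply pow_le; lra|].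
    eapply Rle_trans; [apply Cmod_triangle|]. rewrite Cmod_opp. lra.
  - intros s Hs. rewrite EEw, EEv, !E3_fun_laurent, <- HG4, <- HG6 by auto. fold g4 g6. set (z := (RtoC s * d)%C) in *.
    match goal with |- Cmod ?x <= _ => replace x with (z ^ 4 * (E3_rem w1 w2 z + - E3_rem v1 v2 z))%C by ring end.
    specialize (D1 z (Hsd0 s Hs) ltac:(unfold z; rewrite Hsd; lra)).
    specialize (D2 z (Hsd0 s Hs) ltac:(unfold z; rewrite Hsd; lra)).
    rewrite Cmod_mult, Cmod_pow. unfold z at 1. rewrite Hsd by auto.
    pose proof (Rle_abs M1). pose proof (Rle_abs M2).
    pose proof (Cmod_triangle (E3_rem w1 w2 z) (- E3_rem v1 v2 z)%C) as HT. rewrite Cmod_opp in HT.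
    rewrite Rmult_comm. apply Rmult_le_compat; [apply Cmod_ge_0|apply pow_le; lra|lra|].
    rewrite <- (Rmult_1_r s) at 2. replace (s ^ 4) with (s * s ^ 3) by ring.
    apply Rmult_le_compat_l; [lra|]. rewrite <- (pow1 3). apply pow_incr. lra.
  - intros s Hs. rewrite EPw, EPv, !wp_fun_laurent, <- HG4, <- HG6 by auto. fold g4 g6. set (z := (RtoC s * d)%C) in *.
    assert (Hz : z <> 0%C) by (apply Hsd0; auto).
    specialize (C3 z Hz ltac:(unfold z; rewrite Hsd; lra)). cbv beta in C3.
    match type of C3 with Cmod ?y <= _ => match goal with |- 6 * Cmod ?x <= _ =>
      replace x with (2 * (/ z) ^ 2 + z * y)%C by ring end; set (Y := y) in * end.
    pose proof (Cmod_triangle (2 * (/ z) ^ 2)%C (z * Y)%C) as HT.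
    rewrite Cmod_nat, Cmod_pow, Cmod_inv, Cmod_mult in HT by (auto; lra).
    replace (Cmod z) with s in HT by (unfold z; rewrite Hsd; auto).
    assert (Hs2 : 0 < s ^ 2) by (apply pow_lt; lra).
    replace (13 / s ^ 2) with (12 * (/ s) ^ 2 + / s ^ 2) by (field; lra).
    assert (H1 : 6 * (s * Cmod Y) <= 1).
    { apply Rle_trans with (e6 * (6 * Rabs K3 + 1)); [|unfold e6; right; field; lra].
      replace (6 * (s * Cmod Y)) with (s * (6 * Cmod Y)) by ring.
      pose proof (Cmod_ge_0 Y). apply Rmult_le_compat; lra. }
    assert (H2 : 1 <= / s ^ 2).
    { rewrite <- Rinv_1. apply Rinv_le_contravar; auto. rewrite <- (pow1 2). apply pow_incr. lra. }
    lra.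
Qed.

Lemma matched_open w1 w2 v1 v2 a b :
  is_lattice_basis w1 w2 -> is_lattice_basis v1 v2 -> G_sum w1 w2 4 = G_sum v1 v2 4 -> G_sum w1 w2 6 = G_sum v1 v2 6 ->
  matched w1 w2 v1 v2 a b ->
  exists e, 0 < e /\ forall h, Cmod h < e -> matched w1 w2 v1 v2 (a + h)%C (b + h)%C.
Proof.
  intros HL HL' H4 H6 [[Ha Hb]|[Ha [Hb [E1 E2]]]]; [apply matched_open_pole|apply matched_open_regular]; auto.
Qed.

Lemma pole_blowup w1 w2 B : is_lattice_basis w1 w2 -> exists e, 0 < e /\
  forall z : C, z <> 0%C -> Cmod z < e -> B < Cmod (wp_fun w1 w2 z).
Proof.
  intros HL.
  assert (HX : bounded_near0 (fun z => 3 * z ^ 2 * G_sum w1 w2 4 + 5 * z ^ 4 * G_sum w1 w2 6 + z ^ 5 * wp_rem w1 w2 z)%C).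
  { pose proof (bounded_near0_wp_rem _ _ HL). bounded_near0_tac. }
  destruct HX as [K [e [He HK]]]. pose proof (Rabs_pos K). pose proof (Rabs_pos B).
  pose proof (Rle_abs K). pose proof (Rle_abs B).
  set (M := Rabs K + Rabs B + 1).
  assert (HMi : 0 < / M <= 1).
  { unfold M. split; [apply Rinv_0_lt_compat; lra|]. rewrite <- Rinv_1. apply Rinv_le_contravar; lra. }
  exists (Rmin e (/ M)). split; [apply Rmin_glb_lt; lra|]. intros z Hz Hzs.
  pose proof (Rmin_l e (/ M)). pose proof (Rmin_r e (/ M)).
  specialize (HK z Hz ltac:(lra)). cbv beta in HK.
  assert (Hzp : 0 < Cmod z) by (apply Cmod_gt_0; auto).
  assert (HM : M < / Cmod z).
  { rewrite <- (Rinv_inv M). apply Rinv_lt_contravar; [apply Rmult_lt_0_compat|]; lra. }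
  match type of HK with Cmod ?y <= _ => set (Y := y) in * end.
  assert (E : ((/ z) ^ 2)%C = (wp_fun w1 w2 z + - Y)%C) by (rewrite wp_fun_laurent by auto; unfold Y; ring).
  assert (HT : (/ Cmod z) ^ 2 <= Cmod (wp_fun w1 w2 z) + Cmod Y).
  { rewrite <- Cmod_inv, <- Cmod_pow, E by auto. eapply Rle_trans; [apply Cmod_triangle|]. rewrite Cmod_opp. lra. }
  assert (HM1 : 1 <= M) by (unfold M; lra). assert (HM2 : M = Rabs K + Rabs B + 1) by reflexivity. clearbody M.
  assert (M <= (/ Cmod z) ^ 2) by nra. lra.
Qed.

(** If [a] were regular and [b] a pole, then at matched pairs close to them [wp_fun] would be
    bounded on one side and arbitrarily large on the other. *)
Lemma matched_closed_half w1 w2 v1 v2 a b : is_lattice_basis w1 w2 -> is_lattice_basis v1 v2 ->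
  (forall e, 0 < e -> exists h, Cmod h < e /\ matched w1 w2 v1 v2 (a + h)%C (b + h)%C) ->
  off_lat w1 w2 a -> off_lat v1 v2 b.
Proof.
  intros HL HL' H Ha. destruct (classic (off_lat v1 v2 b)) as [|Hb]; auto. exfalso.
  destruct (not_off_lat _ _ _ Hb) as [q Eq].
  destruct (off_lat_open _ _ _ HL Ha) as [e1 [He1 N1]].
  destruct (cderiv_lip _ _ _ (cderiv_wp_fun w1 w2 a HL Ha)) as [L1 [e2 [HL1 [He2 D1]]]].
  destruct (pole_blowup v1 v2 (Cmod (wp_fun w1 w2 a) + L1) HL') as [e3 [He3 B3]].
  destruct (H (Rmin (Rmin e1 1) (Rmin e2 e3))) as [h [Hh HM]]; [repeat apply Rmin_glb_lt; lra|].
  assert (Hm : Cmod h < e1 /\ Cmod h < 1 /\ Cmod h < e2 /\ Cmod h < e3).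
  { revert Hh. unfold Rmin. repeat destruct Rle_dec; lra. }
  destruct Hm as [h1 [h2 [h3 h4]]]. destruct HM as [[F _]|[_ [F [E _]]]]; [apply F, N1; auto|].
  specialize (D1 h h3).
  assert (Hh0 : h <> 0%C).
  { intros ->. apply Hb. replace b with (b + 0)%C by ring. auto. }
  assert (Nh : off_lat v1 v2 h).
  { replace h with (b + h - pt v1 v2 q)%C by (rewrite Eq; ring). apply off_lat_shift_m; auto. }
  specialize (B3 h Hh0 h4). rewrite Eq, (Cplus_comm (pt v1 v2 q) h), wp_fun_shift in E by auto. rewrite <- E in B3.
  assert (Cmod (wp_fun w1 w2 (a + h)%C) <= Cmod (wp_fun w1 w2 (a + h) - wp_fun w1 w2 a)%C + Cmod (wp_fun w1 w2 a)).
  { eapply Rle_trans; [|apply Cmod_triangle]. right. f_equal. ring. }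
  pose proof (Cmod_ge_0 h). nra.
Qed.

Lemma matched_closed w1 w2 v1 v2 a b : is_lattice_basis w1 w2 -> is_lattice_basis v1 v2 ->
  (forall e, 0 < e -> exists h, Cmod h < e /\ matched w1 w2 v1 v2 (a + h)%C (b + h)%C) ->
  matched w1 w2 v1 v2 a b.
Proof.
  intros HL HL' H.
  assert (H1 := matched_closed_half w1 w2 v1 v2 a b HL HL' H).
  assert (H2 : off_lat v1 v2 b -> off_lat w1 w2 a).
  { apply (matched_closed_half v1 v2 w1 w2 b a HL' HL). intros e He. destruct (H e He) as [h [Hh HM]].
    exists h. split; auto. apply matched_sym; auto. }
  destruct (classic (off_lat w1 w2 a)) as [Ha|Ha]; [|left; tauto]. right. assert (Hb := H1 Ha).
  split; auto. split; auto.
  destruct (off_lat_open _ _ _ HL Ha) as [e1 [He1 N1]].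
  (* Differentiability gives a Lipschitz bound at [a] and [b], so equality at arbitrarily close
     matched pairs passes to the limit; this serves for [wp_fun] and for [E_fun]. *)
  assert (Lim : forall f g : C -> C, (exists l, cderiv f a l) -> (exists m, cderiv g b m) ->
    (forall x y, matched w1 w2 v1 v2 x y -> off_lat w1 w2 x -> f x = g y) -> f a = g b).
  { intros f g [l Hf] [m Hg] Hfg.
    destruct (cderiv_lip _ _ _ Hf) as [L1 [e2 [HL1 [He2 D1]]]]. destruct (cderiv_lip _ _ _ Hg) as [L2 [e3 [HL2 [He3 D2]]]].
    apply Cminus_eq0, Cmod_eq_0, Rle_antisym; [|apply Cmod_ge_0]. apply le_epsilon. intros eps He.
    assert (Hep : 0 < eps / (L1 + L2 + 1)) by (apply Rdiv_lt_0_compat; lra).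
    destruct (H (Rmin (Rmin e1 (eps / (L1 + L2 + 1))) (Rmin e2 e3))) as [h [Hh HM]]; [repeat apply Rmin_glb_lt; lra|].
    assert (Hm : Cmod h < e1 /\ Cmod h < eps / (L1 + L2 + 1) /\ Cmod h < e2 /\ Cmod h < e3).
    { revert Hh. unfold Rmin. repeat destruct Rle_dec; lra. }
    destruct Hm as [h1 [h2 [h3 h4]]]. specialize (D1 h h3). specialize (D2 h h4).
    rewrite (Hfg _ _ HM (N1 h h1)) in D1.
    replace (f a - g b)%C with ((g (b + h) - g b) + - (g (b + h) - f a))%C by ring.
    eapply Rle_trans; [apply Cmod_triangle|]. rewrite Cmod_opp.
    pose proof (Cmod_ge_0 h).
    apply Rle_trans with ((L1 + L2 + 1) * Cmod h); [lra|].
    apply Rle_trans with ((L1 + L2 + 1) * (eps / (L1 + L2 + 1))); [apply Rmult_le_compat_l; lra|].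
    right. field. lra. }
  split; apply Lim.
  - exists (- (2) * E_fun w1 w2 3 a)%C. apply cderiv_wp_fun; auto.
  - exists (- (2) * E_fun v1 v2 3 b)%C. apply cderiv_wp_fun; auto.
  - intros x y [[F _]|[_ [_ [E _]]]] Hx; tauto.
  - eexists. apply cderiv_E_fun; auto; lia.
  - eexists. apply cderiv_E_fun; auto; lia.
  - intros x y [[F _]|[_ [_ [_ E]]]] Hx; tauto.
Qed.

(** Connectedness of the unit interval, by the supremum of the initial segments on which [P]
    holds. *)
Lemma clopen_interval (P : R -> Prop) : P 0 ->
  (forall s, P s -> exists e, 0 < e /\ forall t, Rabs (t - s) < e -> P t) ->
  (forall s, (forall e, 0 < e -> exists t, Rabs (t - s) < e /\ P t) -> P s) -> P 1.
Proof.
  intros H0 Ho Hc.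
  destruct (completeness (fun x => 0 <= x <= 1 /\ forall y, 0 <= y <= x -> P y)) as [S [HS1 HS2]].
  { exists 1. intros x [Hx _]. lra. }
  { exists 0. split; [lra|]. intros y Hy. replace y with 0 by lra. auto. }
  assert (HS0 : 0 <= S).
  { apply HS1. split; [lra|]. intros y Hy. replace y with 0 by lra. auto. }
  assert (HSl : S <= 1) by (apply HS2; intros x [Hx _]; lra).
  assert (Hbelow : forall y, 0 <= y < S -> P y).
  { intros y Hy. destruct (classic (exists x, y < x /\ 0 <= x <= 1 /\ forall z, 0 <= z <= x -> P z)) as [[x [Hx1 [Hx2 Hx3]]]|Hn].
    - apply Hx3. lra.
    - exfalso. assert (S <= y); [|lra]. apply HS2. intros x [Hx1 Hx2].
      destruct (Rle_or_lt x y); auto. exfalso. apply Hn. exists x. auto. }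
  assert (wp_fun : P S).
  { destruct (Req_dec S 0) as [->|Hne]; auto. apply Hc. intros e He.
    exists (Rmax 0 (S - e / 2)). split.
    - unfold Rmax. destruct Rle_dec; rewrite Rabs_left; lra.
    - apply Hbelow. unfold Rmax. destruct Rle_dec; lra. }
  destruct (Ho S wp_fun) as [e [He Hopen]].
  destruct (Rle_or_lt 1 S) as [|Hlt]; [replace 1 with S by lra; auto|]. exfalso.
  assert (Rmin 1 (S + e / 2) <= S); [|unfold Rmin in *; destruct Rle_dec; lra].
  apply HS1. split; [unfold Rmin; destruct Rle_dec; lra|]. intros y Hy.
  destruct (Rlt_or_le y S); [apply Hbelow; lra|]. apply Hopen.
  rewrite Rabs_right; [|lra]. revert Hy. unfold Rmin. destruct Rle_dec; lra.
Qed.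

(** Being matched is open and closed along the segment from 0 to [t], poles included. *)
Lemma matched_everywhere w1 w2 v1 v2 a b t :
  is_lattice_basis w1 w2 -> is_lattice_basis v1 v2 -> G_sum w1 w2 4 = G_sum v1 v2 4 -> G_sum w1 w2 6 = G_sum v1 v2 6 ->
  matched w1 w2 v1 v2 a b -> matched w1 w2 v1 v2 (a + t)%C (b + t)%C.
Proof.
  intros HL HL' H4 H6 H0.
  replace (a + t)%C with (a + RtoC 1 * t)%C by ring. replace (b + t)%C with (b + RtoC 1 * t)%C by ring.
  pose proof (Cmod_ge_0 t) as Ht.
  assert (Hsc : forall x e, 0 < e -> Rabs x < e / (1 + Cmod t) -> Cmod (RtoC x * t)%C < e).
  { intros x e He Hx. rewrite Cmod_mult, Cmod_R.
    apply Rmult_lt_compat_r with (r := 1 + Cmod t) in Hx; [|lra].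
    replace (e / (1 + Cmod t) * (1 + Cmod t)) with e in Hx by (field; lra). pose proof (Rabs_pos x). nra. }
  assert (Hadd : forall x s r : C, (x + s * t + (r - s) * t)%C = (x + r * t)%C) by (intros; ring).
  apply (clopen_interval (fun s => matched w1 w2 v1 v2 (a + RtoC s * t)%C (b + RtoC s * t)%C)).
  - replace (a + 0 * t)%C with a by ring. replace (b + 0 * t)%C with b by ring. auto.
  - intros s Hs. destruct (matched_open _ _ _ _ _ _ HL HL' H4 H6 Hs) as [e [He Ho]].
    exists (e / (1 + Cmod t)). split; [apply Rdiv_lt_0_compat; lra|]. intros r Hr.
    rewrite <- (Hadd a s r), <- (Hadd b s r). apply Ho. rewrite <- RtoC_minus. apply Hsc; auto.
  - intros s Hs. apply matched_closed; auto. intros e He.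
    destruct (Hs (e / (1 + Cmod t))) as [r [Hr HM]]; [apply Rdiv_lt_0_compat; lra|].
    exists (RtoC (r - s) * t)%C. split; [apply Hsc; auto|]. rewrite RtoC_minus, !Hadd. auto.
Qed.

(** Both lattices contain 0, so 0 is matched with itself; translation by [z] then shows that [z]
    lies in both lattices or in neither. *)
Lemma same_invariants_same_lattice w1 w2 v1 v2 :
  is_lattice_basis w1 w2 -> is_lattice_basis v1 v2 -> G_sum w1 w2 4 = G_sum v1 v2 4 -> G_sum w1 w2 6 = G_sum v1 v2 6 ->
  same_lattice w1 w2 v1 v2.
Proof.
  intros HL HL' H4 H6 z.
  assert (H0 : matched w1 w2 v1 v2 0%C 0%C).
  { left. split; intros H; apply (H (0,0)%Z); rewrite pt_0; auto. }
  apply (matched_everywhere _ _ _ _ _ _ z HL HL' H4 H6) in H0. rewrite Cplus_0_l in H0.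
  unfold matched in H0. tauto.
Qed.

(** One lattice is compared with itself from two starting points: translation by [- b] moves [b] to
    the pole at 0, so its partner [a - b] is a pole as well. *)
Lemma wp_injective w1 w2 a b : is_lattice_basis w1 w2 -> off_lat w1 w2 a -> off_lat w1 w2 b ->
  wp_fun w1 w2 a = wp_fun w1 w2 b -> E_fun w1 w2 3 a = E_fun w1 w2 3 b -> exists p, (a - b)%C = pt w1 w2 p.
Proof.
  intros HL Ha Hb E1 E2. apply not_off_lat.
  assert (H0 : matched w1 w2 w1 w2 a b) by (right; auto).
  apply (matched_everywhere _ _ _ _ _ _ (- b)%C HL HL eq_refl eq_refl) in H0.
  destruct H0 as [[H _]|[_ [H _]]]; auto. exfalso. apply (H (0,0)%Z). rewrite pt_0. ring.
Qed.

(** * Lattices with real invariants *)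

(** Reality is asked of the invariants alone. Stability under conjugation follows in [real_same]:
    the conjugate basis has conjugate, hence equal, invariants. *)
Definition real_lattice (w1 w2 : C) : Prop :=
  is_lattice_basis w1 w2 /\ Im (G_sum w1 w2 4) = 0 /\ Im (G_sum w1 w2 6) = 0.

Lemma Cconj_real (z : C) : Im z = 0 -> Cconj z = z.
Proof. intros H. apply injective_projections; simpl; auto. unfold Im in H. rewrite H. ring. Qed.
Lemma real_Cconj (z : C) : Cconj z = z -> Im z = 0.
Proof. intros H. assert (E : Im (Cconj z) = Im z) by (rewrite H; auto). rewrite im_conj in E. lra. Qed.
Lemma Cconj_RtoC (x : R) : Cconj (RtoC x) = RtoC x.
Proof. apply injective_projections; simpl; ring. Qed.
Lemma real_eq (z : C) : Im z = 0 -> z = RtoC (Re z).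
Proof. intros H. apply injective_projections; simpl; auto. Qed.

Lemma real_same w1 w2 : real_lattice w1 w2 -> same_lattice (Cconj w1) (Cconj w2) w1 w2.
Proof.
  intros [HL [H4 H6]]. apply same_invariants_same_lattice; auto.
  - apply basis_conj; auto.
  - rewrite G_sum_conj by (auto; lia). apply Cconj_real; auto.
  - rewrite G_sum_conj by (auto; lia). apply Cconj_real; auto.
Qed.
Lemma real_off_lat w1 w2 z : real_lattice w1 w2 -> off_lat w1 w2 z -> off_lat w1 w2 (Cconj z).
Proof. intros HR Hz. apply (real_same w1 w2 HR). apply off_lat_conj; auto. Qed.
Lemma real_wp_fun w1 w2 z : real_lattice w1 w2 -> off_lat w1 w2 z -> wp_fun w1 w2 (Cconj z) = Cconj (wp_fun w1 w2 z).
Proof.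
  intros HR Hz. rewrite <- wp_fun_conj by (auto; apply HR). symmetry.
  apply same_lattice_wp_fun; [apply basis_conj, HR|apply HR|apply real_same; auto|apply off_lat_conj; auto].
Qed.
Lemma real_zeta_fun w1 w2 z : real_lattice w1 w2 -> off_lat w1 w2 z -> zeta_fun w1 w2 (Cconj z) = Cconj (zeta_fun w1 w2 z).
Proof.
  intros HR Hz. rewrite <- zeta_fun_conj by (auto; apply HR). symmetry.
  apply same_lattice_zeta_fun; [apply basis_conj, HR|apply HR|apply real_same; auto|apply off_lat_conj; auto].
Qed.
Lemma real_E_fun w1 w2 k z : real_lattice w1 w2 -> (3 <= k)%nat -> E_fun w1 w2 k (Cconj z) = Cconj (E_fun w1 w2 k z).
Proof.
  intros HR Hk. rewrite <- E_fun_conj by (auto; apply HR). symmetry.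
  apply same_lattice_E_fun; [apply basis_conj, HR|apply HR|apply real_same; auto|auto].
Qed.

(** * The first real half period *)

Definition wp_real w1 w2 (t : R) : R := Re (wp_fun w1 w2 (RtoC t)).
Definition E3_real w1 w2 (t : R) : R := Re (E_fun w1 w2 3 (RtoC t)).

Lemma wp_fun_real w1 w2 t : real_lattice w1 w2 -> off_lat w1 w2 (RtoC t) -> wp_fun w1 w2 (RtoC t) = RtoC (wp_real w1 w2 t).
Proof.
  intros HR Ht. apply real_eq, real_Cconj. rewrite <- real_wp_fun, Cconj_RtoC; auto.
Qed.
Lemma E_fun_real w1 w2 t : real_lattice w1 w2 -> E_fun w1 w2 3 (RtoC t) = RtoC (E3_real w1 w2 t).
Proof.
  intros HR. apply real_eq, real_Cconj. rewrite <- real_E_fun, Cconj_RtoC; auto.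
Qed.

Lemma cderiv_real f (t : R) l : cderiv f (RtoC t) l -> is_derive (fun x => Re (f (RtoC x))) t (Re l).
Proof.
  intros H. assert (H' : cderiv f (0 + RtoC t * 1)%C l) by (replace (0 + RtoC t * 1)%C with (RtoC t) by ring; auto).
  apply (cderiv_line f 0%C 1%C t l 1%C) in H'. replace (Re (1 * (1 * l))%C) with (Re l) in H' by (unfold Re; simpl; ring).
  eapply is_derive_ext; [|exact H']. intros x. cbv beta.
  replace (0 + RtoC x * 1)%C with (RtoC x) by ring. unfold Re; simpl; ring.
Qed.

Lemma wp_real_derive w1 w2 t : is_lattice_basis w1 w2 -> off_lat w1 w2 (RtoC t) -> is_derive (wp_real w1 w2) t (-2 * E3_real w1 w2 t).
Proof.
  intros HL Ht. replace (-2 * E3_real w1 w2 t) with (Re (- (2) * E_fun w1 w2 3 (RtoC t))%C) by (unfold E3_real, Re; simpl; ring).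
  apply (cderiv_real (wp_fun w1 w2)), cderiv_wp_fun; auto.
Qed.
Lemma E3_real_derive w1 w2 t : is_lattice_basis w1 w2 -> off_lat w1 w2 (RtoC t) -> exists l, is_derive (E3_real w1 w2) t l.
Proof. intros HL Ht. eexists. apply (cderiv_real (E_fun w1 w2 3)), cderiv_E_fun; auto. Qed.

Lemma derive_continuity f t l : is_derive f t l -> continuity_pt f t.
Proof. intros H. apply derivable_continuous_pt. exists l. apply is_derive_Reals; auto. Qed.

Lemma wp_real_cont w1 w2 t : is_lattice_basis w1 w2 -> off_lat w1 w2 (RtoC t) -> continuity_pt (wp_real w1 w2) t.
Proof. intros. eapply derive_continuity, wp_real_derive; auto. Qed.
Lemma E3_real_cont w1 w2 t : is_lattice_basis w1 w2 -> off_lat w1 w2 (RtoC t) -> continuity_pt (E3_real w1 w2) t.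
Proof. intros HL Ht. destruct (E3_real_derive w1 w2 t HL Ht) as [l H]. eapply derive_continuity; eauto. Qed.

Lemma continuity_pt_near f t e : continuity_pt f t -> 0 < e ->
  exists d, 0 < d /\ forall x, Rabs (x - t) < d -> Rabs (f x - f t) < e.
Proof.
  intros H He. destruct (H e He) as [d [Hd HH]]. exists d. split; auto. intros x Hx.
  destruct (Req_dec x t) as [->|Hne]; [replace (f t - f t) with 0 by ring; rewrite Rabs_R0; auto|].
  apply HH. split; [split; [exact I|auto]|exact Hx].
Qed.

Lemma real_pole (f : C -> C) (Y : C -> C) n B : bounded_near0 Y -> (1 <= n)%nat ->
  (forall z : C, z <> 0%C -> f z = ((/ z) ^ n + Y z)%C) ->
  exists e, 0 < e /\ forall t : R, 0 < t < e -> B < Re (f (RtoC t)).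
Proof.
  intros [K [e [He HK]]] Hn Hf. pose proof (Rabs_pos K). pose proof (Rabs_pos B).
  pose proof (Rle_abs K). pose proof (Rle_abs B).
  set (M := Rabs K + Rabs B + 1).
  assert (HMi : 0 < / M <= 1).
  { unfold M. split; [apply Rinv_0_lt_compat; lra|]. rewrite <- Rinv_1. apply Rinv_le_contravar; lra. }
  exists (Rmin e (/ M)). split; [apply Rmin_glb_lt; lra|]. intros t Ht.
  pose proof (Rmin_l e (/ M)). pose proof (Rmin_r e (/ M)).
  assert (Hz : RtoC t <> 0%C) by (intros F; apply RtoC_inj in F; lra).
  specialize (HK _ Hz ltac:(rewrite Cmod_R, Rabs_right; lra)).
  rewrite Hf by auto. rewrite re_plus, <- RtoC_inv, <- RtoC_pow by lra.
  change (Re (RtoC ((/ t) ^ n))) with ((/ t) ^ n).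
  pose proof (re_le_Cmod (Y (RtoC t))) as HY. apply Rabs_le_between in HY.
  assert (HM : M < / t).
  { rewrite <- (Rinv_inv M). apply Rinv_lt_contravar; [apply Rmult_lt_0_compat|]; lra. }
  assert (HM1 : 1 <= M) by (unfold M; lra).
  assert (M < (/ t) ^ n).
  { apply Rlt_le_trans with ((/ t) ^ 1); [lra|]. apply Rle_pow; [lra|auto]. }
  unfold M in *. lra.
Qed.

Lemma wp_real_pole w1 w2 B : is_lattice_basis w1 w2 -> exists e, 0 < e /\ forall t, 0 < t < e -> B < wp_real w1 w2 t.
Proof.
  intros HL. apply (real_pole (wp_fun w1 w2)
    (fun z => 3 * z ^ 2 * G_sum w1 w2 4 + 5 * z ^ 4 * G_sum w1 w2 6 + z ^ 5 * wp_rem w1 w2 z)%C 2); auto.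
  - pose proof (bounded_near0_wp_rem _ _ HL). bounded_near0_tac.
  - intros z Hz. rewrite wp_fun_laurent by auto. ring.
Qed.
Lemma E3_real_pole w1 w2 B : is_lattice_basis w1 w2 -> exists e, 0 < e /\ forall t, 0 < t < e -> B < E3_real w1 w2 t.
Proof.
  intros HL. apply (real_pole (E_fun w1 w2 3)
    (fun z => - (3) * z * G_sum w1 w2 4 - 10 * z ^ 3 * G_sum w1 w2 6 + z ^ 4 * E3_rem w1 w2 z)%C 3); auto.
  - pose proof (bounded_near0_E3_rem _ _ HL). bounded_near0_tac.
  - intros z Hz. rewrite E3_fun_laurent by auto. ring.
Qed.

Section RealPeriod.
Context (w1 w2 : C) (q2 q3 e om : R).
Context (HR : real_lattice w1 w2).
Context (Hq2 : (60 * G_sum w1 w2 4)%C = RtoC q2) (Hq3 : (140 * G_sum w1 w2 6)%C = RtoC q3).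
Let Q s := 4 * s ^ 3 - q2 * s - q3.
Context (Qe : Q e = 0) (Qpos : forall s, e < s -> 0 < Q s).
Context (Hom : is_RInt_gen (fun s => / sqrt (Q s)) (at_right e) (Rbar_locally p_infty) om).
Let HL : is_lattice_basis w1 w2 := proj1 HR.
Let p := wp_real w1 w2.
Let f s := / sqrt (Q s).

Lemma ode_complex z : off_lat w1 w2 z ->
  (4 * E_fun w1 w2 3 z ^ 2 = 4 * wp_fun w1 w2 z ^ 3 - RtoC q2 * wp_fun w1 w2 z - RtoC q3)%C.
Proof. intros Hz. rewrite E3_fun_ode by auto. rewrite <- Hq2, <- Hq3. ring. Qed.

Lemma ode_real t : off_lat w1 w2 (RtoC t) -> (2 * E3_real w1 w2 t) ^ 2 = Q (p t).
Proof.
  intros Ht. pose proof (ode_complex _ Ht) as H. rewrite wp_fun_real, E_fun_real in H by auto. unfold Q, p.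
  apply RtoC_inj. rewrite !RtoC_minus, !RtoC_mult, !RtoC_pow, !RtoC_mult. rewrite <- H. ring.
Qed.

(** An interval starting at the pole 0 on which [wp] is regular with nonvanishing derivative; there
    [p] can serve as a variable of integration. *)
Definition good T := forall x, 0 < x < T -> off_lat w1 w2 (RtoC x) /\ E3_real w1 w2 x <> 0.

Lemma good_pos T x : good T -> 0 < x < T -> 0 < E3_real w1 w2 x.
Proof.
  intros HT Hx. destruct (Rtotal_order (E3_real w1 w2 x) 0) as [H|[H|H]]; [|destruct (HT x Hx); tauto|auto].
  exfalso. destruct (E3_real_pole w1 w2 0 HL) as [d [Hd Hp]].
  set (x0 := Rmin (x / 2) (d / 2)). assert (H0 : 0 < x0) by (apply Rmin_glb_lt; lra).
  assert (x0 <= x / 2) by apply Rmin_l. assert (x0 <= d / 2) by apply Rmin_r.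
  specialize (Hp x0 ltac:(lra)).
  destruct (Ranalysis5.IVT_interv (fun y => - E3_real w1 w2 y) x0 x) as [y [Hy Ey]]; try lra.
  - intros a Ha. apply continuity_pt_opp, E3_real_cont; auto. apply (HT a). lra.
  - destruct (HT y ltac:(lra)). lra.
Qed.

(** Near the pole [p] is large; on reaching [e] the cubic would vanish, and with it [E3_real],
    against [good]. *)
Lemma good_above T x : good T -> 0 < x < T -> e < p x.
Proof.
  intros HT Hx.
  assert (Hne : forall y, 0 < y < T -> p y <> e).
  { intros y Hy E. pose proof (ode_real y (proj1 (HT y Hy))) as H. rewrite E, Qe in H.
    pose proof (good_pos T y HT Hy). assert (0 < (2 * E3_real w1 w2 y) ^ 2) by (apply pow_lt; lra). lra. }
  destruct (Rtotal_order (p x) e) as [H|[H|H]]; [|destruct (Hne x Hx H)|auto].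
  exfalso. destruct (wp_real_pole w1 w2 e HL) as [d [Hd Hp]].
  set (x0 := Rmin (x / 2) (d / 2)). assert (H0 : 0 < x0) by (apply Rmin_glb_lt; lra).
  assert (x0 <= x / 2) by apply Rmin_l. assert (x0 <= d / 2) by apply Rmin_r.
  specialize (Hp x0 ltac:(lra)). fold p in Hp.
  destruct (Ranalysis5.IVT_interv (fun y => e - p y) x0 x) as [y [Hy Ey]]; try lra.
  - intros a Ha. apply continuity_pt_minus; [apply continuity_pt_const; intros ? ?; auto|].
    apply wp_real_cont; auto. apply (HT a). lra.
  - apply (Hne y); lra.
Qed.

Lemma good_decr T s t : good T -> 0 < s -> s < t -> t < T -> p t < p s.
Proof.
  intros HT Hs Hst Ht.
  destruct (mean_value p (fun x => -2 * E3_real w1 w2 x) s t Hst) as [c [Hc E]].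
  - intros x Hx. apply wp_real_derive; auto. apply (HT x). lra.
  - pose proof (good_pos T c HT ltac:(lra)). nra.
Qed.

Lemma f_cont u : e < u -> continuous f u.
Proof.
  intros Hu. pose proof (Qpos u Hu) as HQ. apply continuity_pt_filterlim.
  apply (continuity_pt_inv (fun s => sqrt (Q s))).
  - apply (continuity_pt_comp Q sqrt); [|apply continuity_pt_sqrt; lra].
    unfold Q. apply derivable_continuous_pt. reg.
  - apply Rgt_not_eq, sqrt_lt_R0; auto.
Qed.

Lemma f_ex a b : e < a -> a <= b -> ex_RInt f a b.
Proof.
  intros Ha Hab. apply (@ex_RInt_continuous R_CompleteNormedModule). intros x Hx. rewrite Rmin_left in Hx by lra. apply f_cont. lra.
Qed.

Lemma f_ge0 a b : e < a -> a <= b -> 0 <= RInt f a b.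
Proof.
  intros Ha Hab. apply RInt_ge_0; auto; [apply f_ex; auto|]. intros x Hx. left. apply Rinv_0_lt_compat, sqrt_lt_R0, Qpos. lra.
Qed.

Lemma f_mono a x y b : e < a -> a <= x -> x <= y -> y <= b -> RInt f x y <= RInt f a b.
Proof.
  intros Ha H1 H2 H3.
  rewrite <- (RInt_Chasles f a x b), <- (RInt_Chasles f x y b) by (apply f_ex; lra).
  pose proof (f_ge0 a x Ha H1). pose proof (f_ge0 y b ltac:(lra) H3). unfold plus; simpl. lra.
Qed.

Lemma f_total eps : 0 < eps -> exists d M, 0 < d /\ forall a b, e < a < e + d -> M < b -> a <= b ->
  Rabs (RInt f a b - om) < eps.
Proof.
  intros He. destruct (Hom (ball om (mkposreal eps He)) (locally_ball _ _)) as [P P' [d Hd] [M HM] H].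
  exists d, M. split; [apply cond_pos|]. intros a b Ha Hb Hab.
  destruct (H a b) as [y [Hy1 Hy2]].
  - apply Hd; [|lra]. unfold ball; simpl; unfold AbsRing_ball, abs, minus, plus, opp; simpl. rewrite Rabs_right; lra.
  - apply HM; auto.
  - simpl in Hy1. apply (@is_RInt_unique R_CompleteNormedModule) in Hy1. unfold f. rewrite Hy1. exact Hy2.
Qed.

(** Under the substitution by [p], whose derivative is [-2 * E3_real], positivity gives
    [sqrt (Q (p y)) = 2 * E3_real y], and the integrand becomes -1. *)
Lemma good_time T s t : good T -> 0 < s -> s < t -> t < T -> RInt f (p t) (p s) = t - s.
Proof.
  intros HT Hs Hst Ht.
  assert (H : is_RInt (fun y => scal (-2 * E3_real w1 w2 y) (f (p y))) s t (RInt f (p s) (p t))).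
  { apply (is_RInt_comp f p (fun y => -2 * E3_real w1 w2 y)); rewrite Rmin_left, Rmax_right by lra; intros x Hx.
    - apply f_cont, (good_above T); auto. lra.
    - split; [apply wp_real_derive; auto; apply (HT x); lra|]. apply continuity_pt_filterlim.
      apply (continuity_pt_scal (E3_real w1 w2)). apply E3_real_cont; auto. apply (HT x). lra. }
  assert (H2 : is_RInt (fun y => scal (-2 * E3_real w1 w2 y) (f (p y))) s t (scal (t - s) (-1))).
  { apply (is_RInt_ext (fun _ => -1)); [|apply (@is_RInt_const R_NormedModule)].
    rewrite Rmin_left, Rmax_right by lra. intros x Hx.
    pose proof (good_pos T x HT ltac:(lra)). unfold f, scal; simpl; unfold mult; simpl.
    fold p. rewrite <- ode_real by (apply (HT x); lra). rewrite sqrt_pow2 by lra. field. lra. }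
  apply (@is_RInt_unique R_CompleteNormedModule) in H. apply (@is_RInt_unique R_CompleteNormedModule) in H2. rewrite H in H2.
  rewrite <- (opp_RInt_swap f).
  - rewrite H2. unfold opp, scal; simpl; unfold mult; simpl. ring.
  - apply ex_RInt_swap, f_ex; [apply (good_above T); auto; lra|]. left. apply (good_decr T s t); auto.
Qed.

(** By [good_time] the length of an inner interval is an integral of the positive function [f] over
    part of its range, hence at most [om] up to [eps]; the inner intervals exhaust the good one. *)
Lemma good_le T : 0 < T -> good T -> T <= om.
Proof.
  intros HT0 HT. apply le_epsilon. intros eps He.
  destruct (f_total (eps / 2)) as [d [M [Hd HM]]]; [lra|].
  set (s := Rmin (T / 4) (eps / 8)). set (t := T - s).
  assert (0 < s) by (apply Rmin_glb_lt; lra). assert (s <= T / 4) by apply Rmin_l. assert (s <= eps / 8) by apply Rmin_r.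
  assert (Hst : s < t < T) by (unfold t; lra).
  pose proof (good_time T s t HT ltac:(lra) ltac:(lra) ltac:(lra)) as E.
  pose proof (good_above T t HT ltac:(lra)) as Ha. pose proof (good_decr T s t HT ltac:(lra) ltac:(lra) ltac:(lra)) as Hdec.
  set (a := Rmin (p t) (e + d / 2)). set (b := Rmax (p s) (M + 1)).
  assert (Ha1 : a <= p t) by apply Rmin_l. assert (Ha2 : a <= e + d / 2) by apply Rmin_r.
  assert (Ha3 : e < a) by (apply Rmin_glb_lt; lra).
  assert (Hb1 : p s <= b) by apply Rmax_l. assert (Hb2 : M + 1 <= b) by apply Rmax_r.
  pose proof (f_mono a (p t) (p s) b Ha3 Ha1 ltac:(lra) Hb1) as Hm.
  specialize (HM a b ltac:(lra) ltac:(lra) ltac:(lra)). apply Rabs_lt_between in HM. unfold t in *. lra.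
Qed.

Lemma off_lat_good : exists T, 0 < T /\ good T.
Proof.
  destruct (E3_real_pole w1 w2 0 HL) as [d [Hd Hp]]. destruct (near0 w1 w2 HL) as [L [HL0 HN]].
  assert (0 < / (2 * L)) by (apply Rinv_0_lt_compat; lra).
  exists (Rmin d (/ (2 * L))). split; [apply Rmin_glb_lt; auto|]. intros x Hx.
  pose proof (Rmin_l d (/ (2 * L))). pose proof (Rmin_r d (/ (2 * L))).
  split; [|specialize (Hp x ltac:(lra)); lra].
  apply HN; [intros F; apply RtoC_inj in F; lra|]. rewrite Cmod_R, Rabs_right; lra.
Qed.

(** Let [T] be the supremum of the good intervals, finite by [good_le]. It is neither a pole nor a
    point past which the good interval extends, so [E3_real] vanishes there; the integral over the
    whole range of [p] then identifies [T] with [om]. *)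
Lemma real_half_period : 0 < om /\ E_fun w1 w2 3 (RtoC om) = 0%C /\
  forall t, 0 < t <= om -> off_lat w1 w2 (RtoC t).
Proof.
  destruct (completeness (fun T => 0 < T /\ good T)) as [T [HT1 HT2]].
  { exists om. intros T [H1 H2]. apply good_le; auto. }
  { destruct off_lat_good as [T HT]. exists T. auto. }
  assert (HT0 : 0 < T).
  { destruct off_lat_good as [T0 HT0]. pose proof (HT1 _ HT0). lra. }
  assert (HT : good T).
  { intros x Hx. destruct (classic (exists T', x < T' /\ good T')) as [[T' [H1 H2]]|Hn]; [apply H2; lra|].
    exfalso. assert (T <= x); [|lra]. apply HT2. intros T' [H1 H2]. destruct (Rle_or_lt T' x); auto.
    exfalso. apply Hn. exists T'. auto. }
  (* At a lattice point, evenness and periodicity would give [p (T - h) = p h], which is large for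
     small [h], whereas [p] decreases. *)
  assert (HnT : off_lat w1 w2 (RtoC T)).
  { destruct (classic (off_lat w1 w2 (RtoC T))) as [|Hn]; auto. exfalso. destruct (not_off_lat _ _ _ Hn) as [q Eq].
    destruct (wp_real_pole w1 w2 (p (T / 2)) HL) as [d [Hd Hp]].
    set (h := Rmin (T / 4) (d / 2)).
    assert (0 < h) by (apply Rmin_glb_lt; lra). assert (h <= T / 4) by apply Rmin_l. assert (h <= d / 2) by apply Rmin_r.
    specialize (Hp h ltac:(lra)). pose proof (good_decr T (T / 2) (T - h) HT ltac:(lra) ltac:(lra) ltac:(lra)) as Hdec.
    assert (E : p (T - h) = wp_real w1 w2 h); [|fold p in E; unfold p in *; lra].
    assert (Hh : off_lat w1 w2 (RtoC h)) by (apply (HT h); lra).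
    unfold p, wp_real. f_equal. rewrite RtoC_minus, Eq. rewrite <- (wp_fun_even w1 w2 (RtoC h)) by auto.
    replace (pt w1 w2 q - RtoC h)%C with (- RtoC h + pt w1 w2 q)%C by ring. apply wp_fun_shift; auto. apply off_lat_opp; auto. }
  assert (HeT : E3_real w1 w2 T = 0).
  { destruct (Req_dec (E3_real w1 w2 T) 0) as [|Hne]; auto. exfalso.
    destruct (off_lat_open w1 w2 _ HL HnT) as [d1 [Hd1 N1]].
    destruct (continuity_pt_near _ _ (Rabs (E3_real w1 w2 T)) (E3_real_cont w1 w2 T HL HnT)) as [d2 [Hd2 C2]]; [apply Rabs_pos_lt; auto|].
    assert (T + Rmin d1 d2 <= T); [|assert (0 < Rmin d1 d2) by (apply Rmin_glb_lt; auto); lra].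
    apply HT1. split; [assert (0 < Rmin d1 d2) by (apply Rmin_glb_lt; auto); lra|]. intros x Hx.
    destruct (Rlt_or_le x T) as [Hlt|Hge]; [apply HT; lra|].
    pose proof (Rmin_l d1 d2). pose proof (Rmin_r d1 d2). split.
    - replace (RtoC x) with (RtoC T + RtoC (x - T))%C by (rewrite RtoC_minus; ring). apply N1. rewrite Cmod_R, Rabs_right; lra.
    - intros F. specialize (C2 x ltac:(rewrite Rabs_right; lra)). rewrite F, Rminus_0_l, Rabs_Ropp in C2. lra. }
  (* [p T] is a root of the cubic, hence not above [e]; it is not below either, because [p] exceeds
     [e] before [T] and is continuous. *)
  assert (HpT : p T = e).
  { assert (E : Q (p T) = 0) by (rewrite <- ode_real, HeT by auto; ring).
    destruct (Rtotal_order (p T) e) as [H|[H|H]]; auto; [|specialize (Qpos _ H); lra]. exfalso.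
    destruct (continuity_pt_near _ _ (e - p T) (wp_real_cont w1 w2 T HL HnT)) as [d [Hd C2]]; [lra|].
    set (h := Rmin (T / 2) (d / 2)).
    assert (0 < h) by (apply Rmin_glb_lt; lra). assert (h <= T / 2) by apply Rmin_l. assert (h <= d / 2) by apply Rmin_r.
    specialize (C2 (T - h) ltac:(rewrite Rabs_left; lra)). apply Rabs_lt_between in C2.
    pose proof (good_above T (T - h) HT ltac:(lra)). unfold p in *. lra. }
  (* On the good interval [p] comes arbitrarily close to [e] and grows beyond every bound, so
     [good_time] on long subintervals comes within [eps] of the full integral. *)
  assert (ET : T = om).
  { apply Rle_antisym; [apply good_le; auto|]. apply le_epsilon. intros eps He.
    destruct (f_total eps He) as [d [M [Hd HM]]].
    destruct (continuity_pt_near _ _ d (wp_real_cont w1 w2 T HL HnT) Hd) as [d2 [Hd2 C2]].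
    destruct (wp_real_pole w1 w2 M HL) as [d3 [Hd3 Hp]].
    set (h := Rmin (T / 4) (d2 / 2)). set (s := Rmin (T / 4) (d3 / 2)).
    assert (0 < h) by (apply Rmin_glb_lt; lra). assert (h <= T / 4) by apply Rmin_l. assert (h <= d2 / 2) by apply Rmin_r.
    assert (0 < s) by (apply Rmin_glb_lt; lra). assert (s <= T / 4) by apply Rmin_l. assert (s <= d3 / 2) by apply Rmin_r.
    specialize (C2 (T - h) ltac:(rewrite Rabs_left; lra)). apply Rabs_lt_between in C2.
    specialize (Hp s ltac:(lra)).
    pose proof (good_time T s (T - h) HT ltac:(lra) ltac:(lra) ltac:(lra)) as E.
    pose proof (good_above T (T - h) HT ltac:(lra)). pose proof (good_decr T s (T - h) HT ltac:(lra) ltac:(lra) ltac:(lra)).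
    unfold p in *.
    specialize (HM (wp_real w1 w2 (T - h)) (wp_real w1 w2 s) ltac:(lra) ltac:(lra) ltac:(lra)).
    rewrite E in HM. apply Rabs_lt_between in HM. lra. }
  rewrite <- ET. split; auto. split; [rewrite E_fun_real, HeT; auto|].
  intros t Ht. destruct (Req_dec t T) as [->|]; auto. apply (HT t). lra.
Qed.

End RealPeriod.

Lemma pt_scal w1 w2 n p : pt w1 w2 ((n * fst p)%Z, (n * snd p)%Z) = (RtoC (IZR n) * pt w1 w2 p)%C.
Proof. unfold pt, lat_pt; simpl. rewrite !mult_IZR, !RtoC_mult. ring. Qed.

(** Reduce [x] modulo [2 * om]. A nonzero remainder [r], or its reflection [2 * om - r] when it
    exceeds [om], would be a lattice point in the range kept free by the hypothesis. *)
Lemma real_lattice_points w1 w2 om x q0 q : 0 < om -> RtoC (2 * om) = pt w1 w2 q0 ->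
  (forall t, 0 < t <= om -> off_lat w1 w2 (RtoC t)) -> RtoC x = pt w1 w2 q -> exists n : Z, x = 2 * om * IZR n.
Proof.
  intros Ho Eo Hn Ex. exists (Int_part (x / (2 * om))). set (n := Int_part (x / (2 * om))).
  destruct (base_Int_part (x / (2 * om))) as [H1 H2]. fold n in H1, H2.
  assert (Ed : x = x / (2 * om) * (2 * om)) by (field; lra).
  set (r := x - 2 * om * IZR n).
  assert (Hr : 0 <= r < 2 * om) by (unfold r; nra).
  assert (Er : RtoC r = pt w1 w2 (padd q (popp ((n * fst q0)%Z, (n * snd q0)%Z)))).
  { rewrite pt_add, pt_opp, pt_scal, <- Ex, <- Eo. unfold r. rewrite RtoC_minus, !RtoC_mult. ring. }
  destruct (Req_dec r 0) as [E0|E0]; [unfold r in E0; lra|]. exfalso.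
  destruct (Rle_or_lt r om) as [H|H]; [apply (Hn r ltac:(lra) _ Er)|].
  apply (Hn (2 * om - r) ltac:(lra) (padd q0 (popp (padd q (popp ((n * fst q0)%Z, (n * snd q0)%Z)))))).
  rewrite pt_add, pt_opp, <- Er, <- Eo, RtoC_minus. reflexivity.
Qed.

(** The quasi-period is found at the reference point [om]: the shift takes it to [- om], and oddness
    gives twice the value at [om]. Induction over the integers then runs in both directions. *)
Lemma zeta_fun_shift_multiple w1 w2 om q0 : is_lattice_basis w1 w2 -> off_lat w1 w2 (RtoC om) -> RtoC (2 * om) = pt w1 w2 q0 ->
  forall n z, off_lat w1 w2 z -> zeta_fun w1 w2 (z + RtoC (2 * om * IZR n))%C = (zeta_fun w1 w2 z + RtoC (2 * IZR n) * zeta_fun w1 w2 (RtoC om))%C.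
Proof.
  intros HL Ho Eo.
  assert (Step : forall z, off_lat w1 w2 z -> zeta_fun w1 w2 (z - RtoC (2 * om))%C = (zeta_fun w1 w2 z - 2 * zeta_fun w1 w2 (RtoC om))%C).
  { intros z Hz. pose proof (zeta_fun_diff_shift_m w1 w2 z (RtoC om) q0 HL Hz Ho) as H. rewrite <- Eo in H.
    replace (RtoC om - RtoC (2 * om))%C with (- RtoC om)%C in H by (rewrite RtoC_mult; ring).
    rewrite zeta_fun_odd in H by auto.
    replace (zeta_fun w1 w2 (z - RtoC (2 * om))%C) with
      ((zeta_fun w1 w2 (z - RtoC (2 * om)) - - zeta_fun w1 w2 (RtoC om)) - zeta_fun w1 w2 (RtoC om))%C by ring.
    rewrite H. ring. }
  assert (Hnl : forall n z, off_lat w1 w2 z -> off_lat w1 w2 (z + RtoC (2 * om * IZR n))%C).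
  { intros n z Hz. rewrite RtoC_mult, Eo, Cmult_comm, <- pt_scal. apply off_lat_shift; auto. }
  assert (Up : forall n z, off_lat w1 w2 z -> zeta_fun w1 w2 (z + RtoC (2 * om * IZR n))%C = (zeta_fun w1 w2 z + RtoC (2 * IZR n) * zeta_fun w1 w2 (RtoC om))%C ->
     zeta_fun w1 w2 (z + RtoC (2 * om * IZR (Z.succ n)))%C = (zeta_fun w1 w2 z + RtoC (2 * IZR (Z.succ n)) * zeta_fun w1 w2 (RtoC om))%C).
  { intros n z Hz IH. pose proof (Step _ (Hnl (Z.succ n) z Hz)) as H.
    rewrite succ_IZR in *.
    replace (z + RtoC (2 * om * (IZR n + 1)) - RtoC (2 * om))%C with (z + RtoC (2 * om * IZR n))%C in H
      by (rewrite !RtoC_mult, RtoC_plus; ring).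
    rewrite IH in H.
    transitivity ((zeta_fun w1 w2 (z + RtoC (2 * om * (IZR n + 1))) - 2 * zeta_fun w1 w2 (RtoC om)) + 2 * zeta_fun w1 w2 (RtoC om))%C; [ring|].
    rewrite <- H, !RtoC_mult, RtoC_plus. ring. }
  assert (Down : forall n z, off_lat w1 w2 z -> zeta_fun w1 w2 (z + RtoC (2 * om * IZR n))%C = (zeta_fun w1 w2 z + RtoC (2 * IZR n) * zeta_fun w1 w2 (RtoC om))%C ->
     zeta_fun w1 w2 (z + RtoC (2 * om * IZR (Z.pred n)))%C = (zeta_fun w1 w2 z + RtoC (2 * IZR (Z.pred n)) * zeta_fun w1 w2 (RtoC om))%C).
  { intros n z Hz IH. pose proof (Step _ (Hnl n z Hz)) as H.
    replace (IZR (Z.pred n)) with (IZR n - 1) by (unfold Z.pred; rewrite plus_IZR; simpl; ring). rewrite IH in H.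
    replace (z + RtoC (2 * om * (IZR n - 1)))%C with (z + RtoC (2 * om * IZR n) - RtoC (2 * om))%C
      by (rewrite !RtoC_mult, RtoC_minus; ring).
    rewrite H, !RtoC_mult, RtoC_minus. ring. }
  intros n z Hz. revert n. apply Z.peano_ind.
  - rewrite !Rmult_0_r. replace (z + 0)%C with z by ring. ring.
  - intros n IH. apply Up; auto.
  - intros n IH. apply Down; auto.
Qed.

Lemma Re0_of_sqr (z : C) r : (z * z)%C = RtoC r -> r <= 0 -> Re z = 0.
Proof.
  intros H Hr. destruct z as [x y]. injection H; intros Hi Hre. simpl in *.
  unfold Re; simpl. destruct (Req_dec x 0) as [|Hx]; auto. exfalso.
  assert (y = 0).
  { assert (x * y = 0) by lra. apply Rmult_integral in H0. tauto. }
  subst y. assert (0 < x * x) by (apply Rsqr_pos_lt in Hx; exact Hx). lra.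
Qed.

Lemma half_period_pairing_imaginary w1 w2 q2 q3 e om rho P :
  is_lattice_basis w1 w2 -> lat_g2 w1 w2 = RtoC q2 -> lat_g3 w1 w2 = RtoC q3 ->
  4 * e ^ 3 - q2 * e - q3 = 0 -> (forall s, e < s -> 0 < 4 * s ^ 3 - q2 * s - q3) ->
  is_RInt_gen (fun s => / sqrt (4 * s ^ 3 - q2 * s - q3)) (at_right e) (Rbar_locally p_infty) om ->
  ~ in_lattice w1 w2 rho -> wp w1 w2 rho = RtoC P -> 4 * P ^ 3 - q2 * P - q3 <= 0 ->
  Re (wzeta w1 w2 rho * RtoC om - wzeta w1 w2 (RtoC om) * rho)%C = 0.
Proof.
  intros HL Hg2 Hg3 Qe Qpos Hom Hrho HP HQ. apply off_lat_not_in in Hrho.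
  rewrite lat_g2_G_sum in Hg2 by auto. rewrite lat_g3_G_sum in Hg3 by auto. rewrite wp_wp_fun in HP by auto.
  assert (HR : real_lattice w1 w2).
  { split; auto. apply (f_equal Im) in Hg2, Hg3. rewrite im_scal_l, im_RtoC in Hg2, Hg3. split; lra. }
  destruct (real_half_period w1 w2 q2 q3 e om HR Hg2 Hg3 Qe Qpos Hom) as [Ho [E3 Hn]].
  assert (Hnom : off_lat w1 w2 (RtoC om)) by (apply Hn; lra).
  (* The derivative vanishes at [om] and is odd, so [om] and [- om] share the values of [wp_fun] and
     of its derivative; by injectivity they differ by a lattice point. *)
  assert (H2om : exists q0, RtoC (2 * om) = pt w1 w2 q0).
  { destruct (wp_injective w1 w2 (RtoC om) (- RtoC om)%C) as [q0 Hq]; auto.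
    - apply off_lat_opp; auto.
    - rewrite wp_fun_even; auto.
    - rewrite E3_fun_odd, E3 by auto. ring.
    - exists q0. rewrite <- Hq, RtoC_mult. ring. }
  destruct H2om as [q0 Eo].
  (* For an imaginary value conjugation is a change of sign, which agrees with the odd parity under
     [rho -> - rho]. *)
  assert (HI : Re (E_fun w1 w2 3 rho) = 0).
  { apply (Re0_of_sqr _ ((4 * P ^ 3 - q2 * P - q3) / 4)); [|lra].
    pose proof (ode_complex w1 w2 q2 q3 HR Hg2 Hg3 rho Hrho) as H. rewrite HP in H.
    transitivity (RtoC (/ 4) * (4 * E_fun w1 w2 3 rho ^ 2))%C.
    - rewrite RtoC_inv by lra. field.
    - rewrite H. unfold Rdiv. rewrite RtoC_mult, !RtoC_minus, !RtoC_mult, RtoC_pow. ring. }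
  destruct (wp_injective w1 w2 (Cconj rho) (- rho)%C) as [q Hq]; auto.
  { apply real_off_lat; auto. }
  { apply off_lat_opp; auto. }
  { rewrite real_wp_fun, wp_fun_even, HP by auto. apply Cconj_RtoC. }
  { rewrite real_E_fun, E3_fun_odd by auto. revert HI. destruct (E_fun w1 w2 3 rho). unfold Re; simpl. intros ->.
    apply injective_projections; simpl; ring. }
  assert (Hx : RtoC (2 * Re rho) = pt w1 w2 q).
  { rewrite <- Hq. apply injective_projections; simpl; unfold Re, Im; ring. }
  destruct (real_lattice_points w1 w2 om _ q0 q Ho Eo Hn Hx) as [n En].
  assert (HZ : Cconj (zeta_fun w1 w2 rho) = (- zeta_fun w1 w2 rho + RtoC (2 * IZR n) * zeta_fun w1 w2 (RtoC om))%C).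
  { rewrite <- real_zeta_fun, <- zeta_fun_odd by auto. rewrite <- (zeta_fun_shift_multiple w1 w2 om q0) by (auto; apply off_lat_opp; auto).
    f_equal. rewrite <- En. apply injective_projections; simpl; unfold Re; ring. }
  assert (HZo : Im (zeta_fun w1 w2 (RtoC om)) = 0).
  { apply real_Cconj. rewrite <- real_zeta_fun, Cconj_RtoC by auto. auto. }
  rewrite !wzeta_zeta_fun by auto.
  apply (f_equal Re) in HZ. rewrite re_conj, re_plus, re_opp, re_scal_l in HZ.
  unfold Cminus. rewrite re_plus, re_opp, re_scal_r, re_mult, HZo.
  replace (Re rho) with (om * IZR n) by lra. replace (Re (zeta_fun w1 w2 rho)) with (IZR n * Re (zeta_fun w1 w2 (RtoC om))) by lra.
  ring.
Qed.

(** * The cubic, the four regimes and the value at [rho] *)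

Lemma cubic_factor c E s : c ^ 2 <> 1 ->
  cubic c E s = 4 * (s - rootA c E) * (s - rootB c E) * (s - rootC c E).
Proof.
  intros Hc. unfold cubic, g2, g3, rootA, rootB, rootC. field. split; intros F; apply Hc; lra.
Qed.

Lemma cubic_e1 c E : c ^ 2 <> 1 -> cubic c E (e1 c E) = 0.
Proof.
  intros Hc. rewrite cubic_factor by auto. unfold e1, Rmax. repeat destruct Rle_dec; ring.
Qed.
Lemma cubic_pos c E s : c ^ 2 <> 1 -> e1 c E < s -> 0 < cubic c E s.
Proof.
  intros Hc Hs. rewrite cubic_factor by auto. unfold e1 in Hs.
  pose proof (Rmax_l (rootA c E) (Rmax (rootB c E) (rootC c E))).
  pose proof (Rmax_r (rootA c E) (Rmax (rootB c E) (rootC c E))).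
  pose proof (Rmax_l (rootB c E) (rootC c E)). pose proof (Rmax_r (rootB c E) (rootC c E)).
  repeat apply Rmult_lt_0_compat; lra.
Qed.

Definition regime (c E : R) : Prop :=
  (Rabs c < 1 /\ E < 0) \/ (Rabs c > 1 /\ E > 2) \/
          (Rabs c < 1 /\ 0 < E <= 2) \/ (Rabs c > 1 /\ 0 < E <= 2).

Lemma regime_square c E : regime c E -> (c ^ 2 < 1 /\ (E < 0 \/ 0 < E <= 2)) \/ (1 < c ^ 2 /\ 0 < E).
Proof.
  intros H. rewrite <- (pow2_abs c). pose proof (Rabs_pos c).
  destruct H as [[H1 H2]|[[H1 H2]|[[H1 H2]|[H1 H2]]]]; [left|right|left|right]; (split; [nra|lra]).
Qed.

(** With [a b = 4 (c ^ 2 - 1)] the numerator is minus [(a - b) ^ 2 + 2 a b E], which also equals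
    [(a + b) ^ 2 + 2 a b (E - 2)]. The first form settles the cases where [c ^ 2 - 1] and [E] have
    the same sign, the second the case [c ^ 2 < 1], [0 < E <= 2]. *)
Lemma Omega2_nonpos c E zeta : regime c E -> zeta <> 0 ->
  (-8 * (c^2 - 1) * (E - 1) - (c - 1)^2 / zeta^2 - 16 * (c + 1)^2 * zeta^2) / 64 <= 0.
Proof.
  intros HE Hz. apply regime_square in HE. set (a := (c - 1) / zeta). set (b := 4 * (c + 1) * zeta).
  assert (Hab : a * b = 4 * (c ^ 2 - 1)) by (unfold a, b; field; auto).
  replace ((-8 * (c^2 - 1) * (E - 1) - (c - 1)^2 / zeta^2 - 16 * (c + 1)^2 * zeta^2) / 64)
    with (- (a ^ 2 + b ^ 2 + 2 * (a * b) * (E - 1)) / 64) by (rewrite Hab; unfold a, b; field; auto).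
  assert (0 <= a ^ 2 + b ^ 2 + 2 * (a * b) * (E - 1)); [|lra].
  assert (S1 : 0 <= (a - b) ^ 2) by apply pow2_ge_0. assert (S2 : 0 <= (a + b) ^ 2) by apply pow2_ge_0.
  destruct HE as [[H1 [H2|H2]]|[H1 H2]].
  - assert (0 <= (a * b) * E) by nra. nra.
  - assert (0 <= (a * b) * (E - 2)) by nra. nra.
  - assert (0 <= (a * b) * E) by nra. nra.
Qed.

(* In terms of [Y = (c - 1)(E - 1) + 4 (c + 1) zeta^2 + 8 zeta tau], where [Omega = i tau], the cubic at
   [wp rho = - C4 / C5] is [- 4 zeta^2 Y^2 / ((c - 1)^6 (c + 1)^2)]. *)
Lemma cubic_at_rho c E zeta tau : c ^ 2 <> 1 -> zeta <> 0 ->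
  - (tau * tau) = (-8 * (c^2 - 1) * (E - 1) - (c - 1)^2 / zeta^2 - 16 * (c + 1)^2 * zeta^2) / 64 ->
  cubic c E (- (8 / 3 * zeta * ((c - 1) * (E - 1) + 12 * (c + 1) * zeta ^ 2 + 24 * zeta * tau))
     / (16 * (c - 1) ^ 2 * (c + 1) * zeta)) <= 0.
Proof.
  intros Hc Hz Ht. rewrite cubic_factor by auto.
  assert (Hn : c - 1 <> 0) by (intros F; apply Hc; replace c with 1 by lra; ring).
  assert (Hm : c + 1 <> 0) by (intros F; apply Hc; replace c with (-1) by lra; ring).
  set (Y := (c - 1) * (E - 1) + 4 * (c + 1) * zeta ^ 2 + 8 * zeta * tau).
  (* The distances of the value to [rootB] and [rootC] are [- (u - (c - 1)) / D] and
     [- (u + (c - 1)) / D]. The equation for [tau] makes [u ^ 2 - (c - 1) ^ 2] a multiple of [Y],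
     which completes the third factor [Y] to a square. *)
  set (u := 4 * (c + 1) * zeta ^ 2 + 8 * zeta * tau).
  assert (Hu : u ^ 2 - (c - 1) ^ 2 = 8 * (c + 1) * zeta ^ 2 * Y).
  { assert (H64 : 64 * zeta ^ 2 * (tau * tau) = 8 * (c ^ 2 - 1) * (E - 1) * zeta ^ 2 + (c - 1) ^ 2 + 16 * (c + 1) ^ 2 * zeta ^ 4).
    { replace (tau * tau) with (- ((-8 * (c^2 - 1) * (E - 1) - (c - 1)^2 / zeta^2 - 16 * (c + 1)^2 * zeta^2) / 64)) by lra.
      field. auto. }
    unfold u, Y.
    replace ((4 * (c + 1) * zeta ^ 2 + 8 * zeta * tau) ^ 2) with
      (16 * (c + 1) ^ 2 * zeta ^ 4 + 64 * (c + 1) * zeta ^ 3 * tau + 64 * zeta ^ 2 * (tau * tau)) by ring.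
    rewrite H64. ring. }
  set (p := - (8 / 3 * zeta * ((c - 1) * (E - 1) + 12 * (c + 1) * zeta ^ 2 + 24 * zeta * tau))
     / (16 * (c - 1) ^ 2 * (c + 1) * zeta)).
  assert (Hd : c ^ 2 - 1 <> 0) by (intros F; apply Hc; lra).
  assert (Hd' : 1 - c ^ 2 <> 0) by (intros F; apply Hc; lra).
  set (D := 2 * (c - 1) ^ 2 * (c + 1)).
  assert (EA : p - rootA c E = - Y / D) by (unfold p, rootA, Y, D; field; auto).
  assert (EB : p - rootB c E = - (u - (c - 1)) / D) by (unfold p, rootB, u, D; field; auto).
  assert (EC : p - rootC c E = - (u + (c - 1)) / D) by (unfold p, rootC, u, D; field; auto).
  rewrite EA, EB, EC.
  replace (4 * (- Y / D) * (- (u - (c - 1)) / D) * (- (u + (c - 1)) / D)) with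
    (- (4 * Y * (u ^ 2 - (c - 1) ^ 2)) / D ^ 3) by (unfold D; field; auto).
  rewrite Hu.
  replace (- (4 * Y * (8 * (c + 1) * zeta ^ 2 * Y)) / D ^ 3) with (- (4 * (zeta * Y / ((c - 1) ^ 3 * (c + 1))) ^ 2))
    by (unfold D; field; auto).
  pose proof (pow2_ge_0 (zeta * Y / ((c - 1) ^ 3 * (c + 1)))). lra.
Qed.

Theorem theorem2 (c E : R)
  (hreg : (Rabs c < 1 /\ E < 0) \/ (Rabs c > 1 /\ E > 2) \/
          (Rabs c < 1 /\ 0 < E <= 2) \/ (Rabs c > 1 /\ 0 < E <= 2))
  (* the period lattice of wp( . ; g2, g3) *)
  (w1 w2 : C) (hlat : is_lattice_basis w1 w2)
  (hg2 : lat_g2 w1 w2 = RtoC (g2 c E)) (hg3 : lat_g3 w1 w2 = RtoC (g3 c E))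
  (* omega_1 = int_{e1}^{oo} ds / sqrt(4 s^3 - g2 s - g3) *)
  (om1 : R)
  (hom1 : is_RInt_gen (fun s => / sqrt (cubic c E s))
            (at_right (e1 c E)) (Rbar_locally p_infty) om1)
  (zeta : R) (hzeta : zeta <> 0)
  (Om : C) (hOm : (Om * Om)%C = Omega2 c E zeta)
  (rho : C) (hrho_nl : ~ in_lattice w1 w2 rho)
  (hrho : wp w1 w2 rho = (- C4 c E zeta Om / C5 c zeta)%C) :
  Re (I_fun c E zeta w1 w2 om1 Om rho) = 0.
Proof.
  assert (Hc : c ^ 2 <> 1) by (destruct (regime_square c E hreg) as [[? _]|[? _]]; lra).
  assert (Hn : c - 1 <> 0) by (intros F; apply Hc; replace c with 1 by lra; ring).
  assert (Hm : c + 1 <> 0) by (intros F; apply Hc; replace c with (-1) by lra; ring).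
  assert (HRe : Re Om = 0) by (apply (Re0_of_sqr Om _ hOm), Omega2_nonpos; auto).
  destruct Om as [x tau]. unfold Re in HRe. simpl in HRe. subst x.
  assert (Ht : - (tau * tau) = (-8 * (c^2 - 1) * (E - 1) - (c - 1)^2 / zeta^2 - 16 * (c + 1)^2 * zeta^2) / 64).
  { apply (f_equal Re) in hOm. unfold Omega2 in hOm. rewrite re_RtoC in hOm. rewrite <- hOm. unfold Re; simpl. ring. }
  (* With [Om = i tau] the product [- 24 i zeta Om] in [C4] becomes the real number
     [24 zeta tau]. *)
  set (P := - (8 / 3 * zeta * ((c - 1) * (E - 1) + 12 * (c + 1) * zeta ^ 2 + 24 * zeta * tau))
     / (16 * (c - 1) ^ 2 * (c + 1) * zeta)).
  assert (Hd : 16 * (c - 1) ^ 2 * (c + 1) * zeta <> 0).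
  { repeat apply Rmult_integral_contrapositive_currified; auto; try lra. }
  assert (HP : wp w1 w2 rho = RtoC P).
  { rewrite hrho. unfold C4, C5, P. rewrite RtoC_div by auto. f_equal.
    apply injective_projections; simpl; ring. }
  unfold I_fun. rewrite re_plus, re_scal_l.
  rewrite (half_period_pairing_imaginary w1 w2 (g2 c E) (g3 c E) (e1 c E) om1 rho P); auto.
  - replace (RtoC (2 * om1) * (Ci * RtoC zeta + (0, tau)) / RtoC (c - 1))%C with
      (RtoC (2 * om1 * / (c - 1)) * (0, (zeta + tau)%R))%C.
    + rewrite re_scal_l. unfold Re; simpl. ring.
    + unfold Cdiv. rewrite RtoC_mult, RtoC_inv by auto.
      replace (Ci * RtoC zeta + (0, tau))%C with ((0, (zeta + tau)%R) : C) by (apply injective_projections; simpl; ring).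
      ring.
  - apply (cubic_e1 c E Hc).
  - intros s Hs. apply (cubic_pos c E s Hc Hs).
  - apply (cubic_at_rho c E zeta tau Hc hzeta Ht).
Qed.
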